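(* (Beurling case) For every $t>0$ there exist $G\in\mathcal{S}^{M_p,t}_{A_p,t}$ and an ultradifferential operator $P(D)$ of class $(M_p)$ such that $P(D)G=\delta$. (Roumieu case) For every $(t_p)\in\mathfrak{R}$ there exist $G\in\mathcal{S}^{M_p,(t_p)}_{A_p,(t_p)}$ and an ultradifferential operator $P(D)$ of class $\{M_p\}$ such that $P(D)G=\delta$.
   Context: $\mathbb{N}=\{0,1,2,\dots\}$, $\mathbb{Z}_+=\{1,2,\dots\}$. $\{M_p\}_{p\in\mathbb{N}}$ and $\{A_p\}_{p\in\mathbb{N}}$ are sequences of positive numbers with $M_0=M_1=A_0=A_1=1$. Both satisfy (M.1) $M_p^2\leq M_{p-1}M_{p+1}$ for $p\in\mathbb{Z}_+$, and (M.2) there are $c_0,H\geq 1$ with $M_p\leq c_0H^p\min_{0\leq q\leq p}\{M_{p-q}M_q\}$ for $p\in\mathbb{N}$ (and likewise for $A_p$, with the same constants). $M_p$ satisfies (M.5): there exists $q>0$ and $c_0\geq1$ such that $\sum_{j=p+1}^{\infty}M_{j-1}^q/M_j^q\leq c_0\,p\,M_p^q/M_{p+1}^q$ for all $p\in\mathbb{Z}_+$. $A_p$ satisfies (M.6): there are $c_0,L_0\geq1$ with $p!\leq c_0L_0^pA_p$ for all $p\in\mathbb{N}$. For a multi-index $\alpha$, $M_\alpha=M_{|\alpha|}$, $D^\alpha=(-i)^{|\alpha|}\partial^\alpha$. $A(\rho)=\sup_{p\in\mathbb{N}}\log_+(\rho^p/A_p)$. $\mathfrak{R}$ is the set of positive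 sequences $(r_p)_{p\in\mathbb{Z}_+}$ increasing to $\infty$; for $(r_p)\in\mathfrak{R}$, $B_{r_p}(\rho)=\sup_{p\in\mathbb{N}}\log_+\big(\rho^p/(A_p\prod_{j=1}^pr_j)\big)$. For $h>0$, $\mathcal{S}^{M_p,h}_{A_p,h}$ is the Banach space of all $\varphi\in C^\infty(\mathbb{R}^d)$ with $\sigma_h(\varphi)=\sup_\alpha h^{|\alpha|}\|e^{A(h|\cdot|)}D^\alpha\varphi\|_{L^\infty(\mathbb{R}^d)}/M_\alpha<\infty$. For $(r_p)\in\mathfrak{R}$, $\mathcal{S}^{M_p,(r_p)}_{A_p,(r_p)}$ is the Banach space of all $\varphi\in C^\infty(\mathbb{R}^d)$ with $\sigma_{(r_p)}(\varphi)=\sup_\alpha \|e^{B_{r_p}(|\cdot|)}D^\alpha\varphi\|_{L^\infty(\mathbb{R}^d)}/(M_\alpha\prod_{j=1}^{|\alpha|}r_j)<\infty$. $\mathcal{S}^{(M_p)}_{(A_p)}(\mathbb{R}^d)=\varprojlim_{h\to\infty}\mathcal{S}^{M_p,h}_{A_p,h}$ (Beurling case) and $\mathcal{S}^{\{M_p\}}_{\{A_p\}}(\mathbb{R}^d)=\varinjlim_{h\to0}\mathcal{S}^{M_p,h}_{A_p,h}$ (Roumieu case); $\mathcal{S}^*_\dagger(\mathbb{R}^d)$ is the common notation, and $\mathcal{S}'^*_\dagger(\mathbb{R}^d)$ is the strong dual. An ultradifferential operator of class $(M_p)$ (resp. $\{M_p\}$) is $P(D)=\sum_\alpha c_\alpha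 D^\alpha$ where there exist $L,C>0$ (resp. for every $L>0$ there exists $C>0$) with $|c_\alpha|\leq CL^{|\alpha|}/M_\alpha$ for all $\alpha\in\mathbb{N}^d$. It acts on $\mathcal{S}'^*_\dagger(\mathbb{R}^d)$ by $\langle P(D)f,\varphi\rangle=\langle f,P(-D)\varphi\rangle$. The equality $P(D)G=\delta$ ($\delta$ the Dirac delta at $0$) is in $\mathcal{S}'^{(M_p)}_{(A_p)}(\mathbb{R}^d)$ (resp. $\mathcal{S}'^{\{M_p\}}_{\{A_p\}}(\mathbb{R}^d)$), i.e. $\int_{\mathbb{R}^d}G(x)P(-D)\varphi(x)\,dx=\varphi(0)$ for all test functions $\varphi$. *)

(* Defs.v *)
From HB Require Import structures.
From mathcomp Require Import all_boot all_order all_algebra.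
From mathcomp Require Import complex.
From mathcomp Require Import all_classical all_reals all_analysis.

Set Implicit Arguments.
Unset Strict Implicit.
Unset Printing Implicit Defensive.

Import Order.TTheory GRing.Theory Num.Theory.
Import numFieldNormedType.Exports.

Local Open Scope classical_set_scope.
Local Open Scope ring_scope.
Local Open Scope complex_scope.

(* The library has Lebesgue measure only on R.  Lebesgue measure on R^n is
   built by recursion as the image of (Lebesgue on R) x (Lebesgue on R^(n-1))
   under (x, t) |-> x :: t; [lebesgueRn_box] below gives its value on boxes,
   which determines it. *)
Section LebesgueMeasure.
Variable R : realType.
Local Notation RR := (measurableTypeR R).

Definition tuple_cons n (z : RR * n.-tuple RR) : n.+1.-tuple RR :=
  [the n.+1.-tuple RR of z.1 :: z.2].

Lemma measurable_tuple_cons n : measurable_fun setT (@tuple_cons n).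
Proof. exact: measurable_cons measurable_fst measurable_snd. Qed.

HB.instance Definition _ n :=
  isMeasurableFun.Build _ _ _ _ (@tuple_cons n) (@measurable_tuple_cons n).

Section Step.
Variables (n : nat) (m : {measure set (n.-tuple RR) -> \bar R}).

Definition lebesgue_step : set (n.+1.-tuple RR) -> \bar R :=
  pushforward (@lebesgue_measure R \x^ m)%E (@tuple_cons n).

Let lebesgue_step0 : lebesgue_step set0 = 0%E.
Proof. exact: measure0. Qed.

Let lebesgue_step_ge0 B : (0 <= lebesgue_step B)%E.
Proof. exact: measure_ge0. Qed.

Let lebesgue_step_sigma_additive : semi_sigma_additive lebesgue_step.
Proof. exact: measure_semi_sigma_additive. Qed.

HB.instance Definition _ := isMeasure.Build _ _ _ lebesgue_step
  lebesgue_step0 lebesgue_step_ge0 lebesgue_step_sigma_additive.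
End Step.

Fixpoint lebesgueRn n : {measure set (n.-tuple RR) -> \bar R} :=
  match n with
  | 0 => dirac ([tuple] : 0.-tuple RR)
  | k.+1 => lebesgue_step (lebesgueRn k)
  end.

Lemma lebesgueRn_box n (B : 'I_n -> set RR) : (forall i, measurable (B i)) ->
  lebesgueRn n [set t | forall i, B i (tnth t i)] =
  (\prod_(i < n) lebesgue_measure (B i))%E.
Proof.
elim: n B => [|n IH] B mB.
  rewrite big_ord0 /= diracE (_ : [set t | _] = setT) ?in_setT//.
  by apply/seteqP; split => // t _ [].
rewrite big_ord_recl -IH//= /lebesgue_step /pushforward.
have mb : measurable [set t : n.-tuple RR | forall i, B (lift ord0 i) (tnth t i)].
  rewrite (_ : [set t | _] = \bigcap_(i in [set: 'I_n])
      ((fun t : n.-tuple RR => tnth t i) @^-1` B (lift ord0 i))).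
    apply: fin_bigcap_measurable => // i _; rewrite -[X in measurable X]setTI.
    exact: measurable_tnth.
  by apply/seteqP; split=> t /= Ht i; [move=> _; exact: Ht|exact: (Ht i)].
rewrite -product_measure2E//; congr (_ _).
apply/seteqP; split=> -[x t] /=.
  by move=> H; split=> [|i]; [exact: (H ord0)|have := H (lift ord0 i); rewrite tnthS].
move=> [Hx Ht] i; case: (unliftP ord0 i) => [j ->|->]; last exact: Hx.
by rewrite tnthS; exact: Ht.
Qed.

End LebesgueMeasure.

Section Smooth.
Variables (R : realType) (d : nat).
Local Notation Rd := 'rV[R]_d.

Definition Rd_of_tuple (t : d.-tuple R) : Rd := \row_i tnth t i.

Definition enorm (x : Rd) : R := Num.sqrt (\sum_i x 0 i ^+ 2).

(* Lebesgue integral over R^d of a complex function, and L^oo(R^d) norm. *)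
Definition integralRd (f : Rd -> R[i]) : R[i] :=
  (\int[@lebesgueRn R d]_t complex.Re (f (Rd_of_tuple t))) +i*
  (\int[@lebesgueRn R d]_t complex.Im (f (Rd_of_tuple t))).

Definition LooRd (f : Rd -> \bar R) : \bar R :=
  Lnorm (@lebesgueRn R d) +oo%E (fun t => f (Rd_of_tuple t)).

(* The library differentiates maps between normed modules over one field, so
   real partial derivatives of complex functions are taken componentwise. *)
Definition rpart (f : Rd -> R[i]) : Rd -> R^o := fun x => complex.Re (f x).
Definition ipart (f : Rd -> R[i]) : Rd -> R^o := fun x => complex.Im (f x).

Definition partial (i : 'I_d) (f : Rd -> R[i]) : Rd -> R[i] := fun x =>
  ('D_(delta_mx 0 i) (rpart f) x) +i* ('D_(delta_mx 0 i) (ipart f) x).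

Definition smooth (f : Rd -> R[i]) : Prop :=
  forall w : seq 'I_d, let g := foldr partial f w in
    [/\ continuous (rpart g), continuous (ipart g) &
        forall i x, derivable (rpart g) x (delta_mx 0 i) /\
                    derivable (ipart g) x (delta_mx 0 i)].

Definition mindex := {ffun 'I_d -> nat}.
Definition mlen (a : mindex) : nat := (\sum_i a i)%N.

Definition partials (a : mindex) (f : Rd -> R[i]) : Rd -> R[i] :=
  foldr (fun i => iter (a i) (partial i)) f (enum 'I_d).

Definition Dop (a : mindex) (f : Rd -> R[i]) : Rd -> R[i] :=
  fun x => (- 'i%C) ^+ mlen a * partials a f x.

(* Sum over all multi-indices, taken along the shells |a| = n; the families
   summed below are absolutely summable. *)
Definition shell (u : mindex -> R[i]) (n : nat) : R[i] :=
  \sum_(b : {ffun 'I_d -> 'I_n.+1} | (\sum_i b i == n)%N)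
     u [ffun i => nat_of_ord (b i)].

Definition mindex_sum (u : mindex -> R[i]) : R[i] :=
  limn (fun N => \sum_(0 <= n < N) complex.Re (shell u n) : R^o) +i*
  limn (fun N => \sum_(0 <= n < N) complex.Im (shell u n) : R^o).

End Smooth.

Section Sequences.
Variable R : realType.
Implicit Types M A N r : nat -> R.

Definition cond_M1 M : Prop :=
  forall p, (0 < p)%N -> M p ^+ 2 <= M p.-1 * M p.+1.

Definition cond_M2 (c0 H : R) M : Prop := forall p,
  M p <= c0 * H ^+ p *
         \big[Num.min/M p * M 0%N]_(q < p.+1) (M (p - q)%N * M q).

Definition cond_M5 M : Prop := exists q c0 : R, [/\ 0 < q, 1 <= c0 &
  forall p, (0 < p)%N ->
    (\sum_(p.+1 <= j <oo) ((M j.-1 `^ q / M j `^ q)%:E)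
       <= (c0 * p%:R * (M p `^ q / M p.+1 `^ q))%:E)%E].

Definition cond_M6 A : Prop := exists c0 L0 : R, [/\ 1 <= c0, 1 <= L0 &
  forall p, (p`!)%:R <= c0 * L0 ^+ p * A p].

(* Sequences are indexed by p >= 1: the value r 0 is never used. *)
Definition frakR r : Prop :=
  [/\ forall p, (0 < p)%N -> 0 < r p,
      forall p, (0 < p)%N -> r p <= r p.+1 &
      r n @[n --> \oo] --> +oo].

Definition rprod r (p : nat) : R := \prod_(1 <= j < p.+1) r j.

(* [ln 0 = 0], so this is also 0 at 0. *)
Definition logp (x : R) : R := Num.max 0 (ln x).

(* A(rho) is [assoc_fun A rho] and B_(r_p)(rho) is
   [assoc_fun (fun p => A p * rprod r p) rho]. *)
Definition assoc_fun N (rho : R) : \bar R :=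
  ereal_sup [set (logp (rho ^+ p / N p))%:E | p in [set: nat]].

End Sequences.

Section GelfandShilov.
Variables (R : realType) (d : nat).
Local Notation Rd := 'rV[R]_d.
Implicit Types (M A r : nat -> R) (phi : Rd -> R[i]) (c : mindex d -> R[i]).

Definition sigma_h M A (h : R) phi : \bar R :=
  ereal_sup [set ((h ^+ mlen a / M (mlen a))%:E *
    LooRd (fun x => expeR (assoc_fun A (h * enorm x)) *
                    (Normc.normc (Dop a phi x))%:E))%E | a in [set: mindex d]].

Definition sigma_r M A r phi : \bar R :=
  ereal_sup [set (((M (mlen a) * rprod r (mlen a))^-1)%:E *
    LooRd (fun x => expeR (assoc_fun (fun p => A p * rprod r p)%R (enorm x)) *
                    (Normc.normc (Dop a phi x))%:E))%E | a in [set: mindex d]].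

Definition S_h M A (h : R) : set (Rd -> R[i]) :=
  [set phi | smooth phi /\ (sigma_h M A h phi < +oo)%E].

Definition S_r M A r : set (Rd -> R[i]) :=
  [set phi | smooth phi /\ (sigma_r M A r phi < +oo)%E].

Definition S_beurling M A : set (Rd -> R[i]) :=
  \bigcap_(h in [set h : R | 0 < h]) S_h M A h.

Definition S_roumieu M A : set (Rd -> R[i]) :=
  \bigcup_(h in [set h : R | 0 < h]) S_h M A h.

(* P(D) = \sum_a c_a D^a is represented by its coefficients c. *)
Definition udo_beurling M c : Prop := exists L C : R, [/\ 0 < L, 0 < C &
  forall a, Normc.normc (c a) <= C * L ^+ mlen a / M (mlen a)].

Definition udo_roumieu M c : Prop := forall L : R, 0 < L ->
  exists2 C : R, 0 < C &
    forall a, Normc.normc (c a) <= C * L ^+ mlen a / M (mlen a).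

Definition udo c phi : Rd -> R[i] := fun x => mindex_sum (fun a => c a * Dop a phi x).

Definition udo_opp c : mindex d -> R[i] := fun a => (-1) ^+ mlen a * c a.

(* Elements of the dual are represented by functionals on functions, of which
   only the values at test functions matter: see [eq_dual]. *)
Definition functional := (Rd -> R[i]) -> R[i].

Definition regular (G : Rd -> R[i]) : functional :=
  fun phi => integralRd (fun x => G x * phi x).

Definition delta0 : functional := fun phi => phi 0.

Definition udo_dual c (f : functional) : functional :=
  fun phi => f (udo (udo_opp c) phi).

Definition eq_dual (X : set (Rd -> R[i])) (f g : functional) : Prop :=
  forall phi, X phi -> f phi = g phi.

End GelfandShilov.

(* Main.v *)
Require Import Defs.
From HB Require Import structures.
From mathcomp Require Import all_boot all_order all_algebra.
From mathcomp Require Import complex.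
From mathcomp Require Import ring lra zify.
From mathcomp Require Import all_classical all_reals all_analysis.
From mathcomp Require Import measurable_realfun ess_sup_inf.

Set Implicit Arguments.
Unset Strict Implicit.
Unset Printing Implicit Defensive.

Import Order.TTheory GRing.Theory Num.Theory.
Import numFieldNormedType.Exports.

Local Open Scope classical_set_scope.
Local Open Scope ring_scope.

(** The operator and its fundamental solution are tensor products of
    one-dimensional ones: [c_alpha] is the product of the [c (alpha_i)] and [G]
    that of the [G_0 (x_i)].  In dimension one, let [m_j = M_(j+1) / M_j] and
    let [tau_j] be [1/t] in the Beurling case, [t_(j+1)] in the Roumieu case.
    Up to a constant and a lower cut-off,
    [N_j = min (tau_j, j+1) m_j], and the symbol is
    [P(xi) = prod_j (1 + xi^r / N_j^r)] with [r] even and at least the exponent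
    of (M.5), so that [P >= 1] on the real line.  Then
    [G_0(x) = (2 pi)^-1 int cos (x xi) / P(xi) dxi].

    The power series coefficients of [P] are nonnegative.  (M.5) bounds
    [sum_(j >= k) N_j^-r] by a multiple of [k / N_k^r]; evaluating the partial
    products at [xi = N_k] therefore bounds the coefficient of [xi^(rk)] by
    [C^k / prod_(j < k) N_j^r] ([ppoly_coef_le]), and (M.2) turns this into a
    bound [C (L0 / X)^m / M_m] for every [X] eventually below [tau]
    ([fcoef_bound]).  In the Roumieu case [tau] tends to infinity, so every
    [L = L0 / X > 0] is reached.

    The derivatives of [G_0] are transforms of [xi^k / P(xi)].  The first [k+2]
    factors of [P] bound this function by [C 4^k prod_(j < k+2) N_j / (1 + xi^2)],
    and the bound holds for the sums [sum_p |a_p(xi)| s^p] of the Taylor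
    coefficients at every real point, which do the work of Cauchy estimates in
    the strip of width [s] ([prodV_bound]).  Integrating by parts [p] times and
    summing over [p] gives exponential decay of any prescribed rate [kappa]
    ([costr_exp_decay]), hence
    [|G_0^(k)(x)| <= C M_k (prod_(j < k) tau_j) exp (- kappa |x|)]
    ([fund_bound]).  By (M.6) the weight grows at most like [exp (kappa |x|)]
    for a suitable [kappa] ([expeR_assoc_M6]), and log-convexity of [M] carries
    the bound to the tensor product ([LooRd_tensor]).

    For a test function [f] of one variable, moving the transform from [G_0] to
    [f] gives
    [sum_(m < K) (-1)^(m/2) c_m int G_0 f^(m)
       = (2 pi)^-1 int (sum_(m < K) c_m xi^m / P(xi)) fhat(xi) dxi].
    The inner sum increases to 1, so the limit is
    [(2 pi)^-1 int fhat = f(0)] ([symb_sum_cvg], [cosine_inversion]).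
    In dimension [d] the variables are integrated one at a time: by induction,
    the sum over the multi-indices with entries below [K] is within [E B 2^-K] of
    [phi(0)]
    ([box_identity]) as soon as [|c_alpha D^alpha phi|] is at most
    [B 2^-|alpha| prod_i (1 + x_i^2)^-1].  A test function in the space of
    parameter [h] satisfies this when [|c_alpha| <= C (h/2)^|alpha| / M_|alpha|]:
    in the Beurling case [h] is chosen after the operator, in the Roumieu case
    the operator satisfies such a bound for every [h].  The same geometric decay
    replaces boxes by shells and exchanges the sum with the integral
    ([shell_identity]). *)

(** * Integrals of functions dominated by (1 + x^2)^-1 *)

Lemma eq_ler {R : numDomainType} (x y : R) : x = y -> x <= y.
Proof. by move=> ->. Qed.

Lemma is_derive_continuous {R : realType} (f f' : R -> R) :
  (forall x : R, is_derive x 1 f (f' x)) -> continuous f.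
Proof.
by move=> df x; apply/differentiable_continuous/derivable1_diffP; exact: ex_derive.
Qed.

Section DominatedRintegral.
Context d (T : measurableType d) (R : realType)
  (mu : {measure set T -> \bar R}).

Lemma dominated_Rintegral_cvg (f_ : nat -> T -> R) (f g : T -> R) :
  (forall n, measurable_fun setT (f_ n)) ->
  mu.-integrable setT (EFin \o g) ->
  (forall n x, `|f_ n x| <= g x) ->
  (forall x, f_ n x @[n --> \oo] --> f x) ->
  \int[mu]_x f_ n x @[n --> \oo] --> \int[mu]_x f x.
Proof.
move=> mf ig fg ff.
have mEf n : measurable_fun setT (fun x => (f_ n x)%:E) by exact/measurable_EFinP.
have cEf x : setT x -> (f_ n x)%:E @[n --> \oo] --> (f x)%:E.
  by move=> _; apply: cvg_EFin; [exact: nearW|exact: ff].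
have fgE n x : setT x -> (`|(f_ n x)%:E| <= (g x)%:E)%E by move=> _; exact: fg.
have mEF : measurable_fun setT (fun x => (f x)%:E).
  exact: (emeasurable_fun_cvg _ _ mEf cEf).
have [iEf _ H] := @dominated_convergence _ _ _ mu setT measurableT
  (fun n x => (f_ n x)%:E) (fun x => (f x)%:E) (fun x => (g x)%:E) mEf mEF
  (aeW _ cEf) ig (aeW _ (fun x n => fgE n x)).
rewrite /Rintegral; apply: fine_cvg; rewrite fineK//.
exact: integrable_fin_num.
Qed.

Lemma integrable_realZ (f : T -> R) c : mu.-integrable setT (EFin \o f) ->
  mu.-integrable setT (EFin \o (fun x => c * f x)).
Proof.
move=> If; have := integrableZl measurableT c If.
by apply: eq_integrable => // x _; rewrite /= EFinM.
Qed.

Lemma integrable_realD (f g : T -> R) : mu.-integrable setT (EFin \o f) ->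
  mu.-integrable setT (EFin \o g) ->
  mu.-integrable setT (EFin \o (fun x => f x + g x)).
Proof.
move=> If Ig; have := integrableD measurableT If Ig.
by apply: eq_integrable => // x _; rewrite /= EFinD.
Qed.

Lemma dominated_integrable (w f : T -> R) C : mu.-integrable setT (EFin \o w) ->
  measurable_fun setT f -> (forall x, `|f x| <= C * w x) ->
  mu.-integrable setT (EFin \o f).
Proof.
move=> iw mf fC.
apply: (@le_integrable _ _ _ mu _ measurableT _ (EFin \o (fun x => C * w x))).
- exact/measurable_EFinP.
- by move=> x _ /=; rewrite lee_fin (le_trans (fC x))// ler_norm.
- exact: integrable_realZ.
Qed.

Lemma Rintegral_dominated_le (w f : T -> R) C : mu.-integrable setT (EFin \o w) ->
  measurable_fun setT f -> (forall x, `|f x| <= C * w x) ->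
  `|\int[mu]_x f x| <= C * \int[mu]_x w x.
Proof.
move=> iw mf fC; have iF := dominated_integrable iw mf fC.
apply: (le_trans (le_normr_Rintegral _ iF)) => //.
rewrite -RintegralZl//; apply: le_Rintegral => //; first exact: integrable_norm.
exact: integrable_realZ.
Qed.

End DominatedRintegral.

Section Weight.
Context {R : realType}.
Local Notation mu := (@lebesgue_measure R).
Implicit Types f g : R -> R.

Definition wgt (x : R) : R := (1 + x ^+ 2)^-1.

Lemma wgt_gt0 x : 0 < wgt x.
Proof. by rewrite invr_gt0 ltr_pwDl// sqr_ge0. Qed.

Lemma wgt_ge0 x : 0 <= wgt x. Proof. exact/ltW/wgt_gt0. Qed.

Lemma continuous_wgt : continuous wgt.
Proof. exact: continuous_oneDsqrV. Qed.

Lemma integrable_wgt : mu.-integrable setT (EFin \o wgt).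
Proof.
have mw : measurable_fun setT wgt.
  by apply: continuous_measurable_fun; exact: continuous_wgt.
apply/integrableP; split; first exact/measurable_EFinP.
under eq_integral do rewrite /= ger0_norm ?wgt_ge0//.
rewrite ge0_symfun_integralT//; last 3 first.
- by move=> x; exact: wgt_ge0.
- exact: continuous_wgt.
- by move=> x; rewrite /= /wgt sqrrN.
rewrite (_ : [set x | _] = `[0, +oo[%classic); last first.
  by apply/seteqP; split => x/=; rewrite in_itv/= andbT.
by rewrite integral0y_oneDsqr -EFinM ltry.
Qed.

Lemma integrable_wgtZ C : mu.-integrable setT (EFin \o (fun x => C * wgt x)).
Proof. exact/integrable_realZ/integrable_wgt. Qed.

(** One class for transforms, test functions and kernels.  Domination by a fixed
    integrable function is what differentiation under the integral, dominated
    convergence and Fubini's theorem require. *)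
Definition decay f := continuous f /\ exists C, forall x, `|f x| <= C * wgt x.

Lemma dominated_integrable_wgt f C : measurable_fun setT f ->
  (forall x, `|f x| <= C * wgt x) -> mu.-integrable setT (EFin \o f).
Proof. exact: dominated_integrable integrable_wgt. Qed.

Lemma integrable_decay f : decay f -> mu.-integrable setT (EFin \o f).
Proof.
move=> [cf [C fC]]; apply: dominated_integrable_wgt fC.
exact: continuous_measurable_fun.
Qed.

Definition wgt_mass : R := \int[mu]_x wgt x.

Lemma wgt_mass_ge0 : 0 <= wgt_mass.
Proof. by apply: Rintegral_ge0 => x _; exact: wgt_ge0. Qed.

Lemma Rintegral_le_wgt f C : measurable_fun setT f ->
  (forall x, `|f x| <= C * wgt x) -> `|\int[mu]_x f x| <= C * wgt_mass.
Proof. exact: Rintegral_dominated_le integrable_wgt. Qed.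

Lemma wgt_le1 x : wgt x <= 1.
Proof. by rewrite invf_le1 ?ltr_pwDl ?sqr_ge0// lerDl sqr_ge0. Qed.

Lemma decayM f g C : decay f -> continuous g -> (forall x, `|g x| <= C) ->
  decay (fun x => f x * g x).
Proof.
move=> [cf [D fD]] cg gC; split; first by move=> x; apply: cvgM; [exact: cf|exact: cg].
exists (D * C) => x; rewrite normrM mulrAC ler_pM//.
Qed.

Lemma decayZ f c : decay f -> decay (fun x => c * f x).
Proof.
move=> df; have := @decayM _ (fun _ => c) `|c| df; rewrite /=.
under [fun x => f x * c]eq_fun do rewrite mulrC; apply => //.
exact: cst_continuous.
Qed.

Lemma decayD f g : decay f -> decay g -> decay (fun x => f x + g x).
Proof.
move=> [cf [C fC]] [cg [D gD]]; split.
  by move=> x; apply: cvgD; [exact: cf|exact: cg].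
by exists (C + D) => x; rewrite mulrDl (le_trans (ler_normD _ _))// lerD.
Qed.

Lemma decay_cvg0 f : decay f -> f n%:R @[n --> \oo] --> 0 /\ f (- n%:R) @[n --> \oo] --> 0.
Proof.
move=> [_ [C fC]].
have C0 : 0 <= C.
  by have := fC 0; rewrite /wgt expr0n addr0 invr1 mulr1; exact: le_trans.
have K (h : nat -> R) : (forall n, `|h n| <= C * wgt n%:R) -> h n @[n --> \oo] --> 0.
  move=> hC; apply/cvgr0Pnorm_le => e e0.
  near=> n; apply: le_trans (hC n) _.
  have n0 : (0 < n)%N by near: n; exact: nbhs_infty_gt.
  have nC : C / e <= n%:R by near: n; exact: nbhs_infty_ger.
  rewrite /wgt ler_pdivrMr ?ltr_pwDl ?sqr_ge0//.
  have : C <= n%:R * e by rewrite -ler_pdivrMr.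
  move=> /le_trans; apply; rewrite mulrC ler_pM2l//.
  have : (1:R) <= n%:R by rewrite ler1n.
  set t := n%:R; move=> t1; nra.
split; apply: K => n //.
by apply: le_trans (fC _) _; rewrite /wgt sqrrN.
Unshelve. all: by end_near. Qed.

Lemma cvg_Rintegral_segment f : mu.-integrable setT (EFin \o f) ->
  \int[mu]_(x in `[- n%:R, n%:R]) f x @[n --> \oo] --> \int[mu]_x f x.
Proof.
move=> If; have mf : measurable_fun setT f by have /integrableP[/measurable_EFinP] := If.
under eq_fun do rewrite Rintegral_mkcond.
apply: (@dominated_Rintegral_cvg _ _ _ mu _ f (fun x => `|f x|)).
- move=> n; apply/(measurable_restrictT _ _).1 => //.
  exact: measurable_funTS.
- exact: (integrable_norm If).
- by move=> n x; rewrite /patch; case: ifPn => // _; rewrite normr0.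
- move=> x; apply: cvg_near_cst; near=> n.
  rewrite /patch ifT// inE/= in_itv/= -ler_norml.
  by near: n; exact: nbhs_infty_ger.
Unshelve. all: by end_near. Qed.

(** The fundamental theorem of calculus between [- n] and [n], whose boundary terms
    tend to 0; this is the form in which integration by parts is used. *)
Lemma Rintegral_derive0 (F f : R -> R) : (forall x : R, is_derive x 1 F (f x)) ->
  decay F -> decay f -> \int[mu]_x f x = 0.
Proof.
move=> dF DF Df.
have H := cvg_Rintegral_segment (integrable_decay Df).
suff : \int[mu]_(x in `[- n%:R, n%:R]) f x @[n --> \oo] --> 0.
  by move=> K; apply: cvg_unique H K.
have [F1 F2] := decay_cvg0 DF.
have : F n%:R - F (- n%:R) @[n --> \oo] --> 0 by rewrite -(subr0 0); exact: cvgB.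
apply: cvg_trans; apply: near_eq_cvg; near=> n.
have n0 : (0 < n)%N by near: n; exact: nbhs_infty_gt.
have cF := is_derive_continuous dF.
rewrite /Rintegral (@continuous_FTC2 _ _ F)//.
- by rewrite gtrN// ltr0n.
- by apply: continuous_subspaceT; exact: Df.1.
- split.
  + by move=> x _; exact: ex_derive.
  + by apply: cvg_at_right_filter; exact: cF.
  + by apply: cvg_at_left_filter; exact: cF.
- by move=> x _; rewrite derive1E; exact: derive_val.
Unshelve. all: by end_near. Qed.

End Weight.

(** * The cosine transform with a phase *)

Section CosineTransform.
Context {R : realType}.
Local Notation mu := (@lebesgue_measure R).
Implicit Types (f g : R -> R) (a x : R).

(** The phase [a] makes the family stable under differentiation: a derivative or
    an integration by parts shifts [a] by a quarter turn. *)
Definition costr a f x : R := \int[mu]_y (cos (x * y + a) * f y).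

Lemma continuous_cosaff x a : continuous (fun y : R => cos (x * y + a)).
Proof.
move=> y; apply: (@continuous_comp _ _ _ (fun y => x * y + a) cos).
  by apply: cvgD; [apply: cvgM; [exact: cvg_cst|exact: cvg_id]|exact: cvg_cst].
exact: continuous_cos.
Qed.

Lemma continuous_cosaffl y a : continuous (fun x : R => cos (x * y + a)).
Proof.
by move=> x; rewrite (_ : (fun x => _) = (fun x => cos (y * x + a)));
  [exact: continuous_cosaff|apply/funext => z; rewrite mulrC].
Qed.

Lemma decay_cos f a x : decay f -> decay (fun y => cos (x * y + a) * f y).
Proof.
move=> df; under eq_fun do rewrite [_ * f _]mulrC.
apply: (@decayM _ f (fun y => cos (x * y + a)) 1) => //.
- exact: continuous_cosaff.
- by move=> y; exact: cos_max.
Qed.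

Lemma costr_le f C a x : continuous f -> (forall y, `|f y| <= C * wgt y) ->
  `|costr a f x| <= C * wgt_mass.
Proof.
move=> cf fC; apply: Rintegral_le_wgt.
  apply: continuous_measurable_fun => y; apply: cvgM; last exact: cf.
  exact: continuous_cosaff.
move=> y; rewrite normrM (le_trans _ (fC y))// ler_piMl//; exact: cos_max.
Qed.

Lemma is_derive_cosaff (a x y : R) :
  is_derive x 1 (fun t => cos (t * y + a)) (y * cos (x * y + (a + pi / 2))).
Proof.
rewrite addrA cosDpihalf mulrN mulrC -mulNr.
have := @is_derive1_comp _ cos (fun t => t * y + a) x (- sin (x * y + a)) y
  (is_derive_cos _) _.
apply.
by apply: is_derive_eq; rewrite addr0 scaler0 add0r /GRing.scale/= mulr1.
Qed.

Lemma is_derive_costr f (a x : R) : decay f -> decay (fun y => y * f y) ->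
  is_derive x 1 (costr a f) (costr (a + pi / 2) (fun y => y * f y) x).
Proof.
move=> df dyf.
have [C yfC] := dyf.2.
have Ix : (`]x - 1, x + 1[%classic : set R) x.
  by rewrite /= in_itv/= ltrBlDr ltrDl ltr01.
have d1 (z y : R) : is_derive z 1 (fun t => cos (t * y + a) * f y)
    (cos (z * y + (a + pi / 2)) * (y * f y)).
  have H := is_derive_cosaff a z y.
  by apply: is_derive_eq; rewrite scaler0 add0r /GRing.scale/=; ring.
have e z y : partial1of2 (fun x y => cos (x * y + a) * f y) z y =
    cos (z * y + (a + pi / 2)) * (y * f y).
  by rewrite partial1of2E; exact: (@derive_val _ _ _ _ _ _ _ (d1 z y)).
have H1 : forall z : R, `]x - 1, x + 1[%classic z ->
  mu.-integrable setT (EFin \o (fun y => cos (z * y + a) * f y)).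
  by move=> z _; exact/integrable_decay/decay_cos.
have H2 : forall z y : R, `]x - 1, x + 1[%classic z -> setT y ->
   derivable (fun z : R => cos (z * y + a) * f y) z 1.
  by move=> z y _ _; exact: ex_derive.
have H3 : forall y, 0 <= C * wgt y by move=> y; exact: le_trans (yfC y).
have H4 : mu.-integrable setT (EFin \o (fun y => C * wgt y)).
  exact: integrable_wgtZ.
have H5 : forall z y : R, `]x - 1, x + 1[%classic z -> setT y ->
   `|partial1of2 (fun x y => cos (x * y + a) * f y) z y| <= C * wgt y.
  move=> z y _ _; rewrite e normrM (le_trans _ (yfC y))// ler_piMl//.
  exact: cos_max.
apply: DeriveDef.
  exact: (derivable_under_integral measurableT Ix H1 H2 H3 H4 H5).
rewrite -derive1E (differentiation_under_integral measurableT Ix H1 H2 H3 H4 H5).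
by apply: eq_Rintegral => y _; rewrite e.
Qed.

Lemma continuous_costr f a : decay f -> continuous (costr a f).
Proof.
move=> df x; have [C fC] := df.2.
have := @continuity_under_integral _ _ _ mu (fun x y => cos (x * y + a) * f y)
  setT measurableT (x - 1) (x + 1) _ _ (fun y => C * wgt y) _ _ x.
apply.
- by move=> z _; exact/integrable_decay/decay_cos.
- apply: aeW => y _ z _; apply: cvgM; last exact: cvg_cst.
  exact: continuous_cosaffl.
- exact: integrable_wgtZ.
- move=> z _; apply: aeW => y _; rewrite normrM (le_trans _ (fC y))// ler_piMl//.
  exact: cos_max.
- by rewrite inE/= in_itv/= ltrBlDr ltrDl ltr01.
Qed.

(** Integration by parts in the integration variable. *)
Lemma costrM_var f f' a x : (forall y : R, is_derive y 1 f (f' y)) ->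
  decay f -> decay f' -> x * costr a f x = - costr (a - pi / 2) f' x.
Proof.
move=> df Df Df'.
have d1 (y : R) : is_derive y 1 (fun t => cos (x * t + (a - pi / 2)) * f t)
    (cos (x * y + (a - pi / 2)) * f' y + x * (cos (x * y + a) * f y)).
  have H := is_derive_cosaff (a - pi / 2) y x.
  have H' : is_derive y 1 (fun t => cos (x * t + (a - pi / 2)))
    (x * cos (x * y + a)).
    rewrite (_ : (fun t => _) = (fun t => cos (t * x + (a - pi / 2)))); last first.
      by apply/funext => z; rewrite mulrC.
    by apply: is_derive_eq; rewrite (mulrC y) subrK.
  by apply: is_derive_eq; rewrite /GRing.scale/=; ring.
have D1 := decay_cos (a - pi / 2) x Df'.
have D2 := decay_cos a x Df.
have := Rintegral_derive0 d1 (decay_cos _ _ Df) (decayD D1 (decayZ x D2)).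
rewrite RintegralD//; [|exact: integrable_decay..|]; last first.
  exact/integrable_decay/decayZ.
rewrite RintegralZl//; last exact: integrable_decay.
by move=> /eqP; rewrite addrC addr_eq0 => /eqP.
Qed.

(** The kernel [cos (x y + a)] is symmetric in [x] and [y], so Fubini's theorem
    moves the transform from one factor to the other. *)
Lemma Rintegral_costr_exchange f g a : decay f -> decay g ->
  \int[mu]_x (costr a g x * f x) = \int[mu]_x (costr a f x * g x).
Proof.
move=> df dg.
pose h (z : R * R) := cos (z.1 * z.2 + a) * (g z.2 * f z.1).
have mf : measurable_fun setT f by exact: continuous_measurable_fun df.1.
have mg : measurable_fun setT g by exact: continuous_measurable_fun dg.1.
have mh : measurable_fun setT h.
  apply: measurable_funM.
    apply: (measurableT_comp (f := cos)).
      by apply: continuous_measurable_fun; exact: continuous_cos.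
    by apply: measurable_funD => //; apply: measurable_funM.
  by apply: measurable_funM; exact: measurableT_comp.
have mEh : measurable_fun setT (EFin \o h) by exact/measurable_EFinP.
have [C fC] := df.2; have [D gD] := dg.2.
have C0 : 0 <= C by have := le_trans (normr_ge0 _) (fC 0); rewrite pmulr_lge0// wgt_gt0.
have D0 : 0 <= D by have := le_trans (normr_ge0 _) (gD 0); rewrite pmulr_lge0// wgt_gt0.
have E F : decay F -> (\int[mu]_x (F x)%:E)%E = (\int[mu]_x F x)%:E.
  by move=> dF; rewrite /Rintegral fineK//; exact/integrable_fin_num/integrable_decay.
have dw c : decay (fun x => c * wgt x).
  by apply: decayZ; split; [exact: continuous_wgt|exists 1 => x; rewrite mul1r ger0_norm ?wgt_ge0].
have Ih : (mu \x mu)%E.-integrable setT (EFin \o h).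
  apply/(integrable12ltyP mu mu mEh).
  apply: (@le_lt_trans _ _ (\int[mu]_x ((C * D * wgt_mass) * wgt x)%:E)%E); last by rewrite E ?ltry.
  apply: ge0_le_integral => //.
  - by move=> x _; exact: integral_ge0.
  - have mAh : measurable_fun setT (fun z => `|(EFin \o h) z|%E).
      exact: measurableT_comp.
    exact: (measurable_fun_fubini_tonelli_F (m2 := mu)
      (fun z => `|(EFin \o h) z|%E) mAh (fun _ => abse_ge0 _)).
  - by apply/measurable_EFinP; exact: continuous_measurable_fun (dw _).1.
  - move=> x _.
    apply: (@le_trans _ _ (\int[mu]_y ((C * D * wgt x) * wgt y)%:E)%E).
      apply: ge0_le_integral => //.
      + by apply: measurableT_comp => //; exact: measurableT_comp mEh _.
      + by apply/measurable_EFinP; exact: continuous_measurable_fun (dw _).1.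
      + move=> y _; rewrite /= lee_fin /h/= !normrM.
        rewrite (@le_trans _ _ (1 * (D * wgt y * (C * wgt x))))//.
          by apply: ler_pM; rewrite ?mulr_ge0 ?cos_max ?ler_pM.
        by apply: eq_ler; ring.
    rewrite E// lee_fin RintegralZl//; last exact: integrable_wgt.
    by rewrite -/wgt_mass le_eqVlt; apply/orP; left; apply/eqP; ring.
have := Fubini Ih => H.
rewrite /Rintegral; congr fine.
transitivity (\int[mu]_x \int[mu]_y (EFin \o h) (x, y))%E.
  apply: eq_integral => x _; rewrite /h/= -RintegralZr//; last exact/integrable_decay/decay_cos.
  rewrite -E.
    by apply: eq_integral => y _; rewrite mulrA.
  under eq_fun do rewrite mulrC.
  exact/decayZ/decay_cos.
rewrite H.
apply: eq_integral => x _; rewrite /h/= -RintegralZr//; last exact/integrable_decay/decay_cos.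
rewrite -E.
  by apply: eq_integral => y _ /=; congr EFin; rewrite (mulrC x); ring.
under eq_fun do rewrite mulrC.
exact/decayZ/decay_cos.
Qed.

End CosineTransform.

(** * Gaussians and the inversion formula at the origin *)

Section Gaussian.
Context {R : realType}.
Local Notation mu := (@lebesgue_measure R).
Implicit Types (c x : R).

Definition gauss c x : R := expR (- (c * x ^+ 2)).

Lemma gauss_gt0 c x : 0 < gauss c x. Proof. exact: expR_gt0. Qed.

Lemma gauss_le1 c x : 0 < c -> gauss c x <= 1.
Proof. by move=> c0; rewrite /gauss expR_le1 oppr_le0 mulr_ge0 ?sqr_ge0// ltW. Qed.

Lemma gauss_le_inv c x : 0 < c -> gauss c x <= (1 + c * x ^+ 2)^-1.
Proof.
move=> c0; have H : 0 <= c * x ^+ 2 by rewrite mulr_ge0 ?sqr_ge0// ltW.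
by rewrite /gauss expRN lef_pV2 ?posrE ?expR_gt0 ?ltr_pwDl// expR_ge1Dx.
Qed.

Lemma gauss_le_wgt c x : 0 < c -> gauss c x <= (1 + c^-1) * wgt x.
Proof.
move=> c0; apply: le_trans (gauss_le_inv _ c0) _.
have H : 0 <= c * x ^+ 2 by rewrite mulr_ge0 ?sqr_ge0// ltW.
have Hx := sqr_ge0 x.
have cV : c * c^-1 = 1 by rewrite divff// gt_eqF.
have cV0 : 0 <= c^-1 by rewrite invr_ge0 ltW.
rewrite /wgt ler_pdivlMr ?ltr_pwDl// mulrC ler_pdivrMr ?ltr_pwDl//.
have -> : (1 + c^-1) * (1 + c * x ^+ 2) = 1 + c^-1 + c * x ^+ 2 + (c * c^-1) * x ^+ 2 by ring.
rewrite cV; lra.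
Qed.

Lemma is_derive_gauss c x : is_derive x 1 (gauss c) (- (2 * c) * (x * gauss c x)).
Proof.
rewrite /gauss.
have H : is_derive x 1 (fun x : R => - (c * x ^+ 2)) (- (2 * c * x)).
  by apply: is_derive_eq; rewrite /GRing.scale/=; ring.
apply: (is_derive_eq (@is_derive1_comp _ expR (fun x => - (c * x ^+ 2)) x _ _
  (is_derive_expR _) H)).
by ring.
Qed.

Lemma continuous_gauss c : continuous (gauss c).
Proof.
exact: is_derive_continuous (is_derive_gauss c).
Qed.

Lemma decay_gauss c : 0 < c -> decay (gauss c).
Proof.
move=> c0; split; first exact: continuous_gauss.
by exists (1 + c^-1) => x; rewrite gtr0_norm ?gauss_gt0// gauss_le_wgt.
Qed.

Lemma gaussD c c' x : gauss (c + c') x = gauss c x * gauss c' x.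
Proof. by rewrite /gauss mulrDl opprD expRD. Qed.

(** From [exp (- u) <= (1 + u)^-1] and [(c |x| - 1)^2 >= 0].  Half of the exponent
    of a Gaussian pays for a factor [|x|] and gains [c^-1]. *)
Lemma mul_gauss_le c x : 0 < c -> `|x| * gauss (c ^+ 2 / 2) x <= c^-1.
Proof.
move=> c0; set d := c ^+ 2 / 2.
have d0 : 0 < d by rewrite divr_gt0// exprn_gt0.
have H := gauss_le_inv x d0.
apply: (@le_trans _ _ (`|x| * (1 + d * x ^+ 2)^-1)); first by rewrite ler_wpM2l.
have H0 : 0 <= d * x ^+ 2 by apply: mulr_ge0; [exact: ltW|exact: sqr_ge0].
rewrite ler_pdivrMr ?ltr_pwDl//.
rewrite -(ler_pM2l c0) mulrA divff ?gt_eqF// mul1r /d -(real_normK (num_real x)).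
have := sqr_ge0 (c * `|x| - 1); set y := `|x|; nra.
Qed.

Lemma Rintegral_gauss c : 0 < c -> \int[mu]_x gauss c x = Num.sqrt (pi / c).
Proof.
move=> c0; pose s : R := Num.sqrt (2 * c)^-1.
have s2 : s ^+ 2 = (2 * c)^-1.
  by rewrite sqr_sqrtr// invr_ge0 mulr_ge0// ltW.
have s0 : s != 0 by rewrite gt_eqF// sqrtr_gt0 invr_gt0 mulr_gt0.
have cN0 : c != 0 by rewrite gt_eqF.
have I1 := @integral_normal_pdf R 0 s.
have pk : normal_peak s = (Num.sqrt (pi / c))^-1.
  by rewrite /normal_peak s2; congr (Num.sqrt _)^-1; field.
have E x : normal_pdf 0 s x = (Num.sqrt (pi / c))^-1 * gauss c x.
  rewrite normal_pdfE// -pk /normal_fun /gauss s2 subr0; congr (_ * expR _).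
  by field.
have : \int[mu]_x normal_pdf 0 s x = 1 by rewrite /Rintegral I1.
under eq_Rintegral do rewrite E.
rewrite RintegralZl//; last exact/integrable_decay/decay_gauss.
have q0 : Num.sqrt (pi / c) != 0 by rewrite gt_eqF// sqrtr_gt0 divr_gt0// pi_gt0.
by move=> /(congr1 (fun x => Num.sqrt (pi / c) * x)); rewrite mulr1 mulrA divff// mul1r.
Qed.

Lemma decay_mul_gauss c : 0 < c -> decay (fun y => y * gauss c y).
Proof.
move=> c0; pose d := Num.sqrt c.
have d0 : 0 < d by rewrite sqrtr_gt0.
have d2 : c = d ^+ 2 by rewrite sqr_sqrtr// ltW.
have c20 : 0 < c / 2 by rewrite divr_gt0.
split.
  by move=> y; apply: cvgM; [exact: cvg_id|exact: continuous_gauss].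
exists (d^-1 * (1 + (c / 2)^-1)) => y.
rewrite normrM (gtr0_norm (gauss_gt0 _ _)) {1}[c]splitr gaussD mulrA -[leRHS]mulrA.
apply: ler_pM; rewrite ?gauss_le_wgt ?mulr_ge0//; try exact/ltW/gauss_gt0.
by rewrite d2; exact: mul_gauss_le.
Qed.

(** The transform solves [F' = - x F / (2 c)] because differentiation in [x] and
    integration by parts both produce the transform of [y exp (- c y^2)]; hence
    [F(x) exp (x^2 / (4 c))] is constant. *)
Lemma costr_gauss c x : 0 < c ->
  costr 0 (gauss c) x = Num.sqrt (pi / c) * gauss (4 * c)^-1 x.
Proof.
move=> c0; have cN0 : c != 0 by rewrite gt_eqF.
have dg := decay_gauss c0; have dyg := decay_mul_gauss c0.
have dF (y : R) : is_derive y 1 (costr 0 (gauss c)) (- (y / (2 * c)) * costr 0 (gauss c) y).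
  apply: (is_derive_eq (is_derive_costr 0 y dg dyg)).
  have := costrM_var pi y (is_derive_gauss c) dg (decayZ (- (2 * c)) dyg).
  have -> : costr pi (gauss c) y = - costr 0 (gauss c) y.
    rewrite /costr -mulN1r -RintegralZl//; last exact/integrable_decay/decay_cos.
    by apply: eq_Rintegral => z _; rewrite addr0 cosDpi mulNr mulN1r.
  have -> : costr (pi - pi / 2) (fun y => - (2 * c) * (y * gauss c y)) y =
     - (2 * c) * costr (0 + pi / 2) (fun y => y * gauss c y) y.
    rewrite /costr -RintegralZl//; last exact/integrable_decay/decay_cos.
    apply: eq_Rintegral => z _; rewrite mulrCA; congr (_ * (cos (_ + _) * _)).
    by rewrite {1}[pi]splitr addrK add0r.
  set A := costr _ _ _; set B := costr _ _ _ => H.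
  have -> : B = (2 * c)^-1 * (2 * c * B) by field.
  have -> : 2 * c * B = - (y * A) by move: H; rewrite mulrN mulNr opprK => ->.
  by field.
have K : costr 0 (gauss c) x * gauss (- (4 * c)^-1) x =
         costr 0 (gauss c) 0 * gauss (- (4 * c)^-1) 0.
  apply: (@is_derive_0_is_cst _ (fun x => costr 0 (gauss c) x * gauss (- (4 * c)^-1) x)) => y.
  have H1 := dF y; have H2 := is_derive_gauss (- (4 * c)^-1) y.
  by apply: is_derive_eq; rewrite /GRing.scale/=; field.
have g0 d : gauss d 0 = 1 by rewrite /gauss expr0n mulr0 oppr0 expR0.
have C0 : costr 0 (gauss c) 0 = Num.sqrt (pi / c).
  rewrite -Rintegral_gauss//; apply: eq_Rintegral => y _.
  by rewrite mul0r addr0 cos0 mul1r.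
have e1 : gauss (- (4 * c)^-1) x * gauss (4 * c)^-1 x = 1.
  by rewrite -gaussD addNr /gauss mul0r oppr0 expR0.
rewrite -C0; transitivity (costr 0 (gauss c) x * (gauss (- (4 * c)^-1) x * gauss (4 * c)^-1 x)).
  by rewrite e1 mulr1.
by rewrite mulrA K g0 mulr1.
Qed.

End Gaussian.

Lemma lipschitz_mvt {R : realType} (f f' : R -> R) L : (forall x : R, is_derive x 1 f (f' x)) ->
  (forall x, `|f' x| <= L) -> forall x y, `|f x - f y| <= L * `|x - y|.
Proof.
move=> df fL.
have cf := is_derive_continuous df.
have H (a b : R) : a < b -> `|f b - f a| <= L * `|b - a|.
  move=> ab; have [|y _ ->] := @MVT _ f f' a b ab (fun y _ => df y).
    exact: continuous_subspaceT.
  by rewrite normrM ler_wpM2r.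
move=> x y; have [xy|xy|->] := ltgtP x y; last by rewrite !subrr normr0 mulr0.
- by rewrite distrC (distrC x); exact: H.
- exact: H.
Qed.

Section Inversion.
Context {R : realType}.
Local Notation mu := (@lebesgue_measure R).
Variables f f1 f2 : R -> R.
Hypothesis df : forall x : R, is_derive x 1 f (f1 x).
Hypothesis df1 : forall x : R, is_derive x 1 f1 (f2 x).
Hypothesis (Df : decay f) (Df1 : decay f1) (Df2 : decay f2).

(** Two integrations by parts bound [x^2] times the transform. *)
Lemma decay_costr : decay (costr 0 f).
Proof.
split; first exact: continuous_costr.
have [C fC] := Df.2; have [C2 f2C] := Df2.2.
exists (C * wgt_mass + C2 * wgt_mass) => x.
have H1 := costr_le 0 x Df.1 fC.
have : x ^+ 2 * `|costr 0 f x| <= C2 * wgt_mass.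
  rewrite -[x ^+ 2]ger0_norm ?sqr_ge0// -normrM expr2 -mulrA (costrM_var _ _ df)//.
  rewrite mulrN (costrM_var _ _ df1)// opprK; exact: costr_le Df2.1 f2C.
by rewrite /wgt => H2; rewrite ler_pdivlMr ?ltr_pwDl ?sqr_ge0//; lra.
Qed.

(** Damping the integral of the transform by [exp (- c_n x^2)] and exchanging the
    transform leaves the integral of [f] against the Gaussian of parameter
    [k_n = (4 c_n)^-1], of total mass [2 pi]; it concentrates at 0, and the
    Lipschitz bound on [f] makes the error [O(k_n^(-1/2))]. *)
Theorem cosine_inversion : \int[mu]_x costr 0 f x = 2 * pi * f 0.
Proof.
pose k (n : nat) : R := n.+1%:R.
have k0 n : 0 < k n by rewrite /k ltr0n.
pose c n := (4 * k n)^-1.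
have c0 n : 0 < c n by rewrite invr_gt0 mulr_gt0.
have cvgc : c n @[n --> \oo] --> 0.
  under eq_fun do rewrite /c invfM.
  by rewrite -(mulr0 4^-1); apply: cvgM; [exact: cvg_cst|exact: cvg_harmonic].
have HL : \int[mu]_x (costr 0 f x * gauss (c n) x) @[n --> \oo] --> \int[mu]_x costr 0 f x.
  apply: (@dominated_Rintegral_cvg _ _ _ mu _ _ (fun x => `|costr 0 f x|)).
  - move=> n; apply: continuous_measurable_fun => x.
    by apply: cvgM; [exact: decay_costr.1|exact: continuous_gauss].
  - exact/integrable_norm/integrable_decay/decay_costr.
  - move=> n x; rewrite normrM ler_piMr// gtr0_norm ?gauss_gt0//; exact: gauss_le1.
  - move=> x; rewrite -[X in _ --> X]mulr1; apply: cvgM; first exact: cvg_cst.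
    rewrite -expR0 /gauss; apply: (@cvg_comp _ _ _ _ expR _ (nbhs (0:R))); last exact: continuous_expR.
    rewrite -oppr0; apply: cvgN; rewrite -(mul0r (x ^+ 2)).
    by apply: cvgM; [exact: cvgc|exact: cvg_cst].
suff HR : \int[mu]_x (costr 0 f x * gauss (c n) x) @[n --> \oo] --> 2 * pi * f 0.
  by apply: cvg_unique HL HR.
have [C0 f1C0] := Df1.2.
pose C : R := `|C0|.
have f1C x : `|f1 x| <= C.
  apply: (le_trans (f1C0 x)); apply: le_trans (ler_norm _) _.
  by rewrite normrM (ger0_norm (wgt_ge0 _)) ler_piMr// wgt_le1.
have fL x : `|f x - f 0| <= C * `|x| by have := lipschitz_mvt df f1C x 0; rewrite subr0.
have E n : \int[mu]_x (costr 0 f x * gauss (c n) x) =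
   2 * pi * f 0 + Num.sqrt (pi / c n) * \int[mu]_x ((f x - f 0) * gauss (k n) x).
  have dgk := decay_gauss (k0 n).
  have dfg : decay (fun x => f x * gauss (k n) x).
    apply: (decayM (C := 1)) => //; first exact: continuous_gauss.
    by move=> x; rewrite gtr0_norm ?gauss_gt0// gauss_le1.
  rewrite -Rintegral_costr_exchange//; last exact: decay_gauss.
  under eq_Rintegral do rewrite costr_gauss//.
  have -> : (4 * c n)^-1 = k n by rewrite /c; field; rewrite gt_eqF.
  under eq_Rintegral do rewrite -mulrA.
  rewrite RintegralZl//; last first.
    by have := integrable_decay dfg; apply: eq_integrable => // x _ /=; rewrite mulrC.
  under [X in _ = _ + _ * X]eq_Rintegral do rewrite mulrBl.
  rewrite RintegralB//; last 2 first.
  - exact: integrable_decay.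
  - exact/integrable_decay/decayZ.
  rewrite RintegralZl//; last exact: integrable_decay.
  rewrite Rintegral_gauss// mulrBr.
  have -> : Num.sqrt (pi / c n) * (f 0 * Num.sqrt (pi / k n)) = 2 * pi * f 0.
    rewrite mulrCA -sqrtrM; last by rewrite divr_ge0 ?pi_ge0// ltW.
    have -> : pi / c n * (pi / k n) = (2 * pi) ^+ 2.
      by rewrite /c; field; rewrite gt_eqF.
    by rewrite sqrtr_sqr ger0_norm ?mulr_ge0 ?pi_ge0// mulrC.
  rewrite addrC subrK; congr (_ * _); apply: eq_Rintegral => x _; exact: mulrC.
rewrite (eq_cvg _ _ E).
suff H0 : Num.sqrt (pi / c n) * \int[mu]_x ((f x - f 0) * gauss (k n) x)
    @[n --> \oo] --> 0.
  by have := cvgD (cvg_cst (2 * pi * f 0)) H0; rewrite addr0; exact.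
have bnd n : `|Num.sqrt (pi / c n) * \int[mu]_x ((f x - f 0) * gauss (k n) x)| <=
    (C * 4 * pi) * (Num.sqrt (k n))^-1.
  set s := Num.sqrt (k n).
  have s0 : 0 < s by rewrite sqrtr_gt0.
  have sE : s ^+ 2 = k n by rewrite sqr_sqrtr// ltW.
  have k20 : 0 < k n / 2 by rewrite divr_gt0.
  have pw x : `|(f x - f 0) * gauss (k n) x| <= C * s^-1 * gauss (k n / 2) x.
    rewrite normrM (gtr0_norm (gauss_gt0 _ _)) {1}[k n]splitr gaussD mulrA.
    apply: ler_wpM2r; first exact/ltW/gauss_gt0.
    apply: (@le_trans _ _ (C * `|x| * gauss (k n / 2) x)).
      by apply: ler_wpM2r; [exact/ltW/gauss_gt0|exact: fL].
    rewrite -mulrA; apply: ler_wpM2l; first exact: normr_ge0.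
    by rewrite -sE; exact: mul_gauss_le.
  have ig : mu.-integrable setT (EFin \o (fun x => C * s^-1 * gauss (k n / 2) x)).
    exact/integrable_decay/decayZ/decay_gauss.
  have mf : measurable_fun setT (fun x => (f x - f 0) * gauss (k n) x).
    apply: continuous_measurable_fun => x; apply: cvgM; last exact: continuous_gauss.
    by apply: cvgB; [exact: Df.1|exact: cvg_cst].
  have ifg : mu.-integrable setT (EFin \o (fun x => (f x - f 0) * gauss (k n) x)).
    apply: le_integrable ig => //; first exact/measurable_EFinP.
    by move=> x _ /=; rewrite lee_fin (le_trans (pw x))// ler_norm.
  rewrite normrM ger0_norm ?sqrtr_ge0//.
  have H : `|\int[mu]_x ((f x - f 0) * gauss (k n) x)| <= C * s^-1 * Num.sqrt (pi / (k n / 2)).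
    rewrite -Rintegral_gauss// -RintegralZl//; last exact/integrable_decay/decay_gauss.
    apply: (le_trans (le_normr_Rintegral _ _)) => //.
    by apply: le_Rintegral => //; exact: integrable_norm.
  apply: (le_trans (ler_wpM2l (sqrtr_ge0 _) H)).
  rewrite mulrCA -sqrtrM; last by rewrite divr_ge0 ?pi_ge0// ltW.
  have -> : pi / c n * (pi / (k n / 2)) = 2 * (2 * pi) ^+ 2.
    by rewrite /c; field; rewrite gt_eqF.
  rewrite sqrtrM// sqrtr_sqr ger0_norm ?mulr_ge0 ?pi_ge0//.
  have : Num.sqrt 2 <= 2 :> R.
    by rewrite -[leRHS]ger0_norm// -sqrtr_sqr ler_wsqrtr// expr2; lra.
  move=> h2; have := pi_ge0 R; have : 0 <= C * s^-1 by apply: mulr_ge0; [exact: normr_ge0|rewrite invr_ge0 ltW].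
  move: (Num.sqrt 2) h2 => z h2 h3 h4.
  have -> : C * 4 * pi / s = C / s * (2 * (2 * pi)) by ring.
  apply: ler_wpM2l => //; apply: ler_wpM2r => //.
  by rewrite mulr_ge0.
apply/cvgr0Pnorm_le => e e0.
near=> n; apply: le_trans (bnd n) _.
suff : C * 4 * pi <= Num.sqrt (k n) * e.
  by move=> h; rewrite ler_pdivrMr ?sqrtr_gt0// (mulrC e).
rewrite -ler_pdivrMr//; set D := C * 4 * pi / e.
have D0 : 0 <= D.
  apply: divr_ge0; last exact: ltW.
  by rewrite mulr_ge0 ?pi_ge0// mulr_ge0 ?normr_ge0.
rewrite -[leLHS]ger0_norm// -sqrtr_sqr; apply: ler_wsqrtr.
apply: (@le_trans _ _ n%:R); last by rewrite /k ler_nat.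
by near: n; exact: nbhs_infty_ger.
Unshelve. all: by end_near. Qed.

End Inversion.

(** * Kernels of even symbols *)

Section FundamentalIdentity.
Context {R : realType}.
Local Notation mu := (@lebesgue_measure R).

(** A function with all its derivatives: level [k] is the [k]-th derivative of
    level 0.  Keeping the whole sequence makes derivatives explicit data. *)
Definition jet (f : nat -> R -> R) := forall k (x : R), is_derive x 1 (f k) (f k.+1 x).

Lemma costr_derive2 (f : nat -> R -> R) k x : jet f -> (forall k, decay (f k)) ->
  costr 0 (f k.+2) x = - (x ^+ 2 * costr 0 (f k) x).
Proof.
move=> jf df.
rewrite expr2 -mulrA (costrM_var 0 x (jf k))// mulrN (costrM_var _ x (jf k.+1))// opprK.
rewrite -mulN1r -RintegralZl//; last exact/integrable_decay/decay_cos.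
apply: eq_Rintegral => y _; rewrite mulrA; congr (_ * _).
have -> : x * y + (0 - pi / 2 - pi / 2) = x * y - pi by field.
by have := cosDpi (x * y - pi); rewrite subrK addr0 mulN1r.
Qed.

Lemma costr_derive_even (f : nat -> R -> R) k x : jet f -> (forall k, decay (f k)) ->
  costr 0 (f k.*2) x = (-1) ^+ k * x ^+ k.*2 * costr 0 (f 0%N) x.
Proof.
move=> jf df; elim: k => [|k IH]; first by rewrite !expr0 !mul1r.
by rewrite doubleS costr_derive2// IH exprS !exprS; ring.
Qed.

(** The coefficient of the [m]-th real derivative in the operator of symbol
    [sum_m c_m xi^m] with [c_m = 0] for odd [m]: [(- i)^m = (-1)^(m/2)] for even
    [m]. *)
Definition symb (c : nat -> R) m : R := (-1) ^+ m./2 * c m.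

(** A quantitative form of the equation satisfied by a fundamental solution, strong
    enough to survive the induction on the dimension. *)
Definition delta_rate (G : R -> R) (c : nat -> R) (D : R) := forall (f : nat -> R -> R) B K,
  jet f -> (forall k, decay (f k)) ->
  (forall m x, `|c m * f m x| <= B * 2^-1 ^+ m * wgt x) ->
  `|\sum_(m < K) symb c m * \int[mu]_x (G x * f m x) - f 0%N 0| <= D * B * 2^-1 ^+ K.

Variables (g : R -> R) (c : nat -> R).
Hypothesis dg : decay g.
Hypothesis g_ge0 : forall x, 0 <= g x.
Hypothesis c_ge0 : forall m, 0 <= c m.
Hypothesis c_odd : forall m, odd m -> c m = 0.
Hypothesis cg_le1 : forall K x, \sum_(m < K) c m * x ^+ m * g x <= 1.
Hypothesis cg_cvg : forall x, \sum_(m < K) c m * x ^+ m * g x @[K --> \oo] --> (1:R).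

Definition kern x : R := (2 * pi)^-1 * costr 0 g x.

Lemma two_pi_neq0 : 2 * pi != 0 :> R.
Proof. by rewrite mulf_neq0 ?pnatr_eq0// gt_eqF// pi_gt0. Qed.

Lemma continuous_kern : continuous kern.
Proof. by move=> x; apply: cvgM; [exact: cvg_cst|exact: continuous_costr]. Qed.

Lemma kern_bounded : exists2 C, 0 <= C & forall x, `|kern x| <= C.
Proof.
have [C gC] := dg.2; exists (`|(2 * pi)^-1| * `|C * wgt_mass|); first exact: mulr_ge0.
move=> x; rewrite normrM ler_wpM2l// (le_trans (costr_le _ _ dg.1 gC))//.
exact: ler_norm.
Qed.

Lemma decay_kernM f : decay f -> decay (fun x => kern x * f x).
Proof.
move=> df; have [C C0 kC] := kern_bounded.
under eq_fun do rewrite mulrC.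
by apply: (decayM (C := C)) => //; exact: continuous_kern.
Qed.

Lemma symb_costr (f : nat -> R -> R) m x : jet f -> (forall k, decay (f k)) ->
  symb c m * costr 0 (f m) x = c m * x ^+ m * costr 0 (f 0%N) x.
Proof.
move=> jf df; rewrite /symb; have [mo|me] := boolP (odd m).
  by rewrite c_odd// !(mulr0, mul0r).
rewrite -[in f m](even_halfK me) -[in x ^+ m](even_halfK me) costr_derive_even//.
have : (-1) ^+ m./2 * (-1) ^+ m./2 = 1 :> R by rewrite -exprMn mulrNN mulr1 expr1n.
move: ((-1) ^+ m./2) (x ^+ _) (costr _ _ _) => s X F ss.
have -> : s * c m * (s * X * F) = (s * s) * (c m * X * F) by ring.
by rewrite ss mul1r.
Qed.

(** The transform is moved from the kernel to the test function. *)
Lemma int_kern f m : decay f ->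
  symb c m * \int[mu]_x (kern x * f x) =
  (2 * pi)^-1 * \int[mu]_x (symb c m * costr 0 f x * g x).
Proof.
move=> df.
have [C gC] := dg.2.
have [D fD] := df.2.
have dcg : decay (fun x => costr 0 f x * g x).
  under eq_fun do rewrite mulrC.
  apply: (decayM (C := D * wgt_mass)) => //; first exact: continuous_costr.
  by move=> x; apply: costr_le fD; exact: df.1.
have dcf : decay (fun x => costr 0 g x * f x).
  under eq_fun do rewrite mulrC.
  apply: (decayM (C := C * wgt_mass)) => //; first exact: continuous_costr.
  by move=> x; apply: costr_le gC; exact: dg.1.
under [X in _ = _ * X]eq_Rintegral do rewrite -mulrA.
rewrite RintegralZl//; last exact: integrable_decay.
rewrite -Rintegral_costr_exchange// mulrCA; congr (_ * _).
rewrite /kern; under eq_Rintegral do rewrite -mulrA.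
by rewrite RintegralZl//; exact: integrable_decay.
Qed.

(** After the transform is moved to [f], the [K]-th partial sum is the integral of
    [(sum_(m < K) c_m x^m g(x)) costr 0 f x].  The bracket lies between 0 and 1 and
    tends to 1, so dominated convergence and the inversion formula give [f 0]. *)
Lemma symb_sum_cvg (f : nat -> R -> R) : jet f -> (forall k, decay (f k)) ->
  \sum_(m < K) symb c m * \int[mu]_x (kern x * f m x) @[K --> \oo] --> f 0%N 0.
Proof.
move=> jf df.
have E K : \sum_(m < K) symb c m * \int[mu]_x (kern x * f m x) =
   (2 * pi)^-1 * \int[mu]_x ((\sum_(m < K) c m * x ^+ m * g x) * costr 0 (f 0%N) x).
  under eq_bigr do rewrite int_kern//.
  rewrite -mulr_sumr; congr (_ * _).
  elim: K => [|K IH].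
    rewrite big_ord0; under eq_Rintegral do rewrite big_ord0 mul0r.
    by rewrite /Rintegral integral0.
  rewrite big_ord_recr/= IH.
  have e m x : symb c m * costr 0 (f m) x * g x = c m * x ^+ m * g x * costr 0 (f 0%N) x.
    by rewrite symb_costr//; ring.
  have dm m : decay (fun x => c m * x ^+ m * g x * costr 0 (f 0%N) x).
    rewrite (_ : (fun x => _) = (fun x => symb c m * (g x * costr 0 (f m) x))); last first.
      by apply/funext => x; rewrite -e; ring.
    have [D fD] := (df m).2.
    apply: decayZ; apply: (decayM (C := D * wgt_mass)) => //; first exact: continuous_costr.
    by move=> x; apply: costr_le fD; exact: (df m).1.
  under [X in _ + X]eq_Rintegral do rewrite e.
  rewrite -RintegralD//; last 2 first.
  - apply: integrable_decay; elim: K {IH} => [|K IH].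
      under eq_fun do rewrite big_ord0 mul0r; split; first exact: cst_continuous.
      by exists 0 => x; rewrite normr0 mul0r.
    under eq_fun do rewrite big_ord_recr/= mulrDl; exact: decayD.
  - exact: integrable_decay.
  by apply: eq_Rintegral => x _; rewrite big_ord_recr/= mulrDl.
have D0 := decay_costr (jf 0%N) (jf 1%N) (df _) (df _) (df _).
have s0 K x : 0 <= \sum_(m < K) c m * x ^+ m * g x.
  apply: sumr_ge0 => m _; have [mo|me] := boolP (odd m); first by rewrite c_odd// !mul0r.
  by rewrite !mulr_ge0// exprn_even_ge0.
rewrite (eq_cvg _ _ E).
have -> : f 0%N 0 = (2 * pi)^-1 * \int[mu]_x costr 0 (f 0%N) x.
  by rewrite (cosine_inversion (jf 0%N) (jf 1%N))// mulrA mulVf ?two_pi_neq0// mul1r.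
apply: cvgM; first exact: cvg_cst.
apply: (@dominated_Rintegral_cvg _ _ _ mu _ _ (fun x => `|costr 0 (f 0%N) x|)).
- move=> K; apply: continuous_measurable_fun => x.
  apply: cvgM; last exact: D0.1.
  elim: K => [|K IH]; first by under eq_fun do rewrite big_ord0; rewrite big_ord0; exact: cvg_cst.
  under eq_fun do rewrite big_ord_recr/=; rewrite big_ord_recr/=.
  apply: cvgD => //; apply: cvgM; last exact: dg.1.
  apply: cvgM; first exact: cvg_cst.
  exact: exprn_continuous.
- exact/integrable_norm/integrable_decay.
- by move=> K x; rewrite normrM ger0_norm// ler_piMl.
- move=> x; rewrite -[X in _ --> X]mul1r; apply: cvgM; [exact: cg_cvg|exact: cvg_cst].
Qed.

Lemma geo_ord_le (q : R) K : 0 <= q -> q < 1 -> \sum_(k < K) q ^+ k <= (1 - q)^-1.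
Proof.
rewrite -subr_gt0 => q0 q1.
have -> : \sum_(k < K) q ^+ k = (1 - q ^+ K) / (1 - q).
  elim: K => [|K IH]; first by rewrite big_ord0 expr0 subrr mul0r.
  by rewrite big_ord_recr/= IH exprS; field; rewrite gt_eqF.
by rewrite ler_piMl ?invr_ge0 ?(ltW q1)// gerBl exprn_ge0.
Qed.

Lemma geo_sum_le (K N : nat) : \sum_(K <= m < N) (2^-1 : R) ^+ m <= 2 * 2^-1 ^+ K.
Proof.
have [NK|KN] := leqP N K.
  by rewrite big_geq// mulr_ge0// exprn_ge0// invr_ge0.
suff -> : \sum_(K <= m < N) (2^-1 : R) ^+ m = 2 * 2^-1 ^+ K - 2 * 2^-1 ^+ N.
  by rewrite gerBl mulr_ge0// exprn_ge0// invr_ge0.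
elim: N KN => // N IH; rewrite ltnS leq_eqVlt => /predU1P[->|KN].
  by rewrite big_nat1 exprS mulrA divff// mul1r; ring.
rewrite big_nat_recr 1?ltnW//= IH// exprS (mulrA 2 2^-1) divff// mul1r; ring.
Qed.

(** The terms of the convergent series are geometrically small, hence so is the
    remainder. *)
Theorem symb_sum_rate : exists2 D, 0 <= D & delta_rate kern c D.
Proof.
have [C C0 kC] := kern_bounded.
exists (C * wgt_mass * 2); first by rewrite !mulr_ge0// wgt_mass_ge0.
move=> f B K jf df fB.
pose S K := \sum_(m < K) symb c m * \int[mu]_x (kern x * f m x).
have B0 : 0 <= B.
  by have := le_trans (normr_ge0 _) (fB 0%N 0); rewrite expr0 mulr1 pmulr_lge0// wgt_gt0.
have term m : `|symb c m * \int[mu]_x (kern x * f m x)| <= C * B * wgt_mass * 2^-1 ^+ m.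
  rewrite /symb !normrM normrX normrN normr1 expr1n mul1r -normrM.
  have ik := integrable_decay (decay_kernM (df m)).
  rewrite -RintegralZl//.
  rewrite mulrAC; apply: Rintegral_le_wgt.
    have /integrableP[/measurable_EFinP mk _] := ik.
    exact: measurable_funM.
  move=> x; rewrite mulrCA normrM.
  apply: (le_trans (ler_pM (normr_ge0 _) (normr_ge0 _) (kC x) (fB m x))).
  by rewrite !mulrA.
have SB N : (K <= N)%N -> `|S K - S N| <= C * wgt_mass * 2 * B * 2^-1 ^+ K.
  move=> KN; rewrite distrC /S -!(big_mkord xpredT (fun m => symb c m * \int[mu]_x (kern x * f m x))).
  rewrite (big_cat_nat (n := K))//= [X in X - _]addrC addrK.
  apply: (le_trans (ler_norm_sum _ _ _)).
  apply: (@le_trans _ _ (\sum_(K <= m < N) C * B * wgt_mass * 2^-1 ^+ m)).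
    by apply: ler_sum => m _; exact: term.
  rewrite -mulr_sumr (_ : C * wgt_mass * 2 * B * 2^-1 ^+ K = C * B * wgt_mass * (2 * 2^-1 ^+ K)); last by ring.
  by rewrite ler_wpM2l ?geo_sum_le// !mulr_ge0// wgt_mass_ge0.
have H := symb_sum_cvg jf df.
have H2 : `|S K - S N| @[N --> \oo] --> `|S K - f 0%N 0|.
  by apply: cvg_norm; apply: cvgB; [exact: cvg_cst|exact: H].
apply: (cvgr_to_le H2).
by near=> N; apply: SB; near: N; exact: nbhs_infty_ge.
Unshelve. all: by end_near. Qed.

End FundamentalIdentity.

(** * Taylor coefficients and exponential decay of transforms *)

Section TaylorJets.
Context {R : realType}.
Local Notation mu := (@lebesgue_measure R).
Implicit Types (a u v : nat -> R -> R) (h B : R -> R).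

(** Here [a p x] is the [p]-th Taylor coefficient of [a 0] at [x], the derivative
    divided by [p!]: products become Cauchy products without binomials. *)
Definition tjet a := forall p (x : R), is_derive x 1 (a p) (p.+1%:R * a p.+1 x).

(** The Taylor series of [h] at every real [x] converges absolutely at distance [s],
    with norm at most [B x].  This norm is submultiplicative and replaces a supremum
    over complex discs. *)
Definition jbound (s : R) h B := exists a,
  [/\ tjet a, forall x, a 0%N x = h x &
      forall m x, \sum_(p < m) `|a p x| * s ^+ p <= B x].

Definition cauchy_prod u v p x : R := \sum_(i < p.+1) u i x * v (p - i)%N x.

Lemma tjet_cauchy u v : tjet u -> tjet v -> tjet (cauchy_prod u v).
Proof.
move=> ju jv p x.
have H i : is_derive x 1 (fun x => u i x * v (p - i)%N x)
    (i.+1%:R * u i.+1 x * v (p - i)%N x + (p - i).+1%:R * (u i x * v (p - i).+1 x)).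
  have H1 := ju i x; have H2 := jv (p - i)%N x.
  by apply: is_derive_eq; rewrite /GRing.scale/=; ring.
have H2 : is_derive x 1 (cauchy_prod u v p) (\sum_(i < p.+1)
    (i.+1%:R * u i.+1 x * v (p - i)%N x + (p - i).+1%:R * (u i x * v (p - i).+1 x))).
  rewrite /cauchy_prod (_ : (fun x => _) = \sum_(i < p.+1) (fun x => u i x * v (p - i)%N x)).
    by apply: is_derive_sum => i.
  by apply/funext => z; rewrite fct_sumE.
apply: (is_derive_eq H2); rewrite big_split/=.
have -> : \sum_(i < p.+1) i.+1%:R * u i.+1 x * v (p - i)%N x =
    \sum_(i < p.+2) i%:R * (u i x * v (p.+1 - i)%N x).
  rewrite [RHS]big_ord_recl/= !mul0r add0r; apply: eq_bigr => i _.
  by rewrite /bump/= add1n subSS -mulrA.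
have -> : \sum_(i < p.+1) (p - i).+1%:R * (u i x * v (p - i).+1 x) =
    \sum_(i < p.+2) (p.+1 - i)%:R * (u i x * v (p.+1 - i)%N x).
  rewrite [RHS]big_ord_recr/= subnn mul0r addr0; apply: eq_bigr => i _.
  by rewrite subSn// -ltnS.
rewrite -big_split/= /cauchy_prod mulr_sumr; apply: eq_bigr => i _.
by rewrite -mulrDl -natrD subnKC// -ltnS.
Qed.

Lemma cauchy_sum_le u v s m x : 0 <= s ->
  \sum_(p < m) `|cauchy_prod u v p x| * s ^+ p <=
  (\sum_(p < m) `|u p x| * s ^+ p) * (\sum_(p < m) `|v p x| * s ^+ p).
Proof.
move=> s0.
pose F i j := (`|u i x| * s ^+ i) * (`|v j x| * s ^+ j).
have F0 i j : 0 <= F i j by rewrite !mulr_ge0// exprn_ge0.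
have -> : (\sum_(p < m) `|u p x| * s ^+ p) * (\sum_(p < m) `|v p x| * s ^+ p) =
    \sum_(i < m) \sum_(j < m) F i j.
  by rewrite mulr_suml; apply: eq_bigr => i _; rewrite mulr_sumr.
apply: (@le_trans _ _ (\sum_(p < m) \sum_(i < m | (i <= p)%N) F i (p - i)%N)).
  apply: ler_sum => p _; rewrite /cauchy_prod.
  have -> : \sum_(i < m | (i <= p)%N) F i (p - i)%N = \sum_(i < p.+1) F i (p - i)%N.
    rewrite [RHS](big_ord_widen_cond m (fun=> true) (fun i => F i (p - i)%N))//.
  apply: (@le_trans _ _ ((\sum_(i < p.+1) `|u i x * v (p - i)%N x|) * s ^+ p)).
    by rewrite ler_wpM2r ?exprn_ge0// ler_norm_sum.
  rewrite mulr_suml; apply: ler_sum => i _; rewrite normrM /F.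
  have ip : (i <= p)%N by rewrite -ltnS.
  have -> : s ^+ p = s ^+ i * s ^+ (p - i) by rewrite -exprD subnKC.
  apply: eq_ler; ring.
rewrite (exchange_big_dep predT)//=; apply: ler_sum => i _.
rewrite -(big_mkord (fun p => (i <= p)%N) (fun p => F i (p - i)%N)).
rewrite -(big_mkord xpredT (fun p => F i p)).
rewrite (big_cat_nat (n := i)) ?(ltnW (ltn_ord i))//=.
rewrite big_nat_cond big1 ?add0r; last first.
  by move=> p /andP[/andP[_ pi] ip]; move: pi; rewrite ltnNge ip.
rewrite -{1}[(i : nat)]add0n big_addn.
have -> : \sum_(0 <= p < m - i | (i <= p + i)%N) F i (p + i - i)%N =
  \sum_(0 <= p < m - i) F i p.
  by apply: eq_big => p; [rewrite leq_addl|rewrite addnK].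
by rewrite [leRHS](big_cat_nat (n := (m - i)%N)) ?leq_subr//= lerDl sumr_ge0.
Qed.

Lemma jboundM s h B h' B' : 0 <= s -> jbound s h B -> jbound s h' B' ->
  jbound s (fun x => h x * h' x) (fun x => B x * B' x).
Proof.
move=> s0 [u [ju u0 uB]] [v [jv v0 vB]]; exists (cauchy_prod u v); split.
- exact: tjet_cauchy.
- by move=> x; rewrite /cauchy_prod big_ord1 subnn u0 v0.
- move=> m x; apply: (le_trans (cauchy_sum_le _ _ _ _ s0)).
  apply: ler_pM => //.
  + by apply: sumr_ge0 => i _; rewrite mulr_ge0// exprn_ge0.
  + by apply: sumr_ge0 => i _; rewrite mulr_ge0// exprn_ge0.
Qed.

Lemma jbound1 s : jbound s (fun=> 1) (fun=> 1).
Proof.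
exists (fun p _ => (p == 0)%:R); split => //.
  move=> p x; rewrite mulr0; case: p => [|p]; exact: is_derive_cst.
move=> [|m] x; first by rewrite big_ord0.
rewrite big_ord_recl/= normr1 mul1r big1 ?addr0// => i _.
by rewrite normr0 mul0r.
Qed.

Lemma jboundX s : 0 <= s -> jbound s id (fun x => `|x| + s).
Proof.
move=> s0; exists (fun p x => if p == 0%N then x else (p == 1%N)%:R); split => //.
  move=> [|p] x /=.
    by rewrite mulr1; exact: is_derive_id.
  by rewrite mulr0; case: p => [|p]; exact: is_derive_cst.
move=> m x.
have s1 p : 0 <= `|if p == 0%N then x else (p == 1%N)%:R| * s ^+ p.
  by rewrite mulr_ge0// exprn_ge0.
apply: (@le_trans _ _ (\sum_(p < m.+2) `|if p == 0%N :> nat then x else (p == 1%N :> nat)%:R| * s ^+ p)).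
  rewrite 2!big_ord_recr/= -addrA lerDl.
  by apply: addr_ge0; [exact: (s1 m)|exact: (s1 m.+1)].
rewrite big_ord_recl/= big_ord_recl/= /bump/= normr1 expr1 mulr1 mul1r big1 ?addr0// => i _.
by rewrite normr0 mul0r.
Qed.

Lemma jboundXn s k : 0 <= s -> jbound s (fun x => x ^+ k) (fun x => (`|x| + s) ^+ k).
Proof.
move=> s0; elim: k => [|k IH]; first by under eq_fun do rewrite expr0; exact: jbound1.
under eq_fun do rewrite exprS; under [X in jbound _ _ X]eq_fun do rewrite exprS.
exact: (jboundM s0 (jboundX s0) IH).
Qed.

(** Inverting a power series is a recursion on all previous coefficients, hence
    the list of the coefficients of index at most [p]. *)
Fixpoint invlist (f : nat -> R) (p : nat) : seq R :=
  if p is p'.+1 then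
    let l := invlist f p' in
    rcons l (- (\sum_(i < p) f (p - i)%N * l`_i) / f 0%N)
  else [:: (f 0%N)^-1].

Lemma size_invlist f p : size (invlist f p) = p.+1.
Proof. by elim: p => //= p IH; rewrite size_rcons IH. Qed.

Definition invjet a p x : R := (invlist (fun q => a q x) p)`_p.

Lemma nth_invlist f p q : (q <= p)%N -> (invlist f p)`_q = (invlist f q)`_q.
Proof.
elim: p => [|p IH]; first by rewrite leqn0 => /eqP->.
rewrite leq_eqVlt => /predU1P[->//|qp].
by rewrite [invlist f p.+1]/= nth_rcons size_invlist qp IH.
Qed.

Lemma invjet0 a x : invjet a 0%N x = (a 0%N x)^-1. Proof. by []. Qed.

Lemma invjetS a p x : invjet a p.+1 x =
  - (\sum_(i < p.+1) a (p.+1 - i)%N x * invjet a i x) / a 0%N x.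
Proof.
rewrite /invjet [invlist _ p.+1]/= nth_rcons size_invlist ltnn eqxx.
congr (- _ / _); apply: eq_bigr => i _; rewrite nth_invlist//.
by rewrite -ltnS.
Qed.

Lemma invjet_mul a p x : a 0%N x != 0 ->
  a 0%N x * invjet a p x = (p == 0%N)%:R - \sum_(i < p) a (p - i)%N x * invjet a i x.
Proof.
move=> a0; case: p => [|p]; first by rewrite invjet0 divff// big_ord0 subr0.
by rewrite invjetS mulrC divfK// sub0r.
Qed.

(** Strong induction: the coefficient of order [p] is a rational expression of those
    of smaller order, and the derivatives recombine through
    [(p - i) + i = p]. *)
Lemma tjet_inv a : tjet a -> (forall x, a 0%N x != 0) -> tjet (invjet a).
Proof.
move=> ja a0 p; elim/ltn_ind: p => p IH x.
have e : invjet a p = fun x => ((p == 0%N)%:R - \sum_(i < p) a (p - i)%N x * invjet a i x) * (a 0%N x)^-1.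
  by apply/funext => z; rewrite -invjet_mul// mulrC mulKf.
have H i : (i < p)%N -> is_derive x 1 (fun x => a (p - i)%N x * invjet a i x)
    ((p - i).+1%:R * (a (p - i).+1 x * invjet a i x) + i.+1%:R * (a (p - i)%N x * invjet a i.+1 x)).
  move=> ip; have H1 := ja (p - i)%N x; have H2 := IH i ip x.
  by apply: is_derive_eq; rewrite /GRing.scale/=; ring.
pose D := \sum_(i < p) ((p - i).+1%:R * (a (p - i).+1 x * invjet a i x) + i.+1%:R * (a (p - i)%N x * invjet a i.+1 x)).
have H2 : is_derive x 1 (fun x => \sum_(i < p) a (p - i)%N x * invjet a i x) D.
  rewrite (_ : (fun x => _) = \sum_(i < p) (fun x => a (p - i)%N x * invjet a i x)).
    by apply: is_derive_sum => i; exact: H.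
  by apply/funext => z; rewrite fct_sumE.
have H3 := ja 0%N x.
have H4 := is_deriveV (a0 x) H3.
rewrite e.
have H5 : is_derive x 1 (fun x => (p == 0%N)%:R - \sum_(i < p) a (p - i)%N x * invjet a i x) (- D).
  apply: (is_derive_eq (is_deriveB (is_derive_cst ((p == 0%N)%:R : R) x 1) H2)).
  by rewrite sub0r.
apply: (is_derive_eq (is_deriveM H5 H4)).
rewrite /GRing.scale/=.
set N := _ - _; have Ne : N = a 0%N x * invjet a p x by rewrite /N invjet_mul.
have DE : D = \sum_(i < p.+1) (p.+1 - i)%:R * (a (p.+1 - i)%N x * invjet a i x)
   - a 1%N x * invjet a p x + \sum_(i < p.+1) i%:R * (a (p.+1 - i)%N x * invjet a i x).
  rewrite /D big_split/= big_ord_recr/= subSnn mul1r addrK; congr (_ + _).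
    by apply: eq_bigr => i _; rewrite subSn// ltnW.
  by rewrite [RHS]big_ord_recl/= mul0r add0r; apply: eq_bigr => i _; rewrite /bump/= add1n subSS.
have DE' : D = p.+1%:R * (\sum_(i < p.+1) a (p.+1 - i)%N x * invjet a i x)
    - a 1%N x * invjet a p x.
  rewrite DE addrAC -big_split/= mulr_sumr; congr (_ - _); apply: eq_bigr => i _.
  by rewrite -mulrDl -natrD subnK// ltnW.
rewrite Ne DE' invjetS; field; exact: a0.
Qed.

(** The Neumann series: if the part of positive order of [a] has norm at most [W],
    and [W < a 0], the inverse has norm at most [(a 0 - W)^-1].  The proof bounds
    [(a 0 - W) S] by 1, where [S] is a partial sum for the inverse, from the
    recursion and the submultiplicativity of the norm. *)
Lemma jbound_inv s a (W : R -> R) : 0 <= s -> tjet a ->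
  (forall x, W x < a 0%N x) -> (forall x, 0 <= W x) ->
  (forall m x, \sum_(p < m) `|a p.+1 x| * s ^+ p.+1 <= W x) ->
  jbound s (fun x => (a 0%N x)^-1) (fun x => (a 0%N x - W x)^-1).
Proof.
move=> s0 ja Wa W0 aW.
have a_gt0 x : 0 < a 0%N x by exact: le_lt_trans (W0 x) (Wa x).
exists (invjet a); split => //.
  by apply: tjet_inv => // x; rewrite gt_eqF.
move=> m x; set S := \sum_(_ < _) _.
have S0 : 0 <= S by apply: sumr_ge0 => p _; rewrite mulr_ge0// exprn_ge0.
rewrite -[leRHS]mul1r ler_pdivlMr ?subr_gt0// mulrBr lerBlDr mulrC.
(* The part of positive order, so that the recursion for the inverse reads
   as a Cauchy product of [b] with the inverse. *)
pose b p x := if p is 0 then 0 else a p x.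
have H p : a 0%N x * `|invjet a p x| <= (p == 0%N)%:R + `|cauchy_prod b (invjet a) p x|.
  rewrite -[a 0%N x]gtr0_norm// -normrM invjet_mul; last by rewrite gt_eqF.
  apply: (le_trans (ler_normB _ _)); rewrite normr_nat lerD2l.
  apply: eq_ler; congr `|_|.
  rewrite /cauchy_prod [RHS](reindex_inj rev_ord_inj)/= [RHS]big_ord_recr/= subSS subnn/=.
  rewrite mul0r addr0; apply: eq_bigr => i _.
  rewrite !subSS subKn; last exact: ltnW.
  by rewrite /b; have := ltn_ord i; rewrite -subn_gt0; case: (p - i)%N.
apply: (@le_trans _ _ (\sum_(p < m) ((p == 0%N :> nat)%:R + `|cauchy_prod b (invjet a) p x|) * s ^+ p)).
  rewrite mulr_sumr; apply: ler_sum => p _.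
  by rewrite mulrA ler_wpM2r// exprn_ge0.
under eq_bigr do rewrite mulrDl; rewrite big_split/= lerD//.
  case: m {S S0} => [|m]; first by rewrite big_ord0.
  by rewrite big_ord_recl/= expr0 mulr1 big1 ?addr0// => i _; rewrite mul0r.
apply: (le_trans (cauchy_sum_le _ _ _ _ s0)).
rewrite -/S mulrC ler_wpM2l//.
case: m {S S0} => [|m]; first by rewrite big_ord0.
by rewrite big_ord_recl/= normr0 mul0r add0r; exact: aW.
Qed.

Lemma tjet_continuous a p : tjet a -> continuous (a p).
Proof.
by move=> ja; exact: is_derive_continuous (ja p).
Qed.

Section ExpDecay.
Variables (a : nat -> R -> R) (s C : R).
Hypotheses (s_gt0 : 0 < s) (ja : tjet a).
Hypothesis aC : forall p x, `|a p x| * s ^+ p <= C * wgt x.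

Let aC' p x : `|a p x| <= C / s ^+ p * wgt x.
Proof. by rewrite mulrAC ler_pdivlMr ?exprn_gt0. Qed.

Let da p : decay (a p).
Proof. by split; [exact: tjet_continuous|exists (C / s ^+ p)]. Qed.

(** [p] integrations by parts; the factorials come from the derivatives of Taylor
    coefficients. *)
Lemma costr_moment p q b x :
  `|x| ^+ p * `|costr b (a q) x| <= ((p + q)`!%:R / q`!%:R) * (C / s ^+ (p + q)) * wgt_mass.
Proof.
elim: p q b => [|p IH] q b.
  by rewrite expr0 mul1r add0n divff ?pnatr_eq0 -?lt0n ?fact_gt0// mul1r; exact: costr_le (da q).1 (aC' q).
rewrite exprSr -mulrA -normrM.
rewrite (costrM_var b x (ja q) (da q)); last exact: decayZ.
have -> : costr (b - pi / 2) (fun y => q.+1%:R * a q.+1 y) x =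
   q.+1%:R * costr (b - pi / 2) (a q.+1) x.
  rewrite -RintegralZl//; last exact/integrable_decay/decay_cos.
  by apply: eq_Rintegral => y _; rewrite mulrCA.
rewrite normrN normrM normr_nat mulrCA.
apply: (le_trans (ler_wpM2l (ler0n _ _) (IH q.+1 _))).
rewrite addnS addSn le_eqVlt; apply/orP; left; apply/eqP.
rewrite (factS q) natrM; move: (((p + q).+1)`!%:R : R) => F.
move: (C / _) => D; field.
by rewrite pnatr_eq0 -lt0n fact_gt0/= addrC natr1 pnatr_eq0.
Qed.

(** The moment bounds of order [p], of size [p! s^-p], are summed against the
    exponential series at [k |x|]: the ratio [k / s <= 1/2] makes the sum
    geometric. *)
Lemma costr_exp_decay k b x : 0 <= k -> k <= s / 2 ->
  `|costr b (a 0%N) x| <= 2 * C * wgt_mass * expR (- (k * `|x|)).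
Proof.
move=> k0 ks.
rewrite expRN ler_pdivlMr ?expR_gt0//.
have C0 : 0 <= C.
  by have := aC 0%N 0; rewrite expr0 mulr1 => /(le_trans (normr_ge0 _)); rewrite pmulr_lge0// wgt_gt0.
have H : `|costr b (a 0%N) x| * series (exp_coeff (k * `|x|)) n @[n --> \oo] -->
    `|costr b (a 0%N) x| * expR (k * `|x|).
  by apply: cvgM; [exact: cvg_cst|exact: is_cvg_series_exp_coeff].
apply: (cvgr_to_le H).
apply: nearW => n; rewrite /series/= mulr_sumr.
apply: (@le_trans _ _ (\sum_(0 <= p < n) C * wgt_mass * 2^-1 ^+ p)).
  apply: ler_sum => p _; rewrite /exp_coeff/= exprMn.
  have := costr_moment p 0%N b x; rewrite addn0 fact0 divr1 => M.
  have fp : 0 < p`!%:R :> R by rewrite ltr0n fact_gt0.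
  have -> : `|costr b (a 0%N) x| * (k ^+ p * `|x| ^+ p / p`!%:R) =
     (k ^+ p / p`!%:R) * (`|x| ^+ p * `|costr b (a 0%N) x|) by ring.
  apply: (le_trans (ler_wpM2l _ M)); first by rewrite divr_ge0 ?exprn_ge0// ltW.
  have -> : k ^+ p / p`!%:R * (p`!%:R * (C / s ^+ p) * wgt_mass) = C * wgt_mass * (k ^+ p / s ^+ p).
    by field; rewrite !gt_eqF ?exprn_gt0.
  rewrite ler_wpM2l ?mulr_ge0 ?wgt_mass_ge0// -exprVn -exprMn lerXn2r ?nnegrE ?divr_ge0 ?(ltW s_gt0)//.
  by rewrite ler_pdivrMr// mulrC.
rewrite -mulr_sumr (le_trans (ler_wpM2l _ (geo_sum_le _ _)))//; first by rewrite mulr_ge0 ?wgt_mass_ge0.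
by rewrite expr0 mulr1; lra.
Qed.

End ExpDecay.

End TaylorJets.

(** * An infinite product and its power series *)

Lemma cvg_sum_ord {R : realType} (u : nat -> nat -> R) (l : nat -> R) K :
  (forall i, u i n @[n --> \oo] --> l i) ->
  \sum_(i < K) u i n @[n --> \oo] --> \sum_(i < K) l i.
Proof.
move=> ul; elim: K => [|K IH].
  rewrite big_ord0 (_ : (fun n => _) = fun=> 0); first exact: cvg_cst.
  by apply/funext => n; rewrite big_ord0.
rewrite big_ord_recr/= (_ : (fun n => _) = fun n => \sum_(i < K) u i n + u K n).
  exact: cvgD.
by apply/funext => n; rewrite big_ord_recr.
Qed.

Section InfiniteProduct.
Context {R : realType}.
Variables (b : nat -> R) (C : R).
Hypothesis b_gt0 : forall j, 0 < b j.
Hypothesis b_nd : forall i j, (i <= j)%N -> b i <= b j.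
Hypothesis b_tail : forall k J, (0 < k)%N ->
  \sum_(k <= j < J) (b j)^-1 <= C * k%:R / b k.

(** [w] stands for [xi^r]: positivity of the coefficients is visible in this
    variable. *)
Definition pprod J (w : R) : R := \prod_(j < J) (1 + w / b j).
Definition ppoly J : {poly R} := \prod_(j < J) (1 + (b j)^-1 *: 'X).

Lemma horner_ppoly J w : (ppoly J).[w] = pprod J w.
Proof.
rewrite /ppoly horner_prod; apply: eq_bigr => j _.
by rewrite hornerD hornerC hornerZ hornerX mulrC.
Qed.

Lemma ppolyS J k : (ppoly J.+1)`_k =
  (ppoly J)`_k + (if k is k'.+1 then (ppoly J)`_k' / b J else 0).
Proof.
rewrite /ppoly big_ord_recr/= mulrDr mulr1 coefD -scalerAr coefZ coefMX.
by case: k => [|k] /=; [rewrite mulr0|rewrite mulrC].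
Qed.

Lemma ppoly_coef_ge0 J k : 0 <= (ppoly J)`_k.
Proof.
elim: J k => [|J IH] k; first by rewrite /ppoly big_ord0 coef1 ler0n.
rewrite ppolyS addr_ge0//; case: k => // k.
by rewrite divr_ge0// ltW.
Qed.

Lemma ppoly_coef_nd k : nondecreasing_seq (fun J => (ppoly J)`_k).
Proof.
apply/nondecreasing_seqP => J; rewrite ppolyS lerDl.
by case: k => // k; rewrite divr_ge0 ?ppoly_coef_ge0// ltW.
Qed.

Lemma size_ppoly J : (size (ppoly J) <= J.+1)%N.
Proof.
elim: J => [|J IH]; first by rewrite /ppoly big_ord0 size_poly1.
apply/leq_sizeP => k Jk; rewrite ppolyS.
have /leq_sizeP H := IH; rewrite H; last by rewrite ltnW.
by case: k Jk => // k Jk; rewrite H// mul0r addr0.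
Qed.

Lemma pprodE J w : pprod J w = \sum_(k < J.+1) (ppoly J)`_k * w ^+ k.
Proof. by rewrite -horner_ppoly (horner_coef_wide _ (size_ppoly J)). Qed.

Lemma pprod_ge1 J w : 0 <= w -> 1 <= pprod J w.
Proof.
move=> w0; elim: J => [|J IH]; first by rewrite /pprod big_ord0.
rewrite /pprod big_ord_recr/= -[X in X <= _]mulr1 ler_pM//.
by rewrite lerDl divr_ge0// ltW.
Qed.

Lemma pprod_nd w : 0 <= w -> nondecreasing_seq (pprod^~ w).
Proof.
move=> w0; apply/nondecreasing_seqP => J; rewrite /pprod big_ord_recr/=.
rewrite ler_peMr//; first by rewrite (le_trans ler01)// pprod_ge1.
by rewrite lerDl divr_ge0// ltW.
Qed.

(** Each factor beyond [k] is at most the exponential of [w / b j]. *)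
Lemma pprod_cat k J w : (k <= J)%N -> 0 <= w ->
  pprod J w <= pprod k w * expR (w * \sum_(k <= j < J) (b j)^-1).
Proof.
move=> kJ w0.
rewrite /pprod -(big_mkord xpredT (fun j => 1 + w / b j)) (big_cat_nat (n := k))//=.
rewrite big_mkord ler_wpM2l//; first by rewrite (le_trans ler01)// pprod_ge1.
rewrite mulr_sumr expR_sum; apply: ler_prod => j _.
by rewrite expR_ge1Dx addr_ge0// divr_ge0// ltW.
Qed.

Definition sum_invb : R := (b 0%N)^-1 + C / b 1%N.

Lemma sum_invb_le J : \sum_(j < J) (b j)^-1 <= sum_invb.
Proof.
have Vb j : 0 <= (b j)^-1 by rewrite invr_ge0 ltW.
case: J => [|J].
  rewrite big_ord0 addr_ge0//; have := b_tail 1 (ltn0Sn 0).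
  by rewrite big_geq// mulr1.
rewrite -(big_mkord xpredT (fun j => (b j)^-1)) (big_cat_nat (n := 1%N))//=.
rewrite big_nat1 lerD2l (le_trans (b_tail _ _))// mulr1//.
Qed.

Lemma pprod_le_exp J w : 0 <= w -> pprod J w <= expR (w * sum_invb).
Proof.
move=> w0; apply: (le_trans (pprod_cat (leq0n J) w0)).
rewrite /pprod big_ord0 mul1r ler_expR ler_wpM2l// big_mkord; exact: sum_invb_le.
Qed.

Definition pinf (w : R) : R := limn (pprod^~ w).

Lemma pprod_cvg w : 0 <= w -> pprod J w @[J --> \oo] --> pinf w.
Proof.
move=> w0; apply: nondecreasing_is_cvgn; first exact: pprod_nd.
exists (expR (w * sum_invb)) => _ [J _ <-]; exact: pprod_le_exp.
Qed.

Lemma pprod_le_pinf J w : 0 <= w -> pprod J w <= pinf w.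
Proof.
move=> w0; apply: nondecreasing_cvgn_le; first exact: pprod_nd.
by apply/cvg_ex; eexists; exact: pprod_cvg.
Qed.

Lemma pinf_ge1 w : 0 <= w -> 1 <= pinf w.
Proof. by move=> w0; rewrite (le_trans (pprod_ge1 0 w0))// pprod_le_pinf. Qed.

Lemma pinf_gt0 w : 0 <= w -> 0 < pinf w.
Proof. by move=> /pinf_ge1; exact: lt_le_trans. Qed.

(** A coefficient is bounded by the value of the product divided by [w^k]; the best
    point is [w = b k].  There the first [k] factors are at most [2 b_k / b_j], and
    the tail contributes at most [exp (C k)] by the hypothesis on the tails. *)
Lemma ppoly_coef_le J k :
  (ppoly J)`_k <= (2 * expR C) ^+ k / \prod_(j < k) b j.
Proof.
have p0 : 0 < \prod_(j < k) b j by apply: prodr_gt0.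
case: (posnP k) => [->|k0].
  rewrite big_ord0 expr0 divr1.
  elim: J => [|J IH]; first by rewrite /ppoly big_ord0 coef1.
  by rewrite ppolyS addr0.
pose J' := maxn J k.
apply: (@le_trans _ _ (ppoly J')`_k); first by apply: ppoly_coef_nd; exact: leq_maxl.
have w0 : 0 <= b k by exact: ltW.
have wk : 0 < b k ^+ k by rewrite exprn_gt0.
have H1 : (ppoly J')`_k * b k ^+ k <= pprod J' (b k).
  rewrite pprodE (bigD1 (inord k))//= inordK ?ltnS ?leq_maxr// lerDl.
  by apply: sumr_ge0 => i _; rewrite mulr_ge0 ?ppoly_coef_ge0 ?exprn_ge0.
have H2 : pprod J' (b k) <= pprod k (b k) * expR (C * k%:R).
  apply: (le_trans (pprod_cat (leq_maxr J k) w0)).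
  rewrite ler_wpM2l//; first by rewrite (le_trans ler01)// pprod_ge1.
  rewrite ler_expR (le_trans (ler_wpM2l w0 (b_tail _ k0)))// mulrC divfK// gt_eqF//.
have H3 : pprod k (b k) <= 2 ^+ k * b k ^+ k / \prod_(j < k) b j.
  rewrite /pprod -exprMn -[X in _ ^+ X]card_ord -prodr_const -prodf_div.
  apply: ler_prod => j _; apply/andP; split; first by rewrite addr_ge0// divr_ge0// ltW.
  rewrite ler_pdivlMr// mulrDl mul1r divfK ?gt_eqF// mulr_natl mulr2n lerD2r.
  exact/b_nd/ltnW.
rewrite -(ler_pM2r wk) (le_trans H1)// (le_trans H2)//.
rewrite (le_trans (ler_wpM2r (expR_ge0 _) H3))// mulrC expRM_natr exprMn.
by apply: eq_ler; ring.
Qed.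

Definition pcoef k : R := limn (fun J => (ppoly J)`_k).

Lemma ppoly_coef_cvg k : (ppoly J)`_k @[J --> \oo] --> pcoef k.
Proof.
apply: nondecreasing_is_cvgn; first exact: ppoly_coef_nd.
exists ((2 * expR C) ^+ k / \prod_(j < k) b j) => _ [J _ <-]; exact: ppoly_coef_le.
Qed.

Lemma ppoly_coef_le_lim J k : (ppoly J)`_k <= pcoef k.
Proof.
apply: (@nondecreasing_cvgn_le _ (fun J => (ppoly J)`_k)); first exact: ppoly_coef_nd.
by apply/cvg_ex; eexists; exact: ppoly_coef_cvg.
Qed.

Lemma pcoef_ge0 k : 0 <= pcoef k.
Proof. exact: le_trans (ppoly_coef_ge0 0 k) (ppoly_coef_le_lim 0 k). Qed.

Lemma pcoef_le k : pcoef k <= (2 * expR C) ^+ k / \prod_(j < k) b j.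
Proof.
apply: limr_le; first by apply/cvg_ex; eexists; exact: ppoly_coef_cvg.
by apply: nearW => J; exact: ppoly_coef_le.
Qed.

Lemma pcoef_sum_le K w : 0 <= w -> \sum_(k < K) pcoef k * w ^+ k <= pinf w.
Proof.
move=> w0.
have H : \sum_(k < K) (ppoly J)`_k * w ^+ k @[J --> \oo] --> \sum_(k < K) pcoef k * w ^+ k.
  apply: (cvg_sum_ord (u := fun k J => (ppoly J)`_k * w ^+ k)
    (l := fun k => pcoef k * w ^+ k)) => k; apply: cvgM; [exact: ppoly_coef_cvg|exact: cvg_cst].
apply: (cvgr_to_le H).
near=> J; apply: le_trans (pprod_le_pinf J w0); rewrite pprodE.
have KJ : (K <= J.+1)%N by apply: ltnW; rewrite ltnS; near: J; exact: nbhs_infty_ge.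
rewrite -!(big_mkord xpredT (fun k => (ppoly J)`_k * w ^+ k)).
rewrite [leRHS](big_cat_nat (n := K))//= lerDl sumr_ge0// => i _.
by rewrite mulr_ge0 ?ppoly_coef_ge0 ?exprn_ge0.
Unshelve. all: by end_near. Qed.

(** The partial sums lie between the partial products and the infinite product. *)
Lemma pcoef_sum_cvg w : 0 <= w ->
  \sum_(k < K) pcoef k * w ^+ k @[K --> \oo] --> pinf w.
Proof.
move=> w0; rewrite -cvg_shiftS.
apply: (@squeeze_cvgr _ _ _ _ (pprod^~ w) (fun=> pinf w)).
- apply: nearW => K; rewrite pcoef_sum_le// andbT pprodE.
  by apply: ler_sum => k _; rewrite ler_wpM2r ?exprn_ge0// ppoly_coef_le_lim.
- exact: pprod_cvg.
- exact: cvg_cst.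
Qed.

Variable r : nat.
Hypothesis r_gt0 : (0 < r)%N.

(** Coefficients in [xi], where [w = xi^r]. *)
Definition dcoef m : R := if (r %| m)%N then pcoef (m %/ r) else 0.

Lemma dcoef_ge0 m : 0 <= dcoef m.
Proof. by rewrite /dcoef; case: ifP => // _; exact: pcoef_ge0. Qed.

Lemma dcoef0 : dcoef 0 = 1.
Proof.
rewrite /dcoef dvdn0 div0n /pcoef (_ : (fun J => _) = fun=> 1); first exact: lim_cst.
apply/funext; elim=> [|J IH]; first by rewrite /ppoly big_ord0 coef1.
by rewrite ppolyS addr0.
Qed.

(** [(K + r - 1) / r] is the number of multiples of [r] below [K]. *)
Lemma dcoef_sum K x : \sum_(m < K) dcoef m * x ^+ m =
  \sum_(k < (K + r.-1) %/ r) pcoef k * (x ^+ r) ^+ k.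
Proof.
elim: K => [|K IH].
  by rewrite divn_small ?big_ord0// add0n prednK.
rewrite big_ord_recr/= IH /dcoef; case: ifPn => [/dvdnP[k ->]|nd].
  have e : ((k * r + r.-1) %/ r = k)%N.
    by rewrite divnMDl// divn_small ?addn0// prednK.
  have e' : (((k * r).+1 + r.-1) %/ r = k.+1)%N.
    by rewrite addSnnS prednK// -mulSnr mulnK.
  by rewrite e e' mulnK// big_ord_recr/= -exprM mulnC.
rewrite mul0r addr0; suff -> : ((K.+1 + r.-1) %/ r = (K + r.-1) %/ r)%N by [].
have rK : (0 < K %% r)%N by rewrite lt0n.
have Kr : (K %% r < r)%N by rewrite ltn_mod.
have e t : (0 < t <= r)%N -> ((K %/ r * r + t + r.-1) %/ r = K %/ r + 1)%N.
  move=> tr; have -> : (K %/ r * r + t + r.-1 = (K %/ r + 1) * r + t.-1)%N by lia.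
  by rewrite divnMDl// (@divn_small t.-1) ?addn0//; lia.
have := e (K %% r).+1 Kr; rewrite addnS -divn_eq => ->.
by have := e (K %% r)%N; rewrite -divn_eq => ->//; rewrite rK ltnW.
Qed.

End InfiniteProduct.

(** * The reciprocal of the product and the decay of its transform *)

Lemma ler_pow {R : realDomainType} (x y : R) n : 0 <= x -> x <= y -> x ^+ n <= y ^+ n.
Proof.
by move=> x0 xy; apply: lerXn2r => //; rewrite nnegrE// (le_trans x0).
Qed.

Section PowerInequalities.
Context {R : realType}.
Variables (r : nat) (s : R).
Hypothesis r_gt0 : (0 < r)%N.
Hypothesis s_gt0 : 0 < s.

(** For [u >= 4 r s] the shift by [s] multiplies [u^r] by at most
    [exp (1/4) <= 4/3], so that [2 u^r - (u + s)^r >= (2/3) u^r]. *)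
Lemma pow_shift_large u : 4 * r%:R * s <= u ->
  ((u + s) / 4) ^+ r <= 2 * u ^+ r - (u + s) ^+ r.
Proof.
move=> su.
have r0 : 0 < r%:R :> R by rewrite ltr0n.
have r1 : 1 <= r%:R :> R by rewrite ler1n.
have u0 : 0 < u by apply: lt_le_trans su; rewrite !mulr_gt0.
have su' : s <= u by apply: le_trans su; rewrite -[leLHS]mul1r ler_wpM2r ?(ltW s_gt0)//; lra.
have H1 : (u + s) ^+ r <= 4 / 3 * u ^+ r.
  have h : u + s <= expR (4 * r%:R)^-1 * u.
    apply: (@le_trans _ _ ((1 + (4 * r%:R)^-1) * u)); last first.
      by rewrite ler_wpM2r ?(ltW u0)// expR_ge1Dx.
    rewrite mulrDl mul1r lerD2l mulrC ler_pdivlMr ?mulr_gt0//.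
    by rewrite mulrC.
  apply: (@le_trans _ _ ((expR (4 * r%:R)^-1 * u) ^+ r)).
    by apply: ler_pow => //; rewrite addr_ge0// ltW.
  rewrite exprMn -expRM_natl ler_wpM2r ?exprn_ge0 ?(ltW u0)//.
  have -> : r%:R / (4 * r%:R) = 4^-1 :> R by field; rewrite gt_eqF.
  have := expR_ge1Dx (- (4^-1) : R); rewrite expRN => h2.
  rewrite -[leLHS]invrK -[leRHS]invrK lef_pV2 ?posrE ?invr_gt0 ?expR_gt0//.
  by apply: le_trans h2; rewrite invf_div; lra.
have H2 : ((u + s) / 4) ^+ r <= u ^+ r / 2.
  apply: (@le_trans _ _ ((u / 2) ^+ r)).
    by apply: ler_pow; [rewrite divr_ge0// addr_ge0// ltW|lra].
  rewrite expr_div_n ler_pM2l ?exprn_gt0// lef_pV2 ?posrE ?exprn_gt0//.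
  by case: r r_gt0 => // n _; rewrite exprS ler_peMr// exprn_ege1// ler1n.
have := exprn_ge0 r (ltW u0); lra.
Qed.

Lemma pow_shift_small u : 0 <= u -> u <= 4 * r%:R * s ->
  - ((4 * r%:R + 1) * s) ^+ r <= 2 * u ^+ r - (u + s) ^+ r.
Proof.
move=> u0 us.
have : (u + s) ^+ r <= ((4 * r%:R + 1) * s) ^+ r.
  by apply: ler_pow; [rewrite addr_ge0// ltW|rewrite mulrDl mul1r lerD2r].
have := exprn_ge0 r u0; lra.
Qed.

End PowerInequalities.

Section Kernel.
Context {R : realType}.
Local Notation mu := (@lebesgue_measure R).
Variables (N : nat -> R) (C s : R) (r : nat).
Hypothesis r_gt0 : (0 < r)%N.
Hypothesis r_even : ~~ odd r.
Hypothesis s_ge4 : 4 <= s.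

(** The largest value of [|x| + s] in the region [|x| <= 4 r s]. *)
Definition Nmin : R := (4 * r%:R + 1) * s.
Definition Npow j := N j ^+ r.

Hypothesis N_ge : forall j, 2 * Nmin <= N j.
Hypothesis N_nd : forall i j, (i <= j)%N -> N i <= N j.
Hypothesis N_tail : forall k J, (0 < k)%N ->
  \sum_(k <= j < J) (Npow j)^-1 <= C * k%:R / Npow k.

Let s_gt0 : 0 < s. Proof. by apply: lt_le_trans s_ge4. Qed.
Let s_ge0 : 0 <= s. Proof. exact: ltW. Qed.

Lemma Nmin_gt0 : 0 < Nmin.
Proof. by rewrite /Nmin mulr_gt0// ltr_wpDl// mulr_ge0. Qed.

Lemma Nmin_ge1 : 1 <= Nmin.
Proof.
rewrite /Nmin -[leLHS]mulr1 ler_pM//; first by rewrite lerDr mulr_ge0.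
by apply: le_trans s_ge4; rewrite ler1n.
Qed.

Let N_ge1 j : 1 <= N j.
Proof. by apply: le_trans (N_ge j); have := Nmin_ge1; lra. Qed.

Let N_gt0 j : 0 < N j. Proof. exact: lt_le_trans (N_ge1 j). Qed.

Let Npow_gt0 j : 0 < Npow j. Proof. by rewrite exprn_gt0. Qed.

Let Npow_nd i j : (i <= j)%N -> Npow i <= Npow j.
Proof. by move=> ij; apply: ler_pow; [exact: ltW|exact: N_nd]. Qed.

Lemma Npow_ge j : 2 * Nmin ^+ r <= Npow j.
Proof.
apply: (@le_trans _ _ ((2 * Nmin) ^+ r)).
  rewrite [leRHS]exprMn; apply: ler_wpM2r; first by rewrite exprn_ge0// ltW// Nmin_gt0.
  by case: r r_gt0 => // n _; rewrite exprS ler_peMr// exprn_ege1// ler1n.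
by apply: ler_pow => //; rewrite mulr_ge0// ltW// Nmin_gt0.
Qed.

Let absX x : `|x| ^+ r = x ^+ r :> R.
Proof. by rewrite -normrX ger0_norm// exprn_even_ge0. Qed.

Let xr_ge0 (x : R) : 0 <= x ^+ r. Proof. exact: exprn_even_ge0. Qed.

(** With [u = |x|], the constant term of [1 + x^r / N^r] minus the norm of its terms
    of positive order is [1 + (2 u^r - (u + s)^r) / N^r]: this is what
    [jbound_inv] asks to be positive. *)
Definition shiftpow (x : R) := 2 * x ^+ r - (`|x| + s) ^+ r.
Definition factor_bound j (x : R) := (1 + shiftpow x / Npow j)^-1.

(** Far from the origin every factor is at most 1, and at most [N_j / y] with
    [y = (|x| + s) / 4]: trivially if [y <= N_j], and because [(y / N_j)^r] is at
    least [y / N_j] otherwise. *)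
Lemma factor_bound_large j x : 4 * r%:R * s <= `|x| ->
  0 < 1 + shiftpow x / Npow j /\ factor_bound j x <= 1 /\ factor_bound j x <= N j / ((`|x| + s) / 4).
Proof.
move=> xs; set y := (`|x| + s) / 4.
have xs0 : 0 < `|x| + s by rewrite ltr_wpDl.
have y0 : 0 < y by rewrite divr_gt0.
have H := pow_shift_large r_gt0 s_gt0 xs.
rewrite absX -/(shiftpow x) -/y in H.
have H0 : 0 <= shiftpow x / Npow j by rewrite divr_ge0 ?(ltW (Npow_gt0 _))// (le_trans _ H)// exprn_ge0// ltW.
have P : 0 < 1 + shiftpow x / Npow j by rewrite ltr_pwDl.
split=> //; split; first by rewrite /factor_bound invf_le1// lerDl.
rewrite /factor_bound -[N j / y]invrK invf_div lef_pV2 ?posrE// ?divr_gt0//.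
have [yN|Ny] := leP y (N j).
  by apply: (@le_trans _ _ 1); [rewrite ler_pdivrMr// mul1r|rewrite lerDl].
apply: (@le_trans _ _ (shiftpow x / Npow j)); last by rewrite lerDr.
apply: (@le_trans _ _ ((y / N j) ^+ r)); last first.
  by rewrite expr_div_n -/(Npow j); apply: ler_wpM2r => //; rewrite invr_ge0 ltW.
case: r r_gt0 => // n _; rewrite exprS ler_peMr//; first by rewrite divr_ge0// ltW.
by rewrite exprn_ege1// ler_pdivlMr// mul1r ltW.
Qed.

(** Near the origin the factor may exceed 1, but by little enough for the product of
    all factors to stay bounded. *)
Lemma factor_bound_small j x : `|x| <= 4 * r%:R * s ->
  0 < 1 + shiftpow x / Npow j /\ factor_bound j x <= expR (2 * Nmin ^+ r / Npow j).
Proof.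
move=> xs.
have H := pow_shift_small s_gt0 (normr_ge0 x) xs.
rewrite absX -/(shiftpow x) -/Nmin in H.
set t := Nmin ^+ r / Npow j.
have t0 : 0 <= t.
  by apply: divr_ge0; [apply: exprn_ge0; exact/ltW/Nmin_gt0|exact: ltW].
have t1 : t <= 1 / 2.
  by rewrite /t ler_pdivrMr// mulrC mulrA mulr1 ler_pdivlMr// mulrC Npow_ge.
have K : 1 - t <= 1 + shiftpow x / Npow j.
  by rewrite lerD2l /t -mulNr ler_wpM2r// invr_ge0 ltW.
have P : 0 < 1 + shiftpow x / Npow j by apply: lt_le_trans K; lra.
split=> //; rewrite /factor_bound -mulrA -/t.
apply: (@le_trans _ _ (1 - t)^-1); first by rewrite lef_pV2 ?posrE//; lra.
apply: (@le_trans _ _ (1 + 2 * t)); last exact: expR_ge1Dx.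
rewrite -div1r ler_pdivrMr; last lra.
by nra.
Qed.

Lemma shiftpow_gt0 j x : 0 < 1 + shiftpow x / Npow j.
Proof.
have [/factor_bound_large|/ltW/factor_bound_small] := leP (4 * r%:R * s) `|x|; first by move=> /(_ j)[].
by move=> /(_ j)[].
Qed.

Lemma factor_bound_gt0 j x : 0 < factor_bound j x. Proof. by rewrite invr_gt0 shiftpow_gt0. Qed.

Lemma jbound_factor j : jbound s (fun x => (1 + x ^+ r / Npow j)^-1) (factor_bound j).
Proof.
have [a [ja a0 aB]] := jboundXn r s_ge0.
pose a' p (x : R) := (p == 0%N)%:R + a p x / Npow j.
have ja' : tjet a'.
  move=> p x; have H := ja p x; rewrite /a'.
  by apply: is_derive_eq; rewrite ?addr0 ?add0r /GRing.scale/= ?mulr0 ?add0r ?addr0; ring.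
pose W (x : R) := ((`|x| + s) ^+ r - x ^+ r) / Npow j.
have a'0 x : a' 0%N x = 1 + x ^+ r / Npow j by rewrite /a' a0.
have a'W x : a' 0%N x - W x = 1 + shiftpow x / Npow j.
  by rewrite a'0 /W /shiftpow; ring.
have W0 x : 0 <= W x.
  rewrite divr_ge0 ?(ltW (Npow_gt0 _))// subr_ge0 -absX; apply: ler_pow => //.
  by rewrite lerDl.
have := @jbound_inv _ s a' W s_ge0 ja' _ W0 _.
under eq_fun do rewrite a'0; under [X in jbound _ _ X]eq_fun do rewrite a'W.
apply.
- by move=> x; rewrite -subr_gt0 a'W shiftpow_gt0.
- move=> m x; rewrite /a'; under eq_bigr do rewrite add0r normrM mulrAC.
  rewrite -mulr_suml gtr0_norm ?invr_gt0// /W ler_wpM2r ?invr_ge0 ?(ltW (Npow_gt0 _))//.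
  have := aB m.+1 x; rewrite big_ord_recl/= expr0 mulr1 a0 ger0_norm//.
  by rewrite lerBrDl; under eq_bigr do rewrite /bump/= add1n.
Qed.

(** The bounds are proved for finite products and survive the limit. *)
Definition gpart J (x : R) := (pprod Npow J (x ^+ r))^-1.
Definition glim (x : R) := (pinf Npow (x ^+ r))^-1.

Lemma jbound_gpart J : jbound s (gpart J) (fun x => \prod_(j < J) factor_bound j x).
Proof.
elim: J => [|J IH].
  rewrite (_ : gpart 0 = fun=> 1); last by apply/funext => x; rewrite /gpart /pprod big_ord0 invr1.
  by under [X in jbound _ _ X]eq_fun do rewrite big_ord0; exact: jbound1.
rewrite (_ : gpart J.+1 = fun x => gpart J x * (1 + x ^+ r / Npow J)^-1); last first.
  by apply/funext => x; rewrite /gpart /pprod big_ord_recr/= invfM.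
under [X in jbound _ _ X]eq_fun do rewrite big_ord_recr/=.
exact: jboundM s_ge0 IH (jbound_factor J).
Qed.

Definition Kconst : R := 17 +
  expR (2 * Nmin ^+ r * sum_invb Npow C) * (1 + (4 * r%:R * s) ^+ 2).

Lemma Kconst_ge0 : 0 <= Kconst.
Proof. by rewrite addr_ge0// mulr_ge0 ?expR_ge0// addr_ge0// sqr_ge0. Qed.

Definition Kbound k : R := Kconst * (4 ^+ k * \prod_(j < k.+2) N j).

Let prodN_ge1 k : 1 <= \prod_(j < k) N j.
Proof.
apply: (@le_trans _ _ (\prod_(j < k) 1)); first by rewrite big1.
by apply: ler_prod => j _; rewrite ler01/=.
Qed.

(** Far from the origin, [k + 2] factors [N_j / y] absorb [(|x| + s)^k] and
    leave an integrable [y^-2]; near the origin every [N_j] exceeds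
    [|x| + s]. *)
Lemma prodV_bound k J x : (k.+2 <= J)%N ->
  (`|x| + s) ^+ k * \prod_(j < J) factor_bound j x <= Kbound k * wgt x.
Proof.
move=> kJ; rewrite /wgt ler_pdivlMr ?ltr_pwDl ?sqr_ge0//.
have V0 j : 0 <= factor_bound j x by rewrite ltW ?factor_bound_gt0.
rewrite /Kbound -(real_normK (num_real x)).
have [xs|/ltW xs] := leP (4 * r%:R * s) `|x|.
- set y := (`|x| + s) / 4.
  have y1 : 1 <= y by rewrite ler_pdivlMr// mul1r (le_trans s_ge4)// lerDr.
  have y0 : 0 < y by exact: lt_le_trans y1.
  have -> : `|x| + s = 4 * y by rewrite /y; field.
  have H : \prod_(j < J) factor_bound j x <= \prod_(j < k.+2) N j / y ^+ k.+2.
    rewrite -(big_mkord xpredT (fun j => factor_bound j x)) (big_cat_nat (n := k.+2))//=.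
    rewrite -[leRHS]mulr1; apply: ler_pM; rewrite ?prodr_ge0//.
      rewrite big_mkord -[in y ^+ k.+2](card_ord k.+2) -prodr_const -prodf_div.
      apply: ler_prod => j _; rewrite V0/=.
      by have [_ [_]] := factor_bound_large j xs.
    apply: (@le_trans _ _ (\prod_(k.+2 <= j < J) 1)); last by rewrite big1.
    by apply: ler_prod => j _; rewrite V0/=; have [_ []] := factor_bound_large j xs.
  set P := \prod_(j < k.+2) N j in H *.
  have P0 : 0 <= P by rewrite /P (le_trans _ (prodN_ge1 _)).
  have x2 : 1 + `|x| ^+ 2 <= 17 * y ^+ 2.
    have xy : `|x| <= 4 * y by rewrite /y mulrC divfK// lerDl.
    have := normr_ge0 x; set u := `|x| in xy *; move=> u0; nra.
  apply: (@le_trans _ _ ((4 * y) ^+ k * (P / y ^+ k.+2) * (17 * y ^+ 2))).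
    apply: ler_pM; last exact: x2.
    + by rewrite mulr_ge0 ?prodr_ge0// exprn_ge0// mulr_ge0// ltW.
    + by rewrite addr_ge0// sqr_ge0.
    + by rewrite ler_wpM2l// exprn_ge0// mulr_ge0// ltW.
  have -> : (4 * y) ^+ k * (P / y ^+ k.+2) * (17 * y ^+ 2) = 17 * (4 ^+ k * P).
    have -> : y ^+ k.+2 = y ^+ k * y ^+ 2 by rewrite -exprD addn2.
    by rewrite exprMn; field; rewrite !gt_eqF ?exprn_gt0.
  rewrite ler_wpM2r ?mulr_ge0 ?exprn_ge0// lerDl.
  by rewrite mulr_ge0 ?expR_ge0// addr_ge0// sqr_ge0.
- have H : \prod_(j < J) factor_bound j x <= expR (2 * Nmin ^+ r * sum_invb Npow C).
    apply: (@le_trans _ _ (\prod_(j < J) expR (2 * Nmin ^+ r / Npow j))).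
      by apply: ler_prod => j _; rewrite V0/=; have [_] := factor_bound_small j xs.
    rewrite -expR_sum -mulr_sumr ler_expR ler_wpM2l ?mulr_ge0 ?exprn_ge0 ?(ltW Nmin_gt0)//.
    exact: (sum_invb_le Npow_gt0 N_tail).
  set E := expR _ in H *.
  have E0 : 0 <= E by exact: expR_ge0.
  have H2 : (`|x| + s) ^+ k <= \prod_(j < k.+2) N j.
    apply: (@le_trans _ _ (\prod_(j < k) N j)).
      rewrite -[in _ ^+ k](card_ord k) -prodr_const; apply: ler_prod => j _.
      rewrite addr_ge0//= (le_trans _ (N_ge j))//.
      apply: (@le_trans _ _ Nmin); last by have := Nmin_gt0; lra.
      by rewrite /Nmin mulrDl mul1r lerD2r.
    by rewrite 2!big_ord_recr/= -mulrA ler_peMr ?(le_trans ler01 (prodN_ge1 _))// mulr_ege1.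
  set P := \prod_(j < k.+2) N j in H2 *.
  have P0 : 0 <= P by rewrite /P (le_trans _ (prodN_ge1 _)).
  apply: (@le_trans _ _ (P * E * (1 + (4 * r%:R * s) ^+ 2))).
    apply: ler_pM.
    + by rewrite mulr_ge0 ?prodr_ge0// exprn_ge0// addr_ge0.
    + by rewrite addr_ge0// sqr_ge0.
    + by apply: ler_pM; rewrite ?prodr_ge0// exprn_ge0// addr_ge0.
    + by rewrite lerD2l; apply: ler_pow.
  rewrite /Kconst -/E.
  have -> : P * E * (1 + (4 * r%:R * s) ^+ 2) = E * (1 + (4 * r%:R * s) ^+ 2) * (1 * P) by ring.
  apply: ler_pM.
  + by rewrite mulr_ge0// addr_ge0// sqr_ge0.
  + by rewrite mul1r.
  + by rewrite lerDr.
  + by rewrite ler_wpM2r// exprn_ege1// ler1n.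
Qed.

(** The norm of [x^k gpart J x] is at most the product of the norms of its factors;
    each Taylor coefficient is one term of that norm. *)
Lemma gpart_jets k J : (k.+2 <= J)%N -> exists a, [/\ tjet a,
  forall x, a 0%N x = x ^+ k * gpart J x &
  forall p x, `|a p x| * s ^+ p <= Kbound k * wgt x].
Proof.
move=> kJ.
have [a [ja a0 aB]] := jboundM s_ge0 (jboundXn k s_ge0) (jbound_gpart J).
exists a; split => // p x; apply: le_trans (prodV_bound x kJ).
apply: le_trans (aB p.+1 x); rewrite big_ord_recr/= lerDr sumr_ge0// => i _.
by rewrite mulr_ge0// exprn_ge0.
Qed.

Lemma gpart_le k J x : (k.+2 <= J)%N -> `|x ^+ k * gpart J x| <= Kbound k * wgt x.
Proof.
by move=> kJ; have [a [_ a0 /(_ 0%N x)]] := gpart_jets kJ; rewrite a0 expr0 mulr1.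
Qed.

Lemma gpart_cvg x : gpart J x @[J --> \oo] --> glim x.
Proof.
apply: cvgV; last exact: (pprod_cvg Npow_gt0 N_tail).
by rewrite gt_eqF// (pinf_gt0 Npow_gt0 N_tail).
Qed.

Lemma glim_ge0 x : 0 <= glim x.
Proof. by rewrite invr_ge0 ltW// (pinf_gt0 Npow_gt0 N_tail). Qed.

Lemma glim_le k x : `|x ^+ k * glim x| <= Kbound k * wgt x.
Proof.
have H : `|x ^+ k * gpart J x| @[J --> \oo] --> `|x ^+ k * glim x|.
  by apply: cvg_norm; apply: cvgM; [exact: cvg_cst|exact: gpart_cvg].
apply: (cvgr_to_le H).
by near=> J; apply: gpart_le; near: J; exact: nbhs_infty_ge.
Unshelve. all: by end_near. Qed.

(** A pointwise limit of uniformly Lipschitz functions; the Lipschitz constant is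
    the bound on the first Taylor coefficient. *)
Lemma continuous_glim : continuous glim.
Proof.
pose L := Kbound 0 / s.
have L0 : 0 <= L.
  rewrite divr_ge0 // mulr_ge0 ?Kconst_ge0// mulr_ge0 ?exprn_ge0//.
  by rewrite (le_trans _ (prodN_ge1 _)).
have lipg x y : `|glim x - glim y| <= L * `|x - y|.
  have H : `|gpart J x - gpart J y| @[J --> \oo] --> `|glim x - glim y|.
    by apply: cvg_norm; apply: cvgB; exact: gpart_cvg.
  apply: (cvgr_to_le H).
  near=> J.
  have J2 : (2 <= J)%N by near: J; exact: nbhs_infty_ge.
  have [a [ja a0 aB]] := gpart_jets J2.
  have e z : gpart J z = a 0%N z by rewrite a0 expr0 mul1r.
  rewrite !e; apply: (lipschitz_mvt (ja 0%N)) => z.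
  rewrite mul1r /L ler_pdivlMr//.
  have := aB 1%N z; rewrite expr1 => /le_trans; apply.
  by rewrite ler_piMr ?wgt_le1// mulr_ge0 ?Kconst_ge0// mulr_ge0 ?exprn_ge0// (le_trans _ (prodN_ge1 _)).
move=> x; apply/cvgrPdist_le => e e0.
near=> y; apply: (le_trans (lipg x y)).
apply: (@le_trans _ _ (L * (e / (L + 1)))).
  rewrite ler_wpM2l//; near: y; apply: cvgr_dist_le; first exact: cvg_id.
  by rewrite divr_gt0// ltr_wpDl.
by rewrite mulrCA ler_piMr ?(ltW e0)// ler_pdivrMr ?ltr_wpDl// mul1r lerDl.
Unshelve. all: by end_near. Qed.

Lemma decay_glim k : decay (fun x => x ^+ k * glim x).
Proof.
split; last by exists (Kbound k) => x; exact: glim_le.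
by move=> x; apply: cvgM; [exact: exprn_continuous|exact: continuous_glim].
Qed.

Lemma costr_glim_decay k a kappa x : 0 <= kappa -> kappa <= s / 2 ->
  `|costr a (fun y => y ^+ k * glim y) x| <=
  2 * Kbound k * wgt_mass * expR (- (kappa * `|x|)).
Proof.
move=> k0 ks.
pose f J y := cos (x * y + a) * (y ^+ k * gpart (J + k.+2)%N y).
have cg J : continuous (fun y : R => y ^+ k * gpart (J + k.+2)%N y).
  have [b [jb b0 _]] := gpart_jets (leq_addl J k.+2).
  by rewrite (_ : (fun y => _) = b 0%N); [exact: tjet_continuous|apply/funext => y; rewrite b0].
have H : \int[mu]_y f J y @[J --> \oo] --> costr a (fun y => y ^+ k * glim y) x.
  apply: (@dominated_Rintegral_cvg _ _ _ mu _ _ (fun y => Kbound k * wgt y)).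
  - move=> J; apply: continuous_measurable_fun => y.
    by apply: cvgM; [exact: continuous_cosaff|exact: cg].
  - exact: integrable_wgtZ.
  - move=> J y; rewrite normrM (le_trans _ (gpart_le y (leq_addl J k.+2)))//.
    by rewrite ler_piMl// cos_max.
  - move=> y; apply: cvgM; first exact: cvg_cst.
    apply: cvgM; first exact: cvg_cst.
    by have := gpart_cvg (x := y); rewrite -(cvg_shiftn k.+2).
have {}H : `|\int[mu]_y f J y| @[J --> \oo] --> `|costr a (fun y => y ^+ k * glim y) x|.
  exact: cvg_norm.
apply: (cvgr_to_le H).
apply: nearW => J.
have [b [jb b0 bB]] := gpart_jets (leq_addl J k.+2).
have := @costr_exp_decay _ b s (Kbound k) s_gt0 jb bB kappa a x k0 ks.
have -> // : \int[mu]_y f J y = costr a (b 0%N) x.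
by apply: eq_Rintegral => y _; rewrite b0.
Qed.

Lemma dcoef_sum_le1 K x : \sum_(m < K) dcoef Npow r m * x ^+ m * glim x <= 1.
Proof.
rewrite -mulr_suml dcoef_sum// ler_pdivrMr; last first.
  by rewrite (pinf_gt0 Npow_gt0 N_tail).
rewrite mul1r; exact: (pcoef_sum_le Npow_gt0 Npow_nd N_tail).
Qed.

Lemma dcoef_sum_cvg1 x :
  \sum_(m < K) dcoef Npow r m * x ^+ m * glim x @[K --> \oo] --> (1:R).
Proof.
have E K : \sum_(m < K) dcoef Npow r m * x ^+ m * glim x =
  (\sum_(k < (K + r.-1) %/ r) pcoef Npow k * (x ^+ r) ^+ k) * glim x.
  by rewrite -mulr_suml dcoef_sum.
rewrite (eq_cvg _ _ E).
have P1 : pinf Npow (x ^+ r) != 0.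
  by rewrite gt_eqF// (pinf_gt0 Npow_gt0 N_tail).
have <- : pinf Npow (x ^+ r) * glim x = 1 by rewrite /glim divff.
apply: cvgM; last exact: cvg_cst.
apply: (@cvg_comp _ _ _ (fun K => (K + r.-1) %/ r)%N
   (fun K => \sum_(k < K) pcoef Npow k * (x ^+ r) ^+ k) _ \oo); last first.
  exact: (pcoef_sum_cvg Npow_gt0 Npow_nd N_tail).
move=> A [n _ nA]; exists (n * r)%N => // K /= nK; apply: nA => /=.
by rewrite leq_divRL// (leq_trans nK)// leq_addr.
Qed.

End Kernel.

(** * Weight sequences *)

Section ProductComparison.
Context {R : realType}.

(** The finitely many factors that may be below [Y] form the constant. *)
Lemma prod_ge_geometric (a : nat -> R) Y J0 : 0 < Y -> (forall j, 0 < a j) ->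
  (forall j, (J0 <= j)%N -> Y <= a j) ->
  exists2 c, 0 < c & forall k, c * Y ^+ k <= \prod_(j < k) a j.
Proof.
move=> Y0 a0 aY.
pose t j := Num.min 1 (a j / Y).
have t0 j : 0 < t j by rewrite lt_min ltr01 divr_gt0.
have tY j : t j * Y <= a j by rewrite -ler_pdivlMr// ge_min lexx orbT.
have t1 j : t j <= 1 by rewrite ge_min lexx.
exists (\prod_(j < J0) t j); first exact: prodr_gt0.
move=> k; apply: (@le_trans _ _ ((\prod_(j < k) t j) * Y ^+ k)).
  apply: ler_wpM2r; first by rewrite exprn_ge0// ltW.
  rewrite -!(big_mkord xpredT t).
  have [kJ|/ltnW Jk] := leqP k J0.
    rewrite (big_cat_nat (n := k))//= ler_piMr ?prodr_ge0// => [i _|]; first exact: ltW.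
    apply: (@le_trans _ _ (\prod_(k <= j < J0) 1)); last by rewrite big1.
    by apply: ler_prod => j _; rewrite t1 ltW.
  rewrite [leRHS](big_cat_nat (n := J0))//= ler_peMr ?prodr_ge0// => [i _|]; first exact: ltW.
  rewrite big_nat_cond; apply: (@le_trans _ _ (\prod_(J0 <= j < k | (J0 <= j < k)%N && true) 1)).
    by rewrite big1.
  apply: ler_prod => j /andP[/andP[Jj _] _]; rewrite ler01/= le_min lexx/=.
  by rewrite ler_pdivlMr// mul1r aY.
rewrite -[in Y ^+ k](card_ord k) -prodr_const -big_split/=.
by apply: ler_prod => j _; rewrite tY mulr_ge0// ltW.
Qed.

End ProductComparison.

Section WeightSequences.
Context {R : realType}.
Variable M : nat -> R.
Hypothesis M_gt0 : forall p, 0 < M p.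
Hypothesis M0 : M 0%N = 1.
Hypothesis M_M1 : cond_M1 M.

(** Log-convexity of [M] says that this sequence is nondecreasing. *)
Definition mratio j := M j.+1 / M j.

Lemma mratio_gt0 j : 0 < mratio j. Proof. exact: divr_gt0. Qed.

Lemma mratio_nd i j : (i <= j)%N -> mratio i <= mratio j.
Proof.
move=> ij; rewrite -(subnK ij) addnC; elim: (j - i)%N => [|n IH]; first by rewrite addn0.
apply: (le_trans IH); rewrite addnS /mratio ler_pdivrMr// mulrAC ler_pdivlMr//.
by have := M_M1 (ltn0Sn (i + n)); rewrite expr2 /= [X in _ <= X]mulrC.
Qed.

Lemma prod_mratio k : \prod_(j < k) mratio j = M k.
Proof.
elim: k => [|k IH]; first by rewrite big_ord0 M0.
by rewrite big_ord_recr/= IH /mratio mulrC divfK// gt_eqF.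
Qed.

Lemma M_superM p q : M p * M q <= M (p + q)%N.
Proof.
elim: q => [|q IH]; first by rewrite M0 mulr1 addn0.
have e n : M n.+1 = M n * mratio n by rewrite /mratio mulrC divfK// gt_eqF.
rewrite addnS !e mulrA; apply: ler_pM => //.
- by rewrite mulr_ge0// ltW.
- exact/ltW/mratio_gt0.
- by apply: mratio_nd; exact: leq_addl.
Qed.

Hypothesis M_M5 : cond_M5 M.

(** (M.5) with its exponent [q] replaced by an even integer [r >= q]: the extra
    power [r - q] of the ratios is monotone and can be taken out of the sum. *)
Lemma mratio_tail : exists r c, [/\ (0 < r)%N, ~~ odd r, 0 <= c &
  forall k J, (0 < k)%N ->
    \sum_(k <= j < J) (mratio j ^+ r)^-1 <= c * k%:R / mratio k ^+ r].
Proof.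
have [q [c [q0 c1 tail]]] := M_M5.
have cge0 : 0 <= c by exact: le_trans c1.
pose n := (Num.bound q); pose r := n.*2.
have qn : q < n%:R by have := archi_boundP (ltW q0).
have n0 : (0 < n)%N by rewrite -(ltr_nat R) (lt_trans q0).
have qr : q <= r%:R.
  by apply: (le_trans (ltW qn)); rewrite ler_nat /r -addnn leq_addr.
have r0 : (0 < r)%N by rewrite double_gt0.
have rE : ~~ odd r by rewrite odd_double.
exists r, c; split => //.
move=> k J k0.
pose x j := (mratio j)^-1.
have x0 j : 0 < x j by rewrite invr_gt0 mratio_gt0.
have x0' j : 0 <= x j by exact: ltW.
have xE j : M j `^ q / M j.+1 `^ q = x j `^ q.
  have p0 : M j.+1 `^ q != 0 by rewrite gt_eqF// powR_gt0.
  apply: (mulIf p0); rewrite divfK// -powRM ?(ltW (M_gt0 _))//.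
  by rewrite /x /mratio invf_div divfK// gt_eqF.
have xD j : x j ^+ r = x j `^ q * x j `^ (r%:R - q).
  rewrite -powR_mulrn// -powRD; last by apply/implyP => _; rewrite gt_eqF.
  by rewrite addrC subrK.
have T1 : \sum_(k <= j < J) x j `^ q <= c * k%:R * x k `^ q.
  have := tail k k0; rewrite xE => T.
  rewrite -lee_fin -sumEFin (le_trans _ T)//.
  rewrite [leLHS](_ : _ = (\sum_(k.+1 <= j < J.+1) (M j.-1 `^ q / M j `^ q)%:E)%E).
    by apply: nneseries_lim_ge => j _; rewrite lee_fin divr_ge0 ?powR_ge0.
  by rewrite big_add1; apply: eq_bigr => j _; rewrite -xE.
have -> : \sum_(k <= j < J) (mratio j ^+ r)^-1 = \sum_(k <= j < J) x j ^+ r.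
  by apply: eq_bigr => j _; rewrite /x exprVn.
rewrite -exprVn -/(x k) xD mulrA.
apply: (@le_trans _ _ ((\sum_(k <= j < J) x j `^ q) * x k `^ (r%:R - q))); last first.
  by apply: ler_wpM2r => //; exact: powR_ge0.
rewrite mulr_suml big_nat_cond [leRHS]big_nat_cond.
apply: ler_sum => j /andP[/andP[kj _] _].
rewrite xD ler_wpM2l ?powR_ge0// ge0_ler_powR ?subr_ge0 ?nnegrE//.
by rewrite /x lef_pV2 ?posrE ?mratio_gt0// mratio_nd.
Qed.

(** If the ratio at [j] is less than [B], so are the earlier ones, and the tail
    condition at 1 bounds [(j - 1) B^-r]. *)
Lemma mratio_unbounded B : exists J0, forall j, (J0 <= j)%N -> B <= mratio j.
Proof.
have [r [c [r0 _ cge0 tail]]] := mratio_tail.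
pose D := c / mratio 1 ^+ r * `|B| ^+ r.
pose n := Num.bound D.
have nD : D < n%:R.
  apply: archi_boundP; apply: mulr_ge0; last exact: exprn_ge0.
  by apply: divr_ge0 => //; apply: exprn_ge0; exact/ltW/mratio_gt0.
exists n.+1 => j nj; rewrite leNgt; apply/negP => jB.
have := tail 1%N j isT.
have H1 : (j - 1)%:R / mratio j ^+ r <= \sum_(1 <= i < j) (mratio i ^+ r)^-1.
  rewrite mulrC mulr_natr -sumr_const_nat big_nat_cond [leRHS]big_nat_cond.
  apply: ler_sum => i /andP[/andP[_ ij] _].
  rewrite lef_pV2 ?posrE ?exprn_gt0 ?mratio_gt0//.
  by apply: ler_pow; [exact/ltW/mratio_gt0|exact/mratio_nd/ltnW].
move=> /(le_trans H1); rewrite mulr1 leNgt => /negP; apply.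
have mj := mratio_gt0 j.
rewrite ltr_pdivlMr ?exprn_gt0//.
apply: (@le_lt_trans _ _ D).
  rewrite /D ler_wpM2l ?divr_ge0 ?exprn_ge0 ?(ltW (mratio_gt0 _))//.
  by apply: ler_pow; [exact: ltW|rewrite (le_trans (ltW jB))// ler_norm].
by apply: (lt_le_trans nD); rewrite ler_nat; lia.
Qed.

Variables (c0 H : R).
Hypothesis c0_ge1 : 1 <= c0.
Hypothesis H_ge1 : 1 <= H.
Hypothesis M_M2 : cond_M2 c0 H M.

Lemma M_subM p q : M (p + q)%N <= c0 * H ^+ (p + q) * (M p * M q).
Proof.
have qp : (q < (p + q).+1)%N by rewrite ltnS leq_addl.
apply: (le_trans (M_M2 (p + q))).
rewrite ler_wpM2l ?mulr_ge0 ?exprn_ge0 ?(le_trans ler01)//.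
have := @bigmin_le _ _ _ (M (p + q)%N * M 0%N) (Ordinal qp)
  (fun i : 'I_(p + q).+1 => M (p + q - i)%N * M i).
by rewrite /= addnK.
Qed.

(** (M.2) applied once for each entry. *)
Lemma M_sumn_le l :
  M (sumn l) <= c0 ^+ size l * (H ^+ size l) ^+ sumn l * \prod_(k <- l) M k.
Proof.
have H0 : 0 <= H by apply: le_trans H_ge1.
have c00 : 0 <= c0 by apply: le_trans c0_ge1.
elim: l => [|k l IH]; first by rewrite big_nil M0 !expr0 !mulr1.
rewrite big_cons /=; set n := sumn l in IH *; set P := \prod_(j <- l) M j in IH *.
have P0 : 0 <= P by apply: prodr_ge0 => j _; exact: ltW.
apply: (le_trans (M_subM _ _)).
apply: (@le_trans _ _ (c0 * H ^+ (k + n) * (M k * (c0 ^+ size l * (H ^+ size l) ^+ (k + n) * P)))).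
  rewrite ler_wpM2l ?mulr_ge0 ?exprn_ge0//; apply: ler_wpM2l; first exact: ltW.
  apply: (le_trans IH); rewrite ler_wpM2r// ler_wpM2l ?exprn_ge0//.
  by rewrite ler_weXn2l ?leq_addl// exprn_ege1.
by rewrite !exprS exprMn; apply: eq_ler; ring.
Qed.

Lemma M_powM r k : M (r * k)%N <= c0 ^+ r * (H ^+ (r ^ 2)) ^+ k * M k ^+ r.
Proof.
have := M_sumn_le (nseq r k); rewrite size_nseq sumn_nseq mulnC -!exprM.
by rewrite mulnA mulnn big_nseq iter_mulr_1.
Qed.

End WeightSequences.

(** * The one-dimensional fundamental solution *)

Section OneDimensional.
Context {R : realType}.
Local Notation mu := (@lebesgue_measure R).
Variables (M : nat -> R) (c0 H : R).
Hypothesis M_gt0 : forall p, 0 < M p.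
Hypothesis M0 : M 0%N = 1.
Hypothesis M_M1 : cond_M1 M.
Hypothesis c0_ge1 : 1 <= c0.
Hypothesis H_ge1 : 1 <= H.
Hypothesis M_M2 : cond_M2 c0 H M.
Variables (r : nat) (cT : R).
Hypothesis r_gt0 : (0 < r)%N.
Hypothesis r_even : ~~ odd r.
Hypothesis cT_ge0 : 0 <= cT.
Hypothesis M_tail : forall k J, (0 < k)%N ->
  \sum_(k <= j < J) (mratio M j ^+ r)^-1 <= cT * k%:R / mratio M k ^+ r.
Hypothesis M_unbounded : forall B, exists J0, forall j, (J0 <= j)%N -> B <= mratio M j.
Variables (tau : nat -> R) (kappa : R).
Hypothesis tau_gt0 : forall j, 0 < tau j.
Hypothesis tau_nd : forall i j, (i <= j)%N -> tau i <= tau j.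
Hypothesis kappa_ge0 : 0 <= kappa.

Let c0_ge0 : 0 <= c0. Proof. exact: le_trans c0_ge1. Qed.
Let H_gt0 : 0 < H. Proof. exact: lt_le_trans H_ge1. Qed.
Let mr_gt0 j : 0 < mratio M j. Proof. exact: mratio_gt0. Qed.
Let M_ge0 j : 0 <= M j. Proof. exact: ltW. Qed.

(* Radius of the discs, at least twice the decay rate that is wanted. *)
Let s : R := Num.max 4 (2 * kappa).
Let s_ge4 : 4 <= s. Proof. by rewrite le_max lexx. Qed.
Let s_kappa : kappa <= s / 2.
Proof. by rewrite ler_pdivlMr// mulrC le_max lexx orbT. Qed.

(* In [prodsm_le] the power [K0^k] pays for [4^k] from the bound on the kernel, for
   [4^k] from two factors [j + 1], and for [H^k] from (M.2). *)
Let K0 : R := 16 * H.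
Let K0_gt0 : 0 < K0. Proof. by rewrite mulr_gt0. Qed.

(* The cut-off [j + 1] keeps the two surplus factors of the product over [k + 2]
   indices of polynomial size in [k]. *)
Let sg j := Num.min (tau j) j.+1%:R / K0.
Let sg_gt0 j : 0 < sg j.
Proof. by rewrite divr_gt0// lt_min tau_gt0 ltr0n. Qed.

Let sg_nd i j : (i <= j)%N -> sg i <= sg j.
Proof.
move=> ij; rewrite ler_wpM2r ?invr_ge0 ?(ltW K0_gt0)// le_min !ge_min tau_nd//=.
by rewrite ler_nat ltnS ij orbT.
Qed.

Let sm j := sg j * mratio M j.
Let sm_gt0 j : 0 < sm j. Proof. exact: mulr_gt0. Qed.

Let sm_nd i j : (i <= j)%N -> sm i <= sm j.
Proof.
move=> ij; apply: ler_pM; [exact: ltW|exact: ltW|exact: sg_nd|exact: mratio_nd].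
Qed.

Let B0 : R := 2 * Nmin s r.
Let B0_gt0 : 0 < B0. Proof. by rewrite mulr_gt0// Nmin_gt0. Qed.

(* Finitely many indices are affected by this maximum, since the ratios of [M] are
   unbounded. *)
Let N j := Num.max (sm j) B0.
Let N_ge j : B0 <= N j. Proof. by rewrite le_max lexx orbT. Qed.
Let sm_le_N j : sm j <= N j. Proof. by rewrite le_max lexx. Qed.
Let N_gt0 j : 0 < N j. Proof. exact: lt_le_trans (N_ge j). Qed.

Let N_nd i j : (i <= j)%N -> N i <= N j.
Proof. by move=> ij; rewrite ge_max N_ge andbT (le_trans (sm_nd ij)). Qed.

Let CT := cT * (1 + (B0 / sm 1%N) ^+ r).

Let CT_ge0 : 0 <= CT.
Proof.
apply: mulr_ge0 => //; apply: addr_ge0 => //; apply: exprn_ge0.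
by apply: divr_ge0; exact: ltW.
Qed.

Let sm_tail k J : (0 < k)%N ->
  \sum_(k <= j < J) (Npow N r j)^-1 <= cT * k%:R / sm k ^+ r.
Proof.
move=> k0.
apply: (@le_trans _ _ (\sum_(k <= j < J) (sg k ^+ r)^-1 * (mratio M j ^+ r)^-1)).
  rewrite big_nat_cond [leRHS]big_nat_cond; apply: ler_sum => j /andP[/andP[kj _] _].
  rewrite -invfM lef_pV2 ?posrE ?mulr_gt0 ?exprn_gt0//.
  rewrite -exprMn; apply: ler_pow; first by rewrite mulr_ge0// ltW.
  apply: le_trans (sm_le_N j); rewrite /sm ler_wpM2r ?(ltW (mr_gt0 _))//; exact: sg_nd.
rewrite -mulr_sumr (le_trans (ler_wpM2l _ (M_tail _ k0)))//.
  by rewrite invr_ge0 exprn_ge0// ltW.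
have -> : sm k ^+ r = sg k ^+ r * mratio M k ^+ r by rewrite -exprMn.
by move: (sg k ^+ r) (mratio M k ^+ r) => a b; rewrite invfM mulrCA.
Qed.

(* If [N_k = B0], the tail at [k] is at most the tail at 1, which costs the constant
   [(B0 / sm 1)^r]. *)
Let N_tail k J : (0 < k)%N ->
  \sum_(k <= j < J) (Npow N r j)^-1 <= CT * k%:R / Npow N r k.
Proof.
move=> k0.
have P0 : 0 <= (B0 / sm 1%N) ^+ r by rewrite exprn_ge0// divr_ge0// ltW.
have NpowV j : 0 <= (Npow N r j)^-1 by rewrite invr_ge0 exprn_ge0// ltW.
have [Bk|kB] := leP B0 (sm k).
  have -> : Npow N r k = sm k ^+ r by rewrite /Npow /N max_l.
  apply: (le_trans (sm_tail J k0)); rewrite ler_wpM2r ?invr_ge0 ?exprn_ge0 ?(ltW (sm_gt0 _))//.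
  by rewrite ler_wpM2r// /CT mulrDr mulr1 lerDl mulr_ge0.
have -> : Npow N r k = B0 ^+ r by rewrite /Npow /N max_r// ltW.
apply: (@le_trans _ _ (\sum_(1 <= j < J) (Npow N r j)^-1)).
  have [Jk|kJ] := leqP J k; first by rewrite big_geq// sumr_ge0.
  by rewrite [leRHS](big_cat_nat (n := k)) ?(ltnW kJ)//= lerDr sumr_ge0.
apply: (le_trans (sm_tail J (ltn0Sn 0))); rewrite mulr1.
have -> : cT / sm 1%N ^+ r = cT * (B0 / sm 1%N) ^+ r / B0 ^+ r.
  by rewrite expr_div_n; field; rewrite !gt_eqF ?exprn_gt0.
rewrite ler_wpM2r ?invr_ge0 ?exprn_ge0 ?(ltW B0_gt0)//.
apply: (@le_trans _ _ (CT * 1)); first by rewrite mulr1 /CT ler_wpM2l// lerDr.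
by rewrite ler_wpM2l ?ler1n.
Qed.

Let Npow_gt0 j : 0 < Npow N r j. Proof. exact: exprn_gt0. Qed.

Let Npow_nd i j : (i <= j)%N -> Npow N r i <= Npow N r j.
Proof. by move=> ij; apply: ler_pow; [exact: ltW|exact: N_nd]. Qed.

Let g := glim N r.
Let dgl k : decay (fun y => y ^+ k * g y) := decay_glim r_gt0 r_even s_ge4 N_ge N_tail k.

Let dg : decay g.
Proof. by have := dgl 0%N; under eq_fun do rewrite expr0 mul1r. Qed.

(** The [k]-th derivative of the kernel: [k] quarter turns in the phase and a
    factor [y^k]. *)
Definition fund k (x : R) := (2 * pi)^-1 * costr (k%:R * (pi / 2)) (fun y => y ^+ k * g y) x.
Definition fcoef := dcoef (Npow N r) r.

Let fund0 : fund 0%N = kern g.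
Proof.
apply/funext => x; rewrite /fund /kern mul0r; congr (_ * costr _ _ _).
by apply/funext => y; rewrite expr0 mul1r.
Qed.

Lemma jet_fund : jet fund.
Proof.
move=> k x.
have dk1 : decay (fun y => y * (y ^+ k * g y)).
  by have := dgl k.+1; under eq_fun do rewrite exprS -mulrA.
have H1 := is_derive_costr (k%:R * (pi / 2)) x (dgl k) dk1.
have -> : fund k.+1 x = (2 * pi)^-1 *
    costr (k%:R * (pi / 2) + pi / 2) (fun y => y * (y ^+ k * g y)) x.
  rewrite /fund; congr (_ * costr _ _ _); first by rewrite -natr1 mulrDl mul1r.
  by apply/funext => y; rewrite exprS mulrA.
have H2 := is_deriveM (is_derive_cst ((2 * pi)^-1 : R) x 1) H1.
by apply: (is_derive_eq H2); rewrite scaler0 addr0.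
Qed.

Let prodN_le : exists2 e, 0 < e & forall k, \prod_(j < k) N j <= e * \prod_(j < k) sm j.
Proof.
have [J0 mJ] := M_unbounded (B0 / sg 0%N).
have smJ j : (J0 <= j)%N -> B0 <= sm j.
  move=> /mJ; rewrite ler_pdivrMr// mulrC => /le_trans; apply.
  by rewrite ler_wpM2r ?(ltW (mr_gt0 _))// sg_nd.
have [e e0 eN] : exists2 e, 0 < e & forall k, e * 1 ^+ k <= \prod_(j < k) (sm j / N j).
  apply: (prod_ge_geometric (a := fun j => sm j / N j) (J0 := J0)) => // [j|j jJ].
    exact: divr_gt0.
  by rewrite /N max_l ?divff// ?gt_eqF// smJ.
exists e^-1 => [|k]; first by rewrite invr_gt0.
have := eN k; rewrite expr1n mulr1 prodf_div ler_pdivlMr ?prodr_gt0// => h.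
by rewrite mulrC ler_pdivlMr// mulrC.
Qed.

Let tau_prod_ge0 k : 0 <= \prod_(j < k) tau j.
Proof. by apply: prodr_ge0 => j _; exact: ltW. Qed.

Let prodsg_le k :
  \prod_(j < k.+2) sg j <= \prod_(j < k) tau j / K0 ^+ k.+2 * (2 * 4 ^+ k).
Proof.
have sK j : sg j * K0 = Num.min (tau j) j.+1%:R by rewrite /sg divfK// gt_eqF.
have sK0 j : 0 <= sg j * K0 by rewrite mulr_ge0// ltW.
suff h : \prod_(j < k.+2) sg j * K0 ^+ k.+2 <= \prod_(j < k) tau j * (2 * 4 ^+ k).
  by rewrite mulrAC ler_pdivlMr ?exprn_gt0.
rewrite -[in K0 ^+ k.+2](card_ord k.+2) -prodr_const -big_split/=.
rewrite 2!big_ord_recr/= -mulrA; apply: ler_pM.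
- by apply: prodr_ge0 => j _; exact: sK0.
- by rewrite mulr_ge0.
- by apply: ler_prod => j _; rewrite sK0/= sK ge_min lexx.
- apply: (@le_trans _ _ (k.+1%:R * k.+2%:R)).
    by apply: ler_pM; rewrite ?sK0// sK ge_min lexx orbT.
  rewrite -natrM -natrX -natrM ler_nat.
  have := ltn_expl k (isT : 1 < 2)%N.
  have -> : (4 ^ k = 2 ^ k * 2 ^ k)%N by rewrite -expnMn.
  by move: (2 ^ k)%N => t kt; nia.
Qed.

Let prodsm_le : exists2 E, 0 <= E & forall k,
  4 ^+ k * \prod_(j < k.+2) sm j <= E * (M k * \prod_(j < k) tau j).
Proof.
exists (2 * c0 * M 2 * H ^+ 2 / K0 ^+ 2).
  apply: divr_ge0; last by rewrite exprn_ge0// ltW.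
  by rewrite !mulr_ge0 ?exprn_ge0// ltW.
move=> k.
rewrite big_split/= prod_mratio//.
have h2 : M k.+2 <= c0 * H ^+ k.+2 * (M k * M 2).
  by rewrite -addn2; exact: M_subM.
apply: (@le_trans _ _ (4 ^+ k * ((\prod_(j < k) tau j / K0 ^+ k.+2 * (2 * 4 ^+ k)) *
   (c0 * H ^+ k.+2 * (M k * M 2))))).
  apply: ler_wpM2l; first exact: exprn_ge0.
  apply: ler_pM => //; last exact: prodsg_le.
  by apply: prodr_ge0 => j _; exact: ltW.
apply: eq_ler.
have e1 : H ^+ k.+2 = H ^+ k * H ^+ 2 by rewrite -exprD addn2.
have e2 : K0 ^+ k.+2 = 4 ^+ k * 4 ^+ k * H ^+ k * K0 ^+ 2.
  rewrite (_ : K0 ^+ k.+2 = K0 ^+ k * K0 ^+ 2); last by rewrite -exprD addn2.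
  rewrite -!exprMn; congr (_ ^+ _ * _).
  by rewrite /K0; ring.
rewrite e1 e2; move: K0_gt0; move: K0 (\prod_(j < k) tau j) => K T KK.
by field; rewrite !gt_eqF ?exprn_gt0.
Qed.

(** The bound [Kbound k] of the transform is [4^k prod_(j < k+2) N_j] up to a
    constant, and the [N_j] multiply to [M_(k+2)] times the product of the
    [sg j]; (M.2) brings [M_(k+2)] back to [M_k]. *)
Lemma fund_bound : exists2 C, 0 <= C & forall k x,
  `|fund k x| <= C * (M k * \prod_(j < k) tau j) * expR (- (kappa * `|x|)).
Proof.
have [e e0 eN] := prodN_le.
have [E E0 prodsm] := prodsm_le.
pose KC := Kconst N CT s r.
have KC0 : 0 <= KC by exact: Kconst_ge0.
have p0 : 0 <= (2 * pi)^-1 :> R by rewrite invr_ge0 mulr_ge0 ?pi_ge0.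
exists ((2 * pi)^-1 * (2 * (KC * (e * E)) * wgt_mass)).
  apply: mulr_ge0 => //; apply: mulr_ge0; last exact: wgt_mass_ge0.
  by apply: mulr_ge0 => //; apply: mulr_ge0 => //; apply: mulr_ge0 => //; exact: ltW.
move=> k x; rewrite /fund normrM (ger0_norm p0).
have Kb : Kbound N CT s r k <= KC * (e * (E * (M k * \prod_(j < k) tau j))).
  rewrite /Kbound -/KC; apply: ler_wpM2l => //.
  apply: (@le_trans _ _ (4 ^+ k * (e * \prod_(j < k.+2) sm j))).
    by apply: ler_wpM2l; [exact: exprn_ge0|exact: eN].
  by rewrite mulrCA; apply: ler_wpM2l; [exact: ltW|exact: prodsm].
have H1 := costr_glim_decay r_gt0 r_even s_ge4 N_ge N_tail k (k%:R * (pi / 2)) x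
  kappa_ge0 s_kappa.
apply: (le_trans (ler_wpM2l p0 H1)).
move: (expR _) (expR_ge0 (- (kappa * `|x|))) => ex ex0.
move: (Kbound _ _ _ _ _) (M k * _) Kb => KK MM Kb.
rewrite [leRHS](_ : _ = (2 * pi)^-1 * (2 * (KC * (e * (E * MM))) * wgt_mass * ex)); last by ring.
apply: ler_wpM2l => //; apply: ler_wpM2r => //; apply: ler_wpM2r; first exact: wgt_mass_ge0.
exact: ler_wpM2l.
Qed.

Lemma fcoef_ge0 m : 0 <= fcoef m.
Proof. by rewrite /fcoef; apply: (dcoef_ge0 (b := Npow N r) (C := CT)). Qed.

Lemma fcoef_odd m : odd m -> fcoef m = 0.
Proof.
move=> mo; rewrite /fcoef /dcoef; case: ifPn => // /dvdnP[k mk]; move: mo.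
by rewrite mk oddM (negPf r_even) andbF.
Qed.

(** The coefficient of order [r k] is at most [C^k / (prod_(j < k) N_j)^r], and the
    product is at least [(X / K0)^k M_k] up to a constant; (M.2) compares [M_k^r] with
    [M_(rk)]. *)
Lemma fcoef_bound : exists2 L0, 0 < L0 & forall X J0, 0 < X ->
  (forall j, (J0 <= j)%N -> X <= tau j) ->
  exists2 C, 0 < C & forall m, fcoef m <= C * (L0 / X) ^+ m / M m.
Proof.
pose A := 2 * expR CT * H ^+ (r ^ 2).
have A1 : 1 <= A.
  rewrite -[leLHS]mulr1; apply: ler_pM => //; last by rewrite exprn_ege1.
  by rewrite -[leLHS]mulr1; apply: ler_pM; rewrite ?ler1n// -expR0 ler_expR.
have A0 : 0 < A by exact: lt_le_trans A1.
exists (A * K0); first by rewrite mulr_gt0.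
move=> X J0 X0 tauX.
have [e e0 eS] : exists2 e, 0 < e & forall k, e * (X / K0) ^+ k <= \prod_(j < k) sg j.
  apply: (prod_ge_geometric (J0 := maxn J0 (Num.bound X))) => // [|j jJ].
    by rewrite divr_gt0.
  rewrite ler_wpM2r ?invr_ge0 ?(ltW K0_gt0)// le_min tauX ?(leq_trans (leq_maxl _ _) jJ)//=.
  apply: (le_trans (ltW (archi_boundP (ltW X0)))); rewrite ler_nat.
  by rewrite (leq_trans _ (leqnSn j))// (leq_trans (leq_maxr _ _) jJ).
have C00 : 0 < c0 by exact: lt_le_trans c0_ge1.
have XK : 0 < X / K0 by exact: divr_gt0.
exists (c0 ^+ r / e ^+ r); first by rewrite divr_gt0 ?exprn_gt0.
move=> m; rewrite /fcoef /dcoef; case: ifPn => [/dvdnP[k ->]|_]; last first.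
  apply: divr_ge0 => //; apply: mulr_ge0; first by rewrite divr_ge0 ?exprn_ge0// ltW.
  apply: exprn_ge0; apply: divr_ge0; last exact: ltW.
  by apply: mulr_ge0; exact: ltW.
rewrite mulnK//.
apply: (le_trans (pcoef_le Npow_gt0 Npow_nd N_tail k)).
have PS0 : 0 < e * (X / K0) ^+ k by rewrite mulr_gt0 ?exprn_gt0.
have p1 : (e * (X / K0) ^+ k * M k) ^+ r <= \prod_(j < k) Npow N r j.
  rewrite /Npow prodrXl; apply: ler_pow; first by rewrite mulr_ge0// ltW.
  apply: (@le_trans _ _ (\prod_(j < k) sm j)).
    rewrite big_split/= prod_mratio//; exact: ler_wpM2r.
  by apply: ler_prod => j _; rewrite sm_le_N ltW.
have A20 : 0 <= (2 * expR CT) ^+ k by rewrite exprn_ge0// mulr_ge0 ?expR_ge0.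
have D0 : 0 < (e * (X / K0) ^+ k * M k) ^+ r by rewrite exprn_gt0// mulr_gt0.
apply: (@le_trans _ _ ((2 * expR CT) ^+ k / (e * (X / K0) ^+ k * M k) ^+ r)).
  apply: ler_wpM2l => //; rewrite lef_pV2 ?posrE//.
  exact: lt_le_trans p1.
have p2 := M_powM M_gt0 M0 c0_ge1 H_ge1 M_M2 r k.
rewrite ler_pdivlMr// [(k * r)%N]mulnC.
apply: (le_trans (ler_wpM2l _ p2)); first by rewrite divr_ge0// ltW.
rewrite [leLHS](_ : _ = c0 ^+ r / e ^+ r * (A ^+ k * (K0 / X) ^+ (r * k))).
  apply: ler_wpM2l; first by rewrite divr_ge0 ?exprn_ge0// ltW.
  have -> : A * K0 / X = A * (K0 / X) by rewrite mulrA.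
  rewrite [leRHS]exprMn; apply: ler_wpM2r.
    by rewrite exprn_ge0// divr_ge0// ltW.
  by apply: ler_weXn2l => //; rewrite -[leqLHS]mul1n leq_mul.
rewrite /A; move: K0_gt0; generalize K0 => K KK.
rewrite !exprMn !exprVn -!exprM [(k * r)%N]mulnC.
by field; rewrite !gt_eqF ?exprn_gt0.
Qed.

Lemma fund_identity : exists2 D, 0 <= D & delta_rate (fund 0%N) fcoef D.
Proof.
have cg1 := dcoef_sum_le1 r_gt0 r_even s_ge4 N_ge N_nd N_tail.
have cgc := dcoef_sum_cvg1 r_gt0 r_even s_ge4 N_ge N_nd N_tail.
have gge0 x : 0 <= g x by exact: (glim_ge0 r_even s_ge4 N_ge N_tail x).
have := symb_sum_rate dg gge0 fcoef_ge0 fcoef_odd cg1 cgc.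
by rewrite fund0.
Qed.

End OneDimensional.

Theorem fundamental_solution_1d {R : realType} (M : nat -> R) (c0 H : R)
    (tau : nat -> R) (kappa : R) :
  (forall p, 0 < M p) -> M 0%N = 1 -> cond_M1 M ->
  1 <= c0 -> 1 <= H -> cond_M2 c0 H M -> cond_M5 M ->
  (forall j, 0 < tau j) -> (forall i j, (i <= j)%N -> tau i <= tau j) ->
  0 <= kappa ->
  exists (G : nat -> R -> R) (c : nat -> R),
  [/\ jet G,
      exists2 C, 0 <= C & forall k x,
        `|G k x| <= C * (M k * \prod_(j < k) tau j) * expR (- (kappa * `|x|)),
      [/\ c 0%N = 1, forall m, 0 <= c m & forall m, odd m -> c m = 0],
      exists2 L0, 0 < L0 & forall X J0, 0 < X ->
        (forall j, (J0 <= j)%N -> X <= tau j) ->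
        exists2 C, 0 < C & forall m, c m <= C * (L0 / X) ^+ m / M m &
      exists2 D, 0 <= D & delta_rate (G 0%N) c D].
Proof.
move=> M_gt0 M0 M_M1 c0_ge1 H_ge1 M_M2 M_M5 tau_gt0 tau_nd kappa_ge0.
have [r [cT [r_gt0 r_even cT_ge0 M_tail]]] := mratio_tail M_gt0 M_M1 M_M5.
have M_unb := mratio_unbounded M_gt0 M_M1 M_M5.
exists (fund M H r tau kappa), (fcoef M H r tau kappa); split.
- by eapply jet_fund; eassumption.
- by eapply (fund_bound (c0 := c0)); eassumption.
- by split; [exact: dcoef0|eapply fcoef_ge0|eapply fcoef_odd]; eassumption.
- by eapply (fcoef_bound (c0 := c0)); eassumption.
- by eapply fund_identity; eassumption.
Qed.

(** * Lebesgue measure on tuples *)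

Section LebesgueRn.
Context {R : realType}.
Local Notation RR := (measurableTypeR R).
Local Notation mu := (@lebesgue_measure R).

(** A name of its own for [lebesgueRn], to carry the sigma-finite structure that
    product measures and Fubini's theorem ask for. *)
Definition leb n : set (n.-tuple RR) -> \bar R := lebesgueRn R n.

HB.instance Definition _ n := isMeasure.Build _ _ _ (@leb n)
  (measure0 (lebesgueRn R n)) (measure_ge0 (lebesgueRn R n))
  (@measure_semi_sigma_additive _ _ _ (lebesgueRn R n)).

Lemma measurable_box n (B : 'I_n -> set RR) : (forall i, measurable (B i)) ->
  measurable [set t : n.-tuple RR | forall i, B i (tnth t i)].
Proof.
move=> mB.
rewrite (_ : [set t | _] = \bigcap_(i in [set: 'I_n])
    ((fun t : n.-tuple RR => tnth t i) @^-1` B i)).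
  apply: fin_bigcap_measurable => // i _; rewrite -[X in measurable X]setTI.
  exact: measurable_tnth.
by apply/seteqP; split=> t /= Ht i; [move=> _; exact: Ht|exact: (Ht i)].
Qed.

Lemma leb_sigma_finite n : sigma_finite [set: n.-tuple RR] (@leb n).
Proof.
pose I k : set RR := `[- k%:R, k%:R]%classic.
exists (fun k => [set t : n.-tuple RR | forall i, I k (tnth t i)]).
  apply/seteqP; split => // t _.
  exists (Num.bound (\sum_(i < n) `|tnth t i|)) => // i /=.
  rewrite /I/= in_itv/= -ler_norml.
  have H : `|tnth t i| <= \sum_(i < n) `|tnth t i|.
    by rewrite (bigD1 i)//= lerDl sumr_ge0.
  by apply: (le_trans H); apply/ltW/archi_boundP; exact: sumr_ge0.
move=> k; split; first by apply: (measurable_box (B := fun=> I k)) => i; exact: measurable_itv.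
rewrite /leb (lebesgueRn_box (B := fun=> I k)); last by move=> i; exact: measurable_itv.
rewrite -ge0_fin_numE; last by apply: prode_ge0 => i _; exact: measure_ge0.
apply: prode_fin_num => i _; rewrite lebesgue_measure_itv/=.
by case: ifP.
Qed.

HB.instance Definition _ n := Measure_isSigmaFinite.Build _ _ _ (@leb n)
  (leb_sigma_finite n).

Definition tcons n (x : R) (t : n.-tuple RR) : n.+1.-tuple RR := [the n.+1.-tuple RR of x :: t].

(** The two constructions of the product measure, by either order of the sections,
    agree on rectangles and hence everywhere. *)
Lemma lebS_pushforward n (A : set (n.+1.-tuple RR)) : measurable A ->
  @leb n.+1 A = pushforward (mu \x (@leb n))%E (@tuple_cons R n) A.
Proof.
move=> mA; rewrite /pushforward.
transitivity ((mu \x^ (@leb n))%E (@tuple_cons R n @^-1` A)); first by [].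
apply/esym; apply: (@product_measure_unique _ _ _ _ _ mu (@leb n) (mu \x^ (@leb n))%E).
  by move=> B C mB mC; rewrite /= product_measure2E.
rewrite -[X in measurable X]setTI; exact: measurable_tuple_cons.
Qed.

Lemma measurable_comp_tcons n (f : n.+1.-tuple RR -> \bar R) :
  measurable_fun setT f -> measurable_fun setT (f \o @tuple_cons R n).
Proof. by move=> mf; apply: measurableT_comp => //; exact: measurable_tuple_cons. Qed.

Lemma ge0_integral_lebS n (f : n.+1.-tuple RR -> \bar R) :
  measurable_fun setT f -> (forall t, 0 <= f t)%E ->
  (\int[@leb n.+1]_t f t = \int[@leb n]_t \int[mu]_x f (tcons x t))%E.
Proof.
move=> mf f0.
transitivity (\int[pushforward (mu \x (@leb n)) (@tuple_cons R n)]_t f t)%E.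
  by apply: eq_measure_integral => A mA _; exact: lebS_pushforward.
rewrite ge0_integral_pushforward//= preimage_setT.
have mfc := measurable_comp_tcons mf.
by rewrite (fubini_tonelli2 (m1 := mu) (m2 := @leb n) (f \o @tuple_cons R n) mfc (fun z => f0 _)).
Qed.

Section IntegrableLebS.
Variables (n : nat) (f : n.+1.-tuple RR -> \bar R).
Hypothesis intf : (@leb n.+1).-integrable setT f.

Let mf : measurable_fun setT f. Proof. by have /integrableP[] := intf. Qed.

Let ifc : (mu \x (@leb n))%E.-integrable setT (f \o @tuple_cons R n).
Proof.
apply/integrable21ltyP; first exact: measurable_comp_tcons.
have /integrableP[_] := intf; rewrite ge0_integral_lebS//.
exact: measurableT_comp.
Qed.

Lemma integral_lebS :
  (\int[@leb n.+1]_t f t = \int[@leb n]_t \int[mu]_x f (tcons x t))%E.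
Proof.
transitivity (\int[pushforward (mu \x (@leb n)) (@tuple_cons R n)]_t f t)%E.
  by apply: eq_measure_integral => A mA _; exact: lebS_pushforward.
rewrite integral_pushforward//= preimage_setT.
by rewrite -(integral21_prod_meas1 ifc).
Qed.

Lemma measurable_integral_lebS :
  measurable_fun setT (fun t => \int[mu]_x f (tcons x t))%E.
Proof. exact: (measurable_fubini_G ifc). Qed.

End IntegrableLebS.

Definition wgtn n (t : n.-tuple RR) : R := \prod_(i < n) wgt (tnth t i).

Lemma wgtn_ge0 n t : 0 <= @wgtn n t.
Proof. by apply: prodr_ge0 => i _; exact: wgt_ge0. Qed.

Lemma wgtnS n x (t : n.-tuple RR) : wgtn (tcons x t) = wgt x * wgtn t.
Proof.
by rewrite /wgtn big_ord_recl; congr (_ * _); apply: eq_bigr => i _; rewrite tnthS.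
Qed.

Lemma measurable_prod_tnth n (g : R -> R) : measurable_fun setT g ->
  measurable_fun setT (fun t : n.-tuple RR => \prod_(i < n) g (tnth t i)).
Proof.
move=> mg; apply: measurable_prod => i _.
by apply: measurableT_comp => //; exact: measurable_tnth.
Qed.

Lemma measurable_wgt : measurable_fun setT (@wgt R).
Proof. by apply: continuous_measurable_fun; exact: continuous_wgt. Qed.

Lemma measurable_wgtn n : measurable_fun setT (@wgtn n).
Proof. exact: measurable_prod_tnth measurable_wgt. Qed.

Lemma integral_wgt : (\int[mu]_x (wgt x)%:E = (@wgt_mass R)%:E)%E.
Proof. by rewrite /wgt_mass /Rintegral fineK//; exact/integrable_fin_num/integrable_wgt. Qed.

Lemma integral_wgtn n : (\int[@leb n]_t (wgtn t)%:E = ((@wgt_mass R) ^+ n)%:E)%E.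
Proof.
elim: n => [|n IH].
  rewrite (eq_integral (fun=> 1%E)); last by move=> t _; rewrite /wgtn big_ord0.
  by rewrite integral_cst//= mul1e /leb/= /dirac/= indicE in_setT expr0.
rewrite ge0_integral_lebS; last 2 first.
- by apply/measurable_EFinP; exact: measurable_wgtn.
- by move=> t; rewrite lee_fin wgtn_ge0.
under eq_integral => t _.
  under eq_integral => x _ do rewrite wgtnS mulrC EFinM.
  rewrite ge0_integralZl//; last 3 first.
  - by apply/measurable_EFinP; exact: measurable_wgt.
  - by move=> x _; rewrite lee_fin wgt_ge0.
  - by rewrite lee_fin wgtn_ge0.
  rewrite integral_wgt muleC.
  over.
rewrite ge0_integralZl//; last 3 first.
- by apply/measurable_EFinP; exact: measurable_wgtn.
- by move=> t _; rewrite lee_fin wgtn_ge0.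
- by rewrite lee_fin wgt_mass_ge0.
by rewrite IH -EFinM -exprS.
Qed.

Lemma integrable_wgtn n : (@leb n).-integrable setT (EFin \o @wgtn n).
Proof.
apply/integrableP; split; first by apply/measurable_EFinP; exact: measurable_wgtn.
under eq_integral do rewrite /= ger0_norm ?wgtn_ge0//.
by rewrite integral_wgtn ltry.
Qed.

Lemma dominated_integrable_wgtn n (f : n.-tuple RR -> R) C : measurable_fun setT f ->
  (forall t, `|f t| <= C * wgtn t) -> (@leb n).-integrable setT (EFin \o f).
Proof. exact: dominated_integrable (@integrable_wgtn n). Qed.

Lemma Rintegral_le_wgtn n (f : n.-tuple RR -> R) C : measurable_fun setT f ->
  (forall t, `|f t| <= C * wgtn t) -> `|\int[@leb n]_t f t| <= C * (@wgt_mass R) ^+ n.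
Proof.
move=> mf fC; have -> : wgt_mass ^+ n = \int[@leb n]_t wgtn t.
  by rewrite /Rintegral integral_wgtn.
exact: Rintegral_dominated_le (@integrable_wgtn n) mf fC.
Qed.

(** Fubini's theorem for dominated functions, with the first coordinate innermost. *)
Lemma Rintegral_lebS n (f : n.+1.-tuple RR -> R) C : measurable_fun setT f ->
  (forall t, `|f t| <= C * wgtn t) ->
  \int[@leb n.+1]_t f t = \int[@leb n]_t \int[mu]_x f (tcons x t) /\
  measurable_fun setT (fun t : n.-tuple RR => \int[mu]_x f (tcons x t)).
Proof.
move=> mf fC; have iF := dominated_integrable_wgtn mf fC.
have E t : (\int[mu]_x (f (tcons x t))%:E)%E = (\int[mu]_x f (tcons x t))%:E.
  rewrite /Rintegral fineK//; apply: integrable_fin_num => //.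
  apply: (@dominated_integrable_wgt _ (fun x => f (tcons x t)) (C * wgtn t)).
    apply: measurableT_comp => //; exact: measurable_cons.
  by move=> x; rewrite (le_trans (fC _))// wgtnS mulrCA mulrC.
split.
  by rewrite {1}/Rintegral (integral_lebS iF) /Rintegral; congr fine; apply: eq_integral => t _; exact: E.
have mindex_of_seq := measurable_integral_lebS iF.
by apply/measurable_EFinP; apply: eq_measurable_fun mindex_of_seq => t _; exact: E.
Qed.

End LebesgueRn.

(** * Sums over boxes of multi-indices *)

Lemma Rintegral_sum_seq {R : realType} d' (T : measurableType d')
    (mu : {measure set T -> \bar R}) I (r : seq I) (h : I -> T -> R) :
  (forall i, mu.-integrable setT (EFin \o h i)) ->
  mu.-integrable setT (EFin \o (fun t => \sum_(i <- r) h i t)) /\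
  \int[mu]_t (\sum_(i <- r) h i t) = \sum_(i <- r) \int[mu]_t h i t.
Proof.
move=> ih; elim: r => [|i r [iK IH]].
  have -> : (fun t => \sum_(i <- [::]) h i t) = fun=> 0.
    by apply/funext => t; rewrite big_nil.
  rewrite big_nil /Rintegral integral0; split => //; exact: integrable0.
have -> : (fun t => \sum_(i <- i :: r) h i t) = fun t => h i t + \sum_(i <- r) h i t.
  by apply/funext => t; rewrite big_cons.
split; last by rewrite big_cons -IH RintegralD.
exact: integrable_realD.
Qed.

Section BoxSums.
Context {R : realType}.

(** Nested coordinate by coordinate, to match the recursive construction of the
    measure. *)
Fixpoint boxsum n K (J : seq nat -> R) : R :=
  if n is n'.+1 then \sum_(k < K) boxsum n' K (fun a => J (val k :: a)) else J [::].

Lemma boxsum_sum n K m (J : nat -> seq nat -> R) :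
  \sum_(k < m) boxsum n K (J k) = boxsum n K (fun a => \sum_(k < m) J k a).
Proof.
elim: n J => [//|n IH] J /=.
by rewrite exchange_big/=; apply: eq_bigr => k _;
  rewrite (IH (fun i a => J i (val k :: a))).
Qed.

Lemma boxsum_dist n K (J J' : seq nat -> R) E :
  (forall a, size a = n -> `|J a - J' a| <= E * 2^-1 ^+ sumn a) ->
  `|boxsum n K J - boxsum n K J'| <= E * 2 ^+ n.
Proof.
elim: n J J' E => [|n IH] J J' E JE /=.
  by have := JE [::] erefl; rewrite /= !expr0.
rewrite -sumrB; apply: (le_trans (ler_norm_sum _ _ _)).
have E0 : 0 <= E.
  by have := JE (nseq n.+1 0%N) (size_nseq _ _); rewrite sumn_nseq mul0n expr0 mulr1; exact: le_trans.
apply: (@le_trans _ _ (\sum_(k < K) (E * 2 ^+ n) * 2^-1 ^+ k)).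
  apply: ler_sum => k _; rewrite mulrAC; apply: IH => a sa.
  by have := JE (val k :: a); rewrite /= sa exprD mulrA; apply.
rewrite -mulr_sumr exprS -(big_mkord xpredT (fun k => 2^-1 ^+ k)).
apply: (le_trans (ler_wpM2l _ (geo_sum_le _ _))); first by rewrite mulr_ge0// exprn_ge0.
by rewrite expr0 mulr1 -mulrA (mulrC (2 ^+ n)).
Qed.

Definition sprod (c : nat -> R) (a : seq nat) : R := \prod_(k <- a) c k.

Lemma sprod_cons c k a : sprod c (k :: a) = c k * sprod c a.
Proof. by rewrite /sprod big_cons. Qed.

End BoxSums.

Section BoxIdentity.
Context {R : realType}.
Local Notation RR := (measurableTypeR R).
Local Notation mu := (@lebesgue_measure R).
Variables (G : R -> R) (c : nat -> R) (D CG : R).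
Hypothesis G_cont : continuous G.
Hypothesis G_le : forall x, `|G x| <= CG.
Hypothesis CG_ge0 : 0 <= CG.
Hypothesis D_ge0 : 0 <= D.
Hypothesis c0 : c 0%N = 1.
Hypothesis G_fund : delta_rate G c D.

Definition tensor_tuple n (t : n.-tuple RR) : R := \prod_(i < n) G (tnth t i).

Lemma tensor_tuple_cons n x (t : n.-tuple RR) : tensor_tuple (tcons x t) = G x * tensor_tuple t.
Proof.
by rewrite /tensor_tuple big_ord_recl; congr (_ * _); apply: eq_bigr => i _; rewrite tnthS.
Qed.

Lemma measurable_tensor_tuple n : measurable_fun setT (@tensor_tuple n).
Proof. by apply: measurable_prod_tnth; exact: continuous_measurable_fun. Qed.

Lemma tensor_tuple_le n (t : n.-tuple RR) : `|tensor_tuple t| <= CG ^+ n.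
Proof.
rewrite /tensor_tuple normr_prod -[n in CG ^+ n]card_ord -prodr_const.
by apply: ler_prod => i _; rewrite normr_ge0 G_le.
Qed.

Lemma norm_symb m : `|symb c m| = `|c m|.
Proof. by rewrite /symb normrM normrX normrN normr1 expr1n mul1r. Qed.

Lemma norm_sprod_symb a : `|sprod (symb c) a| = `|sprod c a|.
Proof.
elim: a => [|k a IH]; first by rewrite /sprod !big_nil.
by rewrite !sprod_cons (normrM (symb c k)) (normrM (c k)) norm_symb IH.
Qed.

(** [F a] stands for the derivative of order [a] of a function of [n] variables.
    A variable is differentiated with those before it frozen at 0 with exponent 0,
    because the coordinates are integrated, and thereby evaluated at 0, in order. *)
Fixpoint chain n : (seq nat -> n.-tuple RR -> R) -> Prop :=
  match n with
  | 0 => fun=> True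
  | n'.+1 => fun F =>
      (forall a t, jet (fun k x => F (k :: a) (tcons x t))) /\
      chain (fun a t => F (0%N :: a) (tcons 0 t))
  end.

Record admissible n (F : seq nat -> n.-tuple RR -> R) (B : R) : Prop := {
  adm_chain : chain F ;
  adm_meas : forall a, measurable_fun setT (F a) ;
  adm_dom : forall a, exists C, forall t, `|F a t| <= C * wgtn t ;
  adm_bound : forall a t, size a = n ->
    `|sprod c a * F a t| <= B * 2^-1 ^+ sumn a * wgtn t }.

Lemma admissible_ge0 n F B : @admissible n F B -> 0 <= B.
Proof.
move=> [_ _ _ /(_ (nseq n 0%N) (nseq_tuple n 0) (size_nseq _ _))].
rewrite sumn_nseq mul0n expr0 mulr1 => /(le_trans (normr_ge0 _)).
rewrite pmulr_lge0//; apply: prodr_gt0 => i _; exact: wgt_gt0.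
Qed.

Lemma measurable_tconsr n x : measurable_fun setT (@tcons R n x).
Proof. by apply: measurable_cons => //; exact: measurable_id. Qed.

Lemma admissibleS n F B : @admissible n.+1 F B ->
  @admissible n (fun a t => F (0%N :: a) (tcons 0 t)) B.
Proof.
have w0 : @wgt R 0 = 1 by rewrite /wgt expr0n addr0 invr1.
move=> [chF mF dF bF]; split.
- by case: chF.
- by move=> a; apply: measurableT_comp => //; exact: measurable_tconsr.
- by move=> a; have [C FC] := dF (0%N :: a); exists C => t; rewrite (le_trans (FC _))// wgtnS w0 mul1r.
- move=> a t sa; have := bF (0%N :: a) (tcons 0 t); rewrite /= sa => /(_ erefl).
  by rewrite sprod_cons c0 mul1r add0n wgtnS w0 mul1r.
Qed.

Definition coefint n (F : seq nat -> n.-tuple RR -> R) a : R :=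
  sprod (symb c) a * \int[@leb R n]_t (tensor_tuple t * F a t).

(** Summing over the first index and integrating over the first coordinate gives
    the one-dimensional identity, applied to the slices of [F]; its error is
    integrated over the remaining coordinates. *)
Lemma slice_bound n (F : seq nat -> n.+1.-tuple RR -> R) B K a :
  admissible F B -> size a = n ->
  `|\sum_(k < K) coefint F ((k : nat) :: a) - coefint (fun a t => F (0%N :: a) (tcons 0 t)) a|
  <= (CG ^+ n * (D * B * 2^-1 ^+ K) * (@wgt_mass R) ^+ n) * 2^-1 ^+ sumn a.
Proof.
move=> aF sa; have [[jF _] mF dF bF] := aF.
have B0 := admissible_ge0 aF.
have aF' := admissibleS aF.
pose f k x t := F (k :: a) (tcons x t).
pose In k (t : n.-tuple RR) := \int[mu]_x (G x * f k x t).
have dGF k : exists C, forall t, `|tensor_tuple t * F (k :: a) t| <= C * wgtn t.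
  have [C FC] := dF (k :: a); exists (CG ^+ n.+1 * C) => t.
  by rewrite normrM -mulrA ler_pM// tensor_tuple_le.
have mGF k : measurable_fun setT (fun t => tensor_tuple t * F (k :: a) t).
  by apply: measurable_funM; [exact: measurable_tensor_tuple|exact: mF].
have dec k t : decay (fun x => f k x t).
  split.
    exact: is_derive_continuous (jF a t k).
  have [C FC] := dF (k :: a); exists (C * wgtn t) => x.
  by rewrite /f (le_trans (FC _))// wgtnS mulrCA mulrC.
have intGf k t : mu.-integrable setT (EFin \o (fun x => G x * f k x t)).
  have := integrable_decay (decayM (dec k t) G_cont G_le).
  by apply: eq_integrable => // x _ /=; rewrite mulrC.
have e k t : \int[mu]_x (tensor_tuple (tcons x t) * f k x t) = tensor_tuple t * In k t.
  rewrite /In -RintegralZl//; apply: eq_Rintegral => x _.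
  by rewrite tensor_tuple_cons; ring.
have E k : \int[@leb R n.+1]_t (tensor_tuple t * F (k :: a) t) = \int[@leb R n]_t (tensor_tuple t * In k t) /\
    measurable_fun setT (fun t : n.-tuple RR => tensor_tuple t * In k t).
  have [C GFC] := dGF k; have [-> mindex_of_seq] := Rintegral_lebS (mGF k) GFC.
  split; first by apply: eq_Rintegral => t _; exact: e.
  by apply: eq_measurable_fun mindex_of_seq => t _; exact: e.
have iGIn k : (@leb R n).-integrable setT (EFin \o (fun t => tensor_tuple t * In k t)).
  have [C FC] := dF (k :: a).
  apply: (@dominated_integrable_wgtn _ n _ (CG ^+ n * (CG * C * @wgt_mass R))); first exact: (E k).2.
  move=> t; rewrite normrM -mulrA; apply: ler_pM => //; first exact: tensor_tuple_le.
  have : `|In k t| <= (CG * (C * wgtn t)) * @wgt_mass R.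
    apply: Rintegral_le_wgt.
      by have /integrableP[/measurable_EFinP] := intGf k t.
    move=> x; rewrite normrM -mulrA; apply: ler_pM => //.
    by rewrite /f (le_trans (FC _))// wgtnS mulrCA mulrC.
  by move=> /le_trans; apply; apply: eq_ler; ring.
have iGF' : (@leb R n).-integrable setT (EFin \o (fun t => tensor_tuple t * F (0%N :: a) (tcons 0 t))).
  have [C FC] := adm_dom aF' a.
  apply: (@dominated_integrable_wgtn _ n _ (CG ^+ n * C)).
    by apply: measurable_funM; [exact: measurable_tensor_tuple|exact: (adm_meas aF' a)].
  by move=> t; rewrite normrM -mulrA ler_pM// tensor_tuple_le.
pose h k t := tensor_tuple t * (sprod (symb c) a * (symb c k * In k t)).
have hE k : h k = fun t => (sprod (symb c) a * symb c k) * (tensor_tuple t * In k t).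
  by apply/funext => t; rewrite /h; ring.
have ih k : (@leb R n).-integrable setT (EFin \o h k).
  by rewrite hE; exact: integrable_realZ.
have cE k : coefint F (k :: a) = \int[@leb R n]_t h k t.
  rewrite /coefint sprod_cons (E k).1 hE RintegralZl//.
  by rewrite (mulrC (symb c k)).
pose h0 (t : n.-tuple RR) := sprod (symb c) a * (tensor_tuple t * F (0%N :: a) (tcons 0 t)).
have ih0 : (@leb R n).-integrable setT (EFin \o h0).
  exact: integrable_realZ.
have c0E : coefint (fun a t => F (0%N :: a) (tcons 0 t)) a = \int[@leb R n]_t h0 t.
  by rewrite /coefint /h0 RintegralZl.
have [ish shE] := Rintegral_sum_seq (index_enum 'I_K) (fun k : 'I_K => ih k).
under eq_bigr do rewrite cE.
rewrite c0E -shE -RintegralB//.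
rewrite mulrAC; apply: Rintegral_le_wgtn.
  have /integrableP[/measurable_EFinP m1 _] := ish.
  have /integrableP[/measurable_EFinP m2 _] := ih0.
  exact: measurable_funB.
move=> t.
have -> : \sum_(k < K) h k t - h0 t =
    tensor_tuple t * (sprod (symb c) a * (\sum_(k < K) symb c k * In k t - F (0%N :: a) (tcons 0 t))).
  by rewrite /h -mulr_sumr -mulr_sumr /h0; ring.
rewrite normrM -!mulrA; apply: ler_pM => //; first exact: tensor_tuple_le.
rewrite normrM norm_sprod_symb -normrM.
have jf : jet (fun k x => sprod c a * f k x t).
  move=> k x; have H1 := jF a t k x.
  have H2 := is_deriveM (is_derive_cst (sprod c a : R) x 1) H1.
  by apply: (is_derive_eq H2); rewrite scaler0 addr0.
have df k : decay (fun x => sprod c a * f k x t) by exact: decayZ.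
have bf m x : `|c m * (sprod c a * f m x t)| <= (B * 2^-1 ^+ sumn a * wgtn t) * 2^-1 ^+ m * wgt x.
  rewrite mulrA -sprod_cons; have := bF (m :: a) (tcons x t); rewrite /= sa => /(_ erefl).
  by rewrite wgtnS exprD => /le_trans; apply; apply: eq_ler; ring.
have := G_fund K jf df bf.
have -> : \sum_(m < K) symb c m * \int[mu]_x (G x * (sprod c a * f m x t)) =
   sprod c a * \sum_(m < K) symb c m * In m t.
  rewrite mulr_sumr; apply: eq_bigr => m _; rewrite mulrCA; congr (_ * _).
  by rewrite /In -RintegralZl//; apply: eq_Rintegral => x _; rewrite mulrCA.
rewrite -mulrBr => /le_trans; apply.
by apply: eq_ler; ring.
Qed.

(** Induction on the number of variables: [slice_bound] removes the first one, at
    the cost of an error that sums to a constant over the other indices. *)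
Theorem box_identity n : exists2 E, 0 <= E & forall F B K, @admissible n F B ->
  `|boxsum n K (coefint F) - F (nseq n 0%N) (nseq_tuple n 0)| <= E * B * 2^-1 ^+ K.
Proof.
elim: n => [|n [E E0 IH]].
  exists 0 => // F B K aF; rewrite !mul0r /= /coefint /sprod big_nil mul1r.
  rewrite (_ : \int[_]_t _ = F [::] (nseq_tuple 0 0)); first by rewrite subrr normr0.
  rewrite /Rintegral (eq_measure_integral (dirac ([tuple] : 0.-tuple RR)))//.
  rewrite integral_dirac//; last first.
    by apply/measurable_EFinP; apply: measurable_funM; [exact: measurable_tensor_tuple|exact: (adm_meas aF)].
  rewrite diracT mul1e /= /tensor_tuple big_ord0 mul1r; congr (F _ _).
  exact/val_inj.
exists (CG ^+ n * D * (@wgt_mass R) ^+ n * 2 ^+ n + E).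
  by rewrite addr_ge0// !mulr_ge0 ?exprn_ge0// wgt_mass_ge0.
move=> F B K aF; pose F' a t := F (0%N :: a) (tcons 0 t).
have H1 := IH F' B K (admissibleS aF).
have -> : F (nseq n.+1 0%N) (nseq_tuple n.+1 0) = F' (nseq n 0%N) (nseq_tuple n 0).
  by rewrite /F'; congr (F _ _); exact/val_inj.
rewrite [boxsum n.+1 _ _]/= (boxsum_sum n K K (fun k a => coefint F (k :: a))).
set S := boxsum n K _.
have H2 : `|S - boxsum n K (coefint F')| <= CG ^+ n * (D * B * 2^-1 ^+ K) * (@wgt_mass R) ^+ n * 2 ^+ n.
  by apply: boxsum_dist => a sa; exact: slice_bound.
rewrite -(subrK (boxsum n K (coefint F')) S) -addrA.
apply: (le_trans (ler_normD _ _)); rewrite 2!mulrDl; apply: lerD => //.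
apply: (le_trans H2); apply: eq_ler; ring.
Qed.

End BoxIdentity.

(** * Continuous functions on R^d and weighted norms *)

Section Rd.
Context {R : realType} {d : nat}.
Local Notation RR := (measurableTypeR R).
Local Notation Rd := 'rV[R]_d.

(** Second countability, in the form that gives measurability on tuples. *)
Lemma open_rational_box (U : set Rd) : open U ->
  U = \bigcup_(b in [set b : {ffun 'I_d -> rat} * nat |
        [set y : Rd | forall i, ball (ratr (b.1 i) : R) b.2.+1%:R^-1 (y 0 i)] `<=` U])
      [set y : Rd | forall i, ball (ratr (b.1 i) : R) b.2.+1%:R^-1 (y 0 i)].
Proof.
move=> oU; apply/seteqP; split => [x Ux|x [b /= bU xb]]; last exact: bU.
have /nbhs_ballP[e /= e0 xeU] : nbhs x U by exact: open_nbhs_nbhs.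
have [k ke] : exists k, 2 * k.+1%:R^-1 < e.
  exists (Num.bound (2 / e)).
  rewrite ltr_pdivrMr// mulrC -ltr_pdivrMr//.
  apply: (lt_trans (archi_boundP _)); first by rewrite divr_ge0// ltW.
  by rewrite ltr_nat.
have kp : 0 < k.+1%:R^-1 :> R by rewrite invr_gt0.
have H i : {q : rat | ball (ratr q : R) k.+1%:R^-1 (x 0 i)}.
  apply/cid; have /rat_in_itvoo[q] : x 0 i - k.+1%:R^-1 < x 0 i + k.+1%:R^-1.
    by rewrite ltrBlDr -addrA ltrDl addr_gt0.
  rewrite in_itv/= => /andP[q1 q2]; exists q.
  move: q1 q2; set u := _%:R^-1 => q1 q2; rewrite /ball/= ltr_norml; apply/andP; split; lra.
exists ([ffun i => sval (H i)], k) => /=; last by move=> i; rewrite ffunE; exact: (svalP (H i)).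
move=> y yb; apply: xeU; split=> // i j; rewrite (ord1 i).
have := yb j; have := svalP (H j); rewrite ffunE /ball/= => h1 h2.
rewrite distrC in h1.
rewrite -(subrK (ratr (sval (H j))) (x 0 j)) -addrA.
apply: (le_lt_trans (ler_normD _ _)); apply: lt_trans ke.
by rewrite mulr_natl mulr2n; exact: ltrD.
Qed.

Lemma measurable_continuous_Rd (f : Rd -> R^o) : continuous f ->
  measurable_fun setT (fun t : d.-tuple RR => (f (Rd_of_tuple t) : RR)).
Proof.
move=> /continuousP cf; apply: (measurability _ (RGenOpens.measurableE R)).
move=> _ [_ [a [b ->] <-]]; rewrite setTI.
rewrite (_ : _ @^-1` _ = (fun t : d.-tuple RR => (Rd_of_tuple t : Rd)) @^-1` (f @^-1` `]a, b[%classic))//.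
rewrite (open_rational_box (cf _ (interval_open _ _)))//.
rewrite preimage_bigcup bigcup_mkcond.
apply: countable_bigcupT_measurable; first exact: countableP.
move=> c; case: ifPn => // _.
rewrite [X in measurable X](_ : _ = [set t : d.-tuple RR | forall i, ball (ratr (c.1 i) : R) c.2.+1%:R^-1 (tnth t i)]).
  by apply: (measurable_box (B := fun i => ball (ratr (c.1 i) : R) c.2.+1%:R^-1)) => i; exact: measurable_ball.
by apply/seteqP; split => t /= + i => /(_ i); rewrite mxE.
Qed.

Lemma lebesgueRn_ball (x : Rd) (e : R) : 0 < e ->
  measurable [set t : d.-tuple RR | forall i, ball (x 0 i) e (tnth t i)] /\
  (0 < lebesgueRn R d [set t : d.-tuple RR | forall i, ball (x ord0 i) e (tnth t i)])%E.
Proof.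
move=> e0; split; first by apply: (measurable_box (B := fun i => ball (x 0 i) e)) => i; exact: measurable_ball.
rewrite (lebesgueRn_box (B := fun i => ball (x 0 i) e)); last by move=> i; exact: measurable_ball.
under eq_bigr do rewrite (lebesgue_measure_ball _ (ltW e0)).
by rewrite prodEFin lte_fin prodr_gt0// => i _; rewrite pmulrn_lgt0.
Qed.

Lemma lebesgueRn_setT_gt0 : (0 < lebesgueRn R d [set: d.-tuple RR])%E.
Proof.
have [m p] := lebesgueRn_ball 0 (@ltr01 R).
by apply: (lt_le_trans p); apply: le_measure; rewrite ?inE.
Qed.

(** An essential bound on a continuous function holds at every point, because
    every ball has positive measure. *)
Lemma LooRd_ge_continuous (f : Rd -> \bar R) (w : Rd -> R^o) (C : R) :
  continuous w -> (forall x, (w x)%:E <= f x)%E -> (LooRd f <= C%:E)%E ->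
  forall x, w x <= C.
Proof.
move=> cw wf; rewrite /LooRd unlock /= lebesgueRn_setT_gt0 => /ess_supP fC x.
rewrite leNgt; apply/negP => Cw.
have : nbhs x (w @^-1` `]C, +oo[%classic).
  apply: cw; apply: open_nbhs_nbhs; split; first exact: interval_open.
  by rewrite /= in_itv/= Cw.
move=> /nbhs_ballP[e /= e0 xe].
have [mB pB] := lebesgueRn_ball x e0.
set B := [set t | _] in mB pB.
suff : lebesgueRn R d B = 0%E by move=> B0; rewrite B0 ltxx in pB.
apply: (measure_negligible mB).
apply: negligibleS fC => t tB /=; apply/negP.
rewrite -ltNge.
have : `]C, +oo[%classic (w (Rd_of_tuple t)).
  by apply: xe; split => // i j; rewrite (ord1 i) mxE; exact: tB.
rewrite /= in_itv/= andbT -lte_fin => /lt_le_trans; apply.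
by apply: (le_trans (wf _)); exact: lee_abs.
Qed.

Lemma LooRd_le (f : Rd -> \bar R) (C : R) :
  (forall x, 0 <= f x <= C%:E)%E -> (LooRd f <= C%:E)%E.
Proof.
move=> fC; rewrite /LooRd unlock /= lebesgueRn_setT_gt0; apply/ess_supP.
by apply: nearW => t /=; have /andP[f0 fC1] := fC (Rd_of_tuple t); rewrite gee0_abs.
Qed.

End Rd.

Section Complex.
Context {R : realType} {d : nat}.
Local Notation Rd := 'rV[R]_d.

Lemma normcX (z : R[i]) n : Normc.normc (z ^+ n) = Normc.normc z ^+ n.
Proof.
by elim: n => [|n IH]; rewrite ?expr0 ?Normc.normc1// !exprS Normc.normcM IH.
Qed.

Lemma normc_real (x : R) : Normc.normc x%:C%C = `|x|.
Proof. by rewrite /Normc.normc /= expr0n addr0 sqrtr_sqr. Qed.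

Lemma Re_le_normc (z : R[i]) : `|complex.Re z| <= Normc.normc z.
Proof. by case: z => a b; rewrite /= -sqrtr_sqr ler_wsqrtr// lerDl sqr_ge0. Qed.

Lemma Im_le_normc (z : R[i]) : `|complex.Im z| <= Normc.normc z.
Proof. by case: z => a b; rewrite /= -sqrtr_sqr ler_wsqrtr// lerDr sqr_ge0. Qed.

Lemma normc_Dop a (f : Rd -> R[i]) x :
  Normc.normc (Dop a f x) = Normc.normc (partials a f x).
Proof.
rewrite /Dop Normc.normcM normcX (_ : Normc.normc _ = 1) ?expr1n ?mul1r//.
by rewrite /Normc.normc /= oppr0 expr0n/= add0r sqrrN expr1n sqrtr1.
Qed.

(** [partials a] applies the partial derivatives in the order of the coordinates,
    as the word [0^(a_0) 1^(a_1) ...]. *)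
Definition word (a : mindex d) : seq 'I_d :=
  flatten [seq nseq (a i) i | i <- enum 'I_d].

Lemma partials_word a (f : Rd -> R[i]) : partials a f = foldr (@partial R d) f (word a).
Proof.
rewrite /partials /word; elim: (enum _) => [//|i l IH] /=.
rewrite foldr_cat -IH; elim: (a i) => [//|k IHk] /=.
by rewrite -IHk.
Qed.

Lemma count_word a i : count_mem i (word a) = a i.
Proof.
rewrite /word count_flatten -map_comp sumnE big_map big_enum /= (bigD1 i)//= count_nseq /= eqxx mul1n.
rewrite big1 ?addn0// => j ji; rewrite count_nseq /=.
by rewrite (negbTE ji) mul0n.
Qed.

Lemma smooth_partials a (f : Rd -> R[i]) : smooth f ->
  [/\ continuous (rpart (partials a f)), continuous (ipart (partials a f)) &
        forall i x, derivable (rpart (partials a f)) x (delta_mx 0 i) /\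
                    derivable (ipart (partials a f)) x (delta_mx 0 i)].
Proof. by rewrite partials_word => /(_ (word a)). Qed.

End Complex.

Section Weight.
Context {R : realType} {d : nat}.
Local Notation Rd := 'rV[R]_d.

(** [logp] is the positive part of the logarithm, whose exponential is the
    maximum with 1. *)
Lemma ge0_expeR_logp (x : R) : 0 <= x -> (Num.max 1 x)%:E%E = expeR (logp x)%:E.
Proof.
move=> x0; rewrite /= /logp; congr EFin.
have [x1|x1] := leP 1 x.
  by rewrite max_r ?ln_ge0// lnK// posrE (lt_le_trans ltr01).
move: x0; rewrite le_eqVlt => /orP[/eqP <-|x0]; first by rewrite ln0// maxxx expR0.
by rewrite max_l ?expR0// -(@ln1 R) ler_ln ?posrE// ltW.
Qed.

Lemma expeR_assoc_ge (N : nat -> R) rho p : (forall q, 0 < N q) -> 0 <= rho ->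
  ((Num.max 1 (rho ^+ p / N p))%:E <= expeR (assoc_fun N rho))%E.
Proof.
move=> N0 r0; rewrite ge0_expeR_logp; last by rewrite divr_ge0 ?exprn_ge0// ltW.
by rewrite lee_expeR; apply: ereal_sup_ubound; exists p.
Qed.

Lemma expeR_assoc_le (N : nat -> R) rho C : (forall q, 0 < N q) -> 0 <= rho ->
  (forall p, rho ^+ p / N p <= C) -> 1 <= C -> (expeR (assoc_fun N rho) <= C%:E)%E.
Proof.
move=> N0 r0 NC C1.
have C0 : 0 <= C by apply: le_trans C1.
have -> : C%:E = expeR (logp C)%:E by rewrite -ge0_expeR_logp// max_r.
rewrite lee_expeR; apply: ge_ereal_sup => _ [p _ <-].
have q0 : 0 <= rho ^+ p / N p by rewrite divr_ge0 ?exprn_ge0// ltW.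
rewrite -lee_expeR -!ge0_expeR_logp// lee_fin.
by rewrite ge_max !le_max C1 (NC p) !orbT.
Qed.

(** [prod (1 + x_i^2) <= (1 + |x|^2)^d <= 2^d (1 + |x|^(2d))]. *)
Lemma prod_wgt_ge (x : Rd) :
  (\prod_(i < d) wgt (x 0 i))^-1 <= 2 ^+ d * (1 + (\sum_i x 0 i ^+ 2) ^+ d).
Proof.
set s := \sum_i _; have s0 : 0 <= s by apply: sumr_ge0 => i _; exact: sqr_ge0.
rewrite -prodfV.
apply: (@le_trans _ _ ((1 + s) ^+ d)).
  rewrite -[X in _ ^+ X]card_ord -prodr_const; apply: ler_prod => i _.
  rewrite /wgt invrK addr_ge0 ?sqr_ge0//= lerD2l /s (bigD1 i)//= lerDl.
  by apply: sumr_ge0 => j _; exact: sqr_ge0.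
have [s1|s1] := leP s 1.
  apply: (@le_trans _ _ (2 ^+ d)); first by apply: ler_pow; [exact: addr_ge0|lra].
  by rewrite ler_peMr ?exprn_ge0// lerDl exprn_ge0.
apply: (@le_trans _ _ ((2 * s) ^+ d)); first by apply: ler_pow; [exact: addr_ge0|lra].
by rewrite exprMn ler_wpM2l ?exprn_ge0// lerDr.
Qed.

Lemma continuous_sqsum n : continuous (fun x : Rd => (\sum_i x 0 i ^+ 2) ^+ n : R^o).
Proof.
move=> x.
have cs : {for x, continuous ((\sum_i (fun x : Rd => x 0 i ^+ 2 : R^o)) : Rd -> R^o)}.
  elim/big_rec : _ => [|i g _ cg]; first exact: cst_continuous.
  have cx : (fun y : Rd => y 0 i : R^o) @ x --> (x 0 i : R^o) by exact: coord_continuous.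
  by apply: cvgD cg; apply: (cvgM cx cx).
rewrite (_ : (fun x : Rd => (\sum_i x 0 i ^+ 2) ^+ n) = (fun y : R^o => y ^+ n) \o (\sum_i (fun x : Rd => x 0 i ^+ 2 : R^o))).
  by apply: continuous_comp cs _; exact: exprn_continuous.
by apply/funext => y /=; rewrite fct_sumE.
Qed.

(** The weight dominates both 1 and its term of order [2 d], hence
    [prod (1 + x_i^2)] up to a constant; the essential supremum becomes a pointwise
    bound by continuity. *)
Lemma S_h_bound (M A : nat -> R) h (phi : Rd -> R[i]) : (forall p, 0 < M p) -> (forall p, 0 < A p) ->
  0 < h -> S_h M A h phi -> exists2 C, 0 <= C & forall a x,
  `|complex.Re (partials a phi x)| <= C * (M (mlen a) / h ^+ mlen a) * \prod_(i < d) wgt (x 0 i) /\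
  `|complex.Im (partials a phi x)| <= C * (M (mlen a) / h ^+ mlen a) * \prod_(i < d) wgt (x 0 i).
Proof.
move=> M_gt0 A_gt0 h0 [sphi sfin].
have [S S0 HS] : exists2 S : R, 0 <= S & (sigma_h M A h phi <= S%:E)%E.
  case: (sigma_h M A h phi) sfin => [r _|//|_].
    by exists (Num.max 0 r); rewrite ?le_max ?lexx// lee_fin le_max lexx orbT.
  by exists 0; rewrite ?leNye.
(* The term of order [2 d] of the weight is [K |x|^(2d)]. *)
pose K := (h ^+ 2) ^+ d / A (2 * d)%N.
have K0 : 0 < K by rewrite divr_gt0// !exprn_gt0.
pose s (x : Rd) := \sum_i x 0 i ^+ 2.
have s0 x : 0 <= s x by apply: sumr_ge0 => i _; exact: sqr_ge0.
have We x : ((2^-1 * (1 + K * s x ^+ d))%:E <= expeR (assoc_fun A (h * enorm x)))%E.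
  have r0 : 0 <= h * enorm x by rewrite mulr_ge0 ?sqrtr_ge0// ltW.
  apply: le_trans (expeR_assoc_ge (2 * d) A_gt0 r0).
  have -> : (h * enorm x) ^+ (2 * d) = (h ^+ 2) ^+ d * s x ^+ d.
    by rewrite exprM (exprMn 2) (sqr_sqrtr (s0 x)) exprMn.
  rewrite lee_fin [X in Num.max 1 X](_ : _ = K * s x ^+ d); last by rewrite /K mulrAC.
  have : 0 <= K * s x ^+ d by rewrite mulr_ge0 ?exprn_ge0// ltW.
  move: (K * _) => u u0; have [|] := leP 1 u; lra.
have W (g : Rd -> R^o) a : continuous g -> (forall x, `|g x| <= Normc.normc (partials a phi x)) ->
   forall x, `|g x| <= (2 ^+ d * (2 * (1 + K^-1)) * S) * (M (mlen a) / h ^+ mlen a) * \prod_(i < d) wgt (x 0 i).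
  move=> cg gp x.
  have cw : continuous (fun x : Rd => (2^-1 * (1 + K * s x ^+ d)) * `|g x| : R^o).
    have cMul (u v : Rd -> R^o) : continuous u -> continuous v -> continuous (fun x => u x * v x : R^o).
      by move=> cu cv y; exact: cvgM (cu y) (cv y).
    have cAdd (u v : Rd -> R^o) : continuous u -> continuous v -> continuous (fun x => u x + v x : R^o).
      by move=> cu cv y; exact: cvgD (cu y) (cv y).
    have cst (k : R) : continuous ((fun=> k) : Rd -> R^o) by exact: cst_continuous.
    apply: (cMul); last by move=> y; exact: (continuous_comp (cg y) (@norm_continuous R R^o (g y))).
    apply: (cMul); first exact: (cst).
    apply: (cAdd); first exact: (cst).
    by apply: (cMul _ _ (cst K)); exact: continuous_sqsum.
  have ha : 0 < h ^+ mlen a / M (mlen a) by rewrite divr_gt0// exprn_gt0.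
  have := LooRd_ge_continuous (C := S * (M (mlen a) / h ^+ mlen a)) cw.
  move=> /(_ (fun x => expeR (assoc_fun A (h * enorm x)) * (Normc.normc (Dop a phi x))%:E)%E).
  have H1 : forall x, (((2^-1 * (1 + K * s x ^+ d)) * `|g x|)%:E <=
    expeR (assoc_fun A (h * enorm x)) * (Normc.normc (Dop a phi x))%:E)%E.
    move=> y; rewrite EFinM; apply: lee_pmul => //.
    - by rewrite lee_fin mulr_ge0// addr_ge0// mulr_ge0 ?exprn_ge0// ltW.
    - by rewrite normc_Dop lee_fin gp.
  move=> /(_ H1).
  have H2 : (LooRd (fun x => expeR (assoc_fun A (h * enorm x)) * (Normc.normc (Dop a phi x))%:E)
     <= (S * (M (mlen a) / h ^+ mlen a))%:E)%E.
    rewrite -[M _ / _]invf_div EFinM lee_pdivlMr//.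
    rewrite muleC; apply: le_trans HS; apply: ereal_sup_ubound; by exists a.
  move=> /(_ H2 x) H3.
  have P0 : 0 < \prod_(i < d) wgt (x 0 i) by apply: prodr_gt0 => i _; exact: wgt_gt0.
  rewrite -ler_pdivrMr// mulrC.
  apply: (@le_trans _ _ ((2 ^+ d * (1 + s x ^+ d)) * `|g x|)).
    by rewrite ler_wpM2r// prod_wgt_ge.
  rewrite -!mulrA ler_wpM2l ?exprn_ge0//.
  apply: (@le_trans _ _ ((2 * (1 + K^-1)) * (2^-1 * (1 + K * s x ^+ d) * `|g x|))).
    rewrite mulrA ler_wpM2r// mulrA [2 * _ * _]mulrAC mulfV// mul1r.
    have -> : (1 + K^-1) * (1 + K * s x ^+ d) = 1 + s x ^+ d + (K^-1 + K * s x ^+ d).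
      by have := gt_eqF K0; move=> /negbT K1; field.
    have Ki : 0 <= K^-1 by rewrite invr_ge0 ltW.
    have Ks : 0 <= K * s x ^+ d by apply: mulr_ge0; [exact: ltW|exact/exprn_ge0/s0].
    by rewrite lerDl addr_ge0.
  rewrite -!mulrA ler_wpM2l//; apply: ler_wpM2l; first by rewrite addr_ge0// invr_ge0 ltW.
  by rewrite !mulrA in H3 *.
exists (2 ^+ d * (2 * (1 + K^-1)) * S).
  by rewrite !mulr_ge0// ?exprn_ge0// addr_ge0// invr_ge0 ltW.
move=> a x; have [cr ci _] := smooth_partials a sphi; split.
  by apply: W cr _ x => y; exact: Re_le_normc.
by apply: W ci _ x => y; exact: Im_le_normc.
Qed.

End Weight.

(** * Partial derivatives along coordinate lines *)

Section Lines.
Context {R : realType} {d : nat}.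
Local Notation RR := (measurableTypeR R).
Local Notation Rd := 'rV[R]_d.

(** Directional derivatives of [f] at [x] along [v] and derivatives of [g] at [y]
    are limits of the same quotients. *)
Lemma quotient_line (f : Rd -> R^o) (x v : Rd) (g : R -> R) (y : R) :
  (forall h : R, f (h *: v + x) = g (h + y)) ->
  (fun h : R => h^-1 *: ((f \o shift x) (h *: v) - f x)) =
  (fun h : R => h^-1 *: ((g \o shift y) (h *: (1 : R^o)) - g y)).
Proof.
move=> fg; apply/funext => h /=.
by have := fg 0; rewrite scale0r !add0r => ->; rewrite fg -[h *: (1 : R^o)]/(h * 1) mulr1.
Qed.

Lemma derivable_line (f : Rd -> R^o) (x v : Rd) (g : R -> R) (y l : R) :
  (forall h : R, f (h *: v + x) = g (h + y)) -> is_derive (y : R^o) 1 (g : R^o -> R^o) l ->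
  derivable f x v /\ 'D_v f x = l.
Proof.
move=> /quotient_line E [dg <-]; split; first by rewrite /derivable E.
by rewrite /derive E.
Qed.

Lemma is_derive_line (f : Rd -> R^o) (x v : Rd) (g : R -> R) (y : R) :
  (forall h : R, f (h *: v + x) = g (h + y)) -> derivable f x v ->
  is_derive (y : R^o) 1 (g : R^o -> R^o) ('D_v f x).
Proof.
move=> /quotient_line E df; apply: DeriveDef; first by rewrite /derivable -E.
by rewrite /derive E.
Qed.

Definition Rd_of_seq (s : seq R) : Rd := \row_i nth 0 s i.
Definition mindex_of_seq (a : seq nat) : mindex d := [ffun i : 'I_d => nth 0%N a i].

Lemma Rd_of_seq_tuple (t : d.-tuple RR) : Rd_of_seq t = Rd_of_tuple t.
Proof. by apply/rowP => i; rewrite !mxE (tnth_nth 0). Qed.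

Lemma mlen_of_seq a : size a = d -> mlen (mindex_of_seq a) = sumn a.
Proof.
move=> sa; rewrite /mlen sumnE (big_nth 0%N) sa big_mkord.
by apply: eq_bigr => i _; rewrite ffunE.
Qed.

Lemma sprod_of_seq (c : nat -> R) a : size a = d -> sprod c a = \prod_i c (mindex_of_seq a i).
Proof.
move=> sa; rewrite /sprod (big_nth 0%N) sa big_mkord.
by apply: eq_bigr => i _; rewrite ffunE.
Qed.

(** The operators of the first coordinates are outermost; they disappear when
    their exponents vanish. *)
Lemma partials_tail (b : mindex d) (i : 'I_d) (f : Rd -> R[i]) :
  (forall j : 'I_d, (j < i)%N -> b j = 0%N) ->
  partials b f = iter (b i) (partial i)
    (foldr (fun i => iter (b i) (partial i)) f (drop i.+1 (enum 'I_d))).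
Proof.
move=> b0; rewrite /partials -{1}(cat_take_drop i (enum 'I_d)) foldr_cat.
rewrite (drop_nth i) ?size_enum_ord// nth_ord_enum /=.
set g := iter _ _ _.
have : forall j, j \in take i (enum 'I_d) -> b j = 0%N.
  move=> j /(nthP i)[k]; rewrite size_take size_enum_ord ltn_ord => ki <-.
  have kd : (k < d)%N by apply: ltn_trans ki _.
  by apply: b0; rewrite nth_take// nth_enum_ord.
by elim: (take _ _) => [//|j l IH] jl /=; rewrite IH ?jl ?mem_head// => k kl; rewrite jl// inE kl orbT.
Qed.

(** Raising the first possibly nonzero exponent adds one outermost derivative. *)
Lemma partials_incr j k a (f : Rd -> R[i]) (jd : (j < d)%N) :
  partials (mindex_of_seq (nseq j 0%N ++ k.+1 :: a)) f =
  partial (Ordinal jd) (partials (mindex_of_seq (nseq j 0%N ++ k :: a)) f).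
Proof.
have z m (i : 'I_d) : (i < Ordinal jd)%N -> mindex_of_seq (nseq j 0%N ++ m :: a) i = 0%N.
  by move=> /= ij; rewrite ffunE nth_cat size_nseq ij nth_nseq ij.
have e m : mindex_of_seq (nseq j 0%N ++ m :: a) (Ordinal jd) = m.
  by rewrite ffunE nth_cat size_nseq ltnn subnn.
rewrite !(partials_tail _ (z _)) !e iterS; congr (partial _ (iter _ _ _)).
have : forall i, i \in drop (Ordinal jd).+1 (enum 'I_d) ->
   mindex_of_seq (nseq j 0%N ++ k.+1 :: a) i = mindex_of_seq (nseq j 0%N ++ k :: a) i.
  move=> i /(nthP (Ordinal jd))[m]; rewrite size_drop size_enum_ord => md <-.
  rewrite !ffunE !nth_cat !size_nseq nth_drop nth_enum_ord; last by rewrite -ltn_subRL.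
  have -> : ((Ordinal jd).+1 + m < j)%N = false by apply/negbTE; rewrite -leqNgt /=; lia.
  by rewrite /= (_ : (j.+1 + m - j)%N = m.+1)//; lia.
by elim: (drop _ _) => [//|i l IH] il /=; rewrite IH ?il ?mem_head// => m ml; rewrite il// inE ml orbT.
Qed.

Lemma rcons_nseq T m (x : T) l : nseq m x ++ x :: l = nseq m.+1 x ++ l.
Proof. by elim: m => [//|m IH] /=; rewrite IH. Qed.

Lemma Rd_of_seq_line j (x h : R) s (jd : (j < d)%N) :
  Rd_of_seq (nseq j 0 ++ (h + x) :: s) =
  h *: delta_mx 0 (Ordinal jd) + Rd_of_seq (nseq j 0 ++ x :: s).
Proof.
apply/rowP => i; rewrite !mxE eqxx /= !nth_cat !size_nseq -val_eqE /=.
have [ij|ji|ij] := ltngtP i j.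
- by rewrite mulr0 add0r.
- by rewrite mulr0 add0r -(subnSK ji).
- by rewrite ij subnn mulr1.
Qed.

Section Chain.
(* [pr] is the real or the imaginary part. *)
Variables (pr : R[i] -> R) (phi : Rd -> R[i]).
Hypothesis pr_partial : forall a i x,
  let g : Rd -> R^o := fun x => pr (partials a phi x) in
  derivable g x (delta_mx 0 i) /\
  pr (partial i (partials a phi) x) = 'D_(delta_mx 0 i) g x.

Definition jetRd (a : seq nat) (s : seq R) : R := pr (partials (mindex_of_seq a) phi (Rd_of_seq s)).

(** [j] coordinates have been frozen at 0 with exponent 0; the next derivative to be
    raised is then the outermost one. *)
Lemma chain_jetRd n j : (n + j)%N = d ->
  chain (fun a (t : n.-tuple RR) => jetRd (nseq j 0%N ++ a) (nseq j 0 ++ t)).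
Proof.
elim: n j => [//|n IH] j nj /=; split; last first.
  rewrite (_ : (fun _ _ => _) = fun a (t : n.-tuple RR) => jetRd (nseq j.+1 0%N ++ a) (nseq j.+1 0 ++ t)).
    by apply: IH; rewrite addnS.
  by apply/funext => a; apply/funext => t; rewrite !rcons_nseq.
move=> a t k x.
have jd : (j < d)%N by rewrite -nj addSn ltnS leq_addl.
rewrite /jetRd (partials_incr _ _ _ jd).
have [d1 ->] := pr_partial (mindex_of_seq (nseq j 0%N ++ k :: a)) (Ordinal jd) (Rd_of_seq (nseq j 0 ++ x :: t)).
apply: is_derive_line d1 => h.
by rewrite -Rd_of_seq_line.
Qed.

End Chain.

End Lines.

(** * Tensor products of jets *)

Section Tensor.
Context {R : realType} {d : nat}.
Local Notation Rd := 'rV[R]_d.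
Variable G : nat -> R -> R.
Hypothesis jG : jet G.

Definition tensor (m : 'I_d -> nat) : Rd -> R[i] :=
  fun x => (\prod_i G (m i) (x 0 i))%:C%C.

Lemma continuous_jet k : continuous (G k).
Proof.
exact: is_derive_continuous (jG k).
Qed.

Lemma rpart_tensor m : rpart (tensor m) = fun x => \prod_i G (m i) (x 0 i).
Proof. by apply/funext => x; rewrite /rpart. Qed.

Lemma ipart_tensor m : ipart (tensor m) = cst (0 : R^o).
Proof. by apply/funext => x; rewrite /ipart. Qed.

Lemma continuous_tensor m : continuous (rpart (tensor m)).
Proof.
rewrite (_ : rpart _ = (\prod_i (fun x : Rd => G (m i) (x 0 i) : R^o)) :> (Rd -> R^o)); last first.
  by rewrite rpart_tensor; apply/funext => x; rewrite fct_prodE.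
move=> x; elim/big_rec : _ => [|i g _ cg]; first exact: cst_continuous.
have cx : (fun y : Rd => G (m i) (y 0 i) : R^o) @ x --> (G (m i) (x 0 i) : R^o).
  apply: (@continuous_comp _ _ _ (fun y : Rd => y 0 i : R^o) (G (m i) : R^o -> R^o)).
    exact: coord_continuous.
  exact: continuous_jet.
exact: (cvgM cx cg).
Qed.

Lemma derivable_tensor m (i : 'I_d) x :
  derivable (rpart (tensor m)) x (delta_mx 0 i) /\
  'D_(delta_mx 0 i) (rpart (tensor m)) x =
    rpart (tensor (fun j => m j + (j == i))%N) x.
Proof.
rewrite rpart_tensor.
pose c := \prod_(j | j != i) G (m j) (x 0 j).
apply: (derivable_line (g := fun y => G (m i) y * c) (y := x 0 i)).
  move=> h; rewrite (bigD1 i)//= !mxE !eqxx mulr1; congr (_ * _).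
  by apply: eq_bigr => j ji; rewrite !mxE (negbTE ji) andbF mulr0 add0r.
rewrite rpart_tensor (bigD1 i)//= eqxx addn1.
have -> : \prod_(j < d | j != i) G (m j + (j == i))%N (x 0 j) = c.
  by apply: eq_bigr => j ji; rewrite (negbTE ji) addn0.
have H := jG (m i) (x 0 i).
rewrite (_ : (fun y => G (m i) y * c) = (fun y : R => c * G (m i) y)); last by apply/funext => y; rewrite mulrC.
by apply: (is_derive_eq (is_deriveM (is_derive_cst (c:R) (x 0 i) 1) H)); rewrite scaler0 addr0 mulrC.
Qed.

(** Differentiating a tensor product raises one exponent, so any word of partial
    derivatives only counts its letters. *)
Lemma foldr_partial_tensor (w : seq 'I_d) :
  foldr (@partial R d) (tensor (fun=> 0%N)) w = tensor (fun i => count_mem i w).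
Proof.
elim: w => [|i w /= ->]; first by [].
apply/funext => x; rewrite /partial (derivable_tensor _ i x).2 ipart_tensor derive_cst /tensor /=.
congr (_%:C)%C; rewrite rpart_tensor; apply: eq_bigr => j _.
by rewrite addnC eq_sym.
Qed.

Lemma smooth_tensor : smooth (tensor (fun=> 0%N)).
Proof.
move=> w; rewrite /= foldr_partial_tensor; split; first exact: continuous_tensor.
  by rewrite ipart_tensor; exact: cst_continuous.
move=> i x; split; first exact: (derivable_tensor _ i x).1.
by rewrite ipart_tensor; exact: derivable_cst.
Qed.

Lemma normc_Dop_tensor (a : mindex d) x :
  Normc.normc (Dop a (tensor (fun=> 0%N)) x) = `|\prod_i G (a i) (x 0 i)|.
Proof.
rewrite normc_Dop partials_word foldr_partial_tensor normc_real.
by under eq_bigr do rewrite count_word.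
Qed.

Lemma prod_superM (N : nat -> R) (a : mindex d) : N 0%N = 1 -> (forall p, 0 < N p) ->
  (forall p q, N p * N q <= N (p + q)%N) -> \prod_i N (a i) <= N (mlen a).
Proof.
move=> N0 Np NM; rewrite /mlen.
elim/big_rec2 : _ => [|i p q _ H]; first by rewrite N0.
apply: le_trans (NM _ _); rewrite ler_wpM2l// ltW//.
Qed.

Lemma enorm_le (x : Rd) : enorm x <= \sum_i `|x 0 i|.
Proof.
have S0 : 0 <= \sum_i `|x 0 i| by apply: sumr_ge0.
rewrite /enorm -(ger0_norm S0) -sqrtr_sqr ler_wsqrtr//.
rewrite expr2 mulr_suml; apply: ler_sum => i _.
rewrite -real_normK ?num_real// expr2 ler_wpM2l// (bigD1 i)//= lerDl.
exact: sumr_ge0.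
Qed.

Variables (N : nat -> R) (C kappa c1 : R) (W : Rd -> \bar R).
Hypotheses (N0 : N 0%N = 1) (N_gt0 : forall p, 0 < N p)
  (N_superM : forall p q, N p * N q <= N (p + q)%N)
  (C_ge0 : 0 <= C) (kappa_ge0 : 0 <= kappa) (c1_ge0 : 0 <= c1)
  (G_le : forall k x, `|G k x| <= C * N k * expR (- (kappa * `|x|)))
  (W_le : forall x, (0 <= W x <= (c1 * expR (kappa * enorm x))%:E)%E).

(** [N] is supermultiplicative, so the bounds on the factors multiply to a bound
    with [N (mlen a)], and [enorm x <= sum_i |x_i|] lets the exponentials absorb
    the weight. *)
Lemma LooRd_tensor (a : mindex d) :
  (LooRd (fun x => W x * (Normc.normc (Dop a (tensor (fun=> 0%N)) x))%:E)
    <= (c1 * C ^+ d * N (mlen a))%:E)%E.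
Proof.
apply: LooRd_le => x; rewrite normc_Dop_tensor.
have /andP[W0 W1] := W_le x.
rewrite mule_ge0//=.
have H : `|\prod_i G (a i) (x 0 i)| <= C ^+ d * N (mlen a) * expR (- (kappa * \sum_i `|x 0 i|)).
  rewrite normr_prod.
  apply: (@le_trans _ _ (\prod_i (C * N (a i) * expR (- (kappa * `|x 0 i|))))).
    by apply: ler_prod => i _; rewrite normr_ge0 G_le.
  rewrite !big_split /= prodr_const card_ord -expR_sum sumrN -mulr_sumr.
  by rewrite ler_wpM2r ?expR_ge0// ler_wpM2l ?exprn_ge0// prod_superM.
apply: (@le_trans _ _ ((c1 * expR (kappa * enorm x))%:E *
    (C ^+ d * N (mlen a) * expR (- (kappa * \sum_i `|x 0 i|)))%:E)%E).
  by apply: lee_pmul => //; rewrite lee_fin.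
rewrite -EFinM lee_fin.
have -> : c1 * expR (kappa * enorm x) * (C ^+ d * N (mlen a) * expR (- (kappa * \sum_i `|x 0 i|))) =
  c1 * C ^+ d * N (mlen a) * expR (kappa * enorm x - kappa * \sum_i `|x 0 i|).
  by rewrite expRD; ring.
rewrite ler_piMr// ?mulr_ge0 ?exprn_ge0// ?(ltW (N_gt0 _))//.
by rewrite -(@expR0 R) ler_expR subr_le0 ler_wpM2l// enorm_le.
Qed.

End Tensor.

Lemma expR_ge_term {R : realType} (x : R) n : 0 <= x -> x ^+ n / n`!%:R <= expR x.
Proof.
move=> x0; have -> : expR x = limn (series (exp_coeff x)) by rewrite expRE exp_coeffE.
apply: (@le_trans _ _ (series (exp_coeff x) n.+1)).
  rewrite seriesEnat /= big_nat_recr//= lerDr; apply: sumr_ge0 => i _; exact: exp_coeff_ge0.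
apply: nondecreasing_cvgn_le; last exact: is_cvg_series_exp_coeff.
by apply/nondecreasing_series => i _ _; exact: exp_coeff_ge0.
Qed.

(** By (M.6), [rho^p / A' p] is at most [c0 (L0 rho / r)^p / p!], a term of the
    exponential series. *)
Lemma expeR_assoc_M6 {R : realType} (A A' : nat -> R) (c0 L0 r rho : R) :
  (forall p, 0 < A p) -> 1 <= c0 -> 1 <= L0 ->
  (forall p, p`!%:R <= c0 * L0 ^+ p * A p) -> 0 < r ->
  (forall p, A p * r ^+ p <= A' p) -> 0 <= rho ->
  (0 <= expeR (assoc_fun A' rho) <= (c0 * expR (L0 / r * rho))%:E)%E.
Proof.
move=> A0 c1 L1 M6 r0 AA rho0; rewrite expeR_ge0/=.
have L00 : 0 < L0 by apply: lt_le_trans L1.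
have c00 : 0 < c0 by apply: lt_le_trans c1.
have e0 : 0 <= L0 / r * rho by rewrite mulr_ge0// divr_ge0// ltW.
apply: expeR_assoc_le => //.
- by move=> q; apply: lt_le_trans (AA q); rewrite mulr_gt0// exprn_gt0.
- move=> p; have := expR_ge_term p e0; move: (expR _) (expR_ge0 (L0 / r * rho)) => E E0 pE.
  have f0 : 0 < p`!%:R :> R by rewrite ltr0n fact_gt0.
  have A'0 : 0 < A' p by apply: lt_le_trans (AA p); rewrite mulr_gt0// exprn_gt0.
  apply: (@le_trans _ _ (rho ^+ p / (A p * r ^+ p))).
    by rewrite ler_wpM2l ?exprn_ge0// lef_pV2// posrE// mulr_gt0// exprn_gt0.
  have rp : 0 < r ^+ p by rewrite exprn_gt0.
  move: pE; rewrite ler_pdivrMr// exprMn expr_div_n => pE.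
  rewrite ler_pdivrMr; last by rewrite mulr_gt0.
  have Lp : 0 < L0 ^+ p by rewrite exprn_gt0.
  rewrite -(ler_pM2l Lp).
  have H1 : L0 ^+ p * rho ^+ p <= E * p`!%:R * r ^+ p.
    by rewrite -ler_pdivrMr//; move: pE; rewrite mulrAC.
  apply: (le_trans H1).
  have -> : L0 ^+ p * (c0 * E * (A p * r ^+ p)) = E * (c0 * L0 ^+ p * A p) * r ^+ p by ring.
  by rewrite ler_wpM2r ?(ltW rp)// ler_wpM2l.
- by rewrite -[1]mulr1; apply: ler_pM => //; rewrite -(@expR0 R) ler_expR.
Qed.

(** * Sums over shells of multi-indices *)

Section Shells.
Context {R : realType} {d : nat}.
Implicit Types (u : mindex d -> R) (a : mindex d).

Definition mindex_of_box K (b : {ffun 'I_d -> 'I_K}) : mindex d := [ffun i => nat_of_ord (b i)].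

Definition seq_of_mindex a : seq nat := [seq a i | i <- enum 'I_d].

Lemma size_of_mindex a : size (seq_of_mindex a) = d.
Proof. by rewrite size_map size_enum_ord. Qed.

Lemma mindex_of_seqK a : mindex_of_seq (seq_of_mindex a) = a.
Proof.
apply/ffunP => i; rewrite ffunE (nth_map i) ?size_enum_ord//.
by rewrite nth_ord_enum.
Qed.

Lemma sumn_of_mindex a : sumn (seq_of_mindex a) = mlen a.
Proof. by rewrite -(@mlen_of_seq d) ?size_of_mindex// mindex_of_seqK. Qed.

Lemma mlen_of_box K (b : {ffun 'I_d -> 'I_K}) : mlen (mindex_of_box b) = (\sum_i b i)%N.
Proof. by rewrite /mlen; apply: eq_bigr => i _; rewrite ffunE. Qed.

Lemma sum_ffun34_le K : \sum_(b : {ffun 'I_d -> 'I_K}) (3 / 4 : R) ^+ mlen (mindex_of_box b) <= 4 ^+ d.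
Proof.
under eq_bigr do rewrite mlen_of_box -prodrXr.
rewrite -(bigA_distr_bigA (fun (i : 'I_d) (k : 'I_K) => (3 / 4 : R) ^+ k)).
rewrite -[X in _ ^+ X]card_ord -prodr_const.
apply: ler_prod => i _; apply/andP; split; last first.
  have g := @geo_ord_le R (3 / 4) K; rewrite (_ : (1 - 3 / 4)^-1 = 4 :> R) in g; last by field.
  by apply: g; lra.
by apply: sumr_ge0 => k _; rewrite exprn_ge0// divr_ge0.
Qed.

(** [2^-n = (2/3)^n (3/4)^n]: the first factor is small on large multi-indices and
    the second one is summable over all multi-indices, with sum [4^d]. *)
Lemma sum_tail K N u E (P : pred {ffun 'I_d -> 'I_K}) :
  (forall a, `|u a| <= E * 2^-1 ^+ mlen a) ->
  (forall b, P b -> (N <= mlen (mindex_of_box b))%N) ->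
  `|\sum_(b : {ffun 'I_d -> 'I_K} | P b) u (mindex_of_box b)| <= E * 4 ^+ d * (2 / 3) ^+ N.
Proof.
move=> uE PN.
have E0 : 0 <= E.
  have := uE [ffun=> 0%N]; rewrite /mlen big1 ?expr0 ?mulr1; first exact: le_trans.
  by move=> i _; rewrite ffunE.
apply: (le_trans (ler_norm_sum _ _ _)).
apply: (@le_trans _ _ (\sum_(b | P b) E * (2 / 3) ^+ N * (3 / 4) ^+ mlen (mindex_of_box b))).
  apply: ler_sum => b Pb; apply: (le_trans (uE _)).
  rewrite -mulrA ler_wpM2l// (_ : 2^-1 = 2 / 3 * (3 / 4) :> R); last by field.
  rewrite exprMn ler_wpM2r ?exprn_ge0 ?divr_ge0//.
  by rewrite ler_wiXn2l ?PN// ?divr_ge0//; lra.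
rewrite -mulr_sumr [leRHS]mulrAC ler_wpM2l ?mulr_ge0 ?exprn_ge0 ?divr_ge0//.
apply: le_trans (sum_ffun34_le K); rewrite [leRHS](bigID P)/= lerDl.
by apply: sumr_ge0 => b _; rewrite exprn_ge0// divr_ge0.
Qed.

Definition rshell u (n : nat) : R :=
  \sum_(b : {ffun 'I_d -> 'I_n.+1} | (\sum_i b i == n)%N) u (mindex_of_box b).

Lemma rshell_le u E n : (forall a, `|u a| <= E * 2^-1 ^+ mlen a) ->
  `|rshell u n| <= E * 4 ^+ d * (2 / 3) ^+ n.
Proof. by move=> uE; apply: sum_tail => // b /eqP; rewrite mlen_of_box => ->. Qed.

Lemma rshell_widen u n N : (n < N)%N ->
  rshell u n = \sum_(b : {ffun 'I_d -> 'I_N} | (\sum_i b i == n)%N) u (mindex_of_box b).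
Proof.
move=> nN; have w (k : 'I_n.+1) : (k < N)%N by apply: leq_trans nN; exact: ltn_ord.
pose h (b : {ffun 'I_d -> 'I_n.+1}) : {ffun 'I_d -> 'I_N} := [ffun i => Ordinal (w (b i))].
pose h' (b : {ffun 'I_d -> 'I_N}) : {ffun 'I_d -> 'I_n.+1} := [ffun i => inord (b i)].
rewrite (reindex_onto h h')/=; last first.
  move=> b /eqP bn; apply/ffunP => i; rewrite !ffunE; apply/val_inj => /=.
  by rewrite inordK// ltnS -bn (bigD1 i)//= leq_addr.
apply: eq_big => b; last first.
  by move=> _; congr u; apply/ffunP => i; rewrite !ffunE.
have -> : h' (h b) == b by apply/eqP/ffunP => i; rewrite !ffunE; exact: inord_val.
by rewrite andbT; congr (_ == _); apply: eq_bigr => i _; rewrite ffunE.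
Qed.

(** The shells of order less than [N] fill the part of the box where the order is
    less than [N]; the rest of the box is a tail. *)
Lemma rshell_box u E N : (forall a, `|u a| <= E * 2^-1 ^+ mlen a) ->
  `|\sum_(0 <= n < N) rshell u n - \sum_(b : {ffun 'I_d -> 'I_N}) u (mindex_of_box b)|
    <= E * 4 ^+ d * (2 / 3) ^+ N.
Proof.
move=> uE.
have -> : \sum_(0 <= n < N) rshell u n =
    \sum_(b : {ffun 'I_d -> 'I_N} | (\sum_i b i < N)%N) u (mindex_of_box b).
  rewrite big_mkord; under eq_bigr => n _ do rewrite (rshell_widen u (ltn_ord n)).
  rewrite (exchange_big_dep (fun b : {ffun 'I_d -> 'I_N} => (\sum_i b i < N)%N))/=.
    apply: eq_bigr => b bN; rewrite (big_pred1 (Ordinal bN))// => n.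
  by move=> n b _ /eqP ->.
rewrite [X in _ - X](bigID (fun b : {ffun 'I_d -> 'I_N} => (\sum_i b i < N)%N))/=.
rewrite opprD addrA subrr add0r normrN.
by apply: sum_tail => // b; rewrite -leqNgt mlen_of_box.
Qed.

Lemma cvg_geo23 (E : R) : E * (2 / 3) ^+ n @[n --> \oo] --> (0 : R).
Proof.
rewrite -[X in _ --> X](mulr0 E); apply: cvgM; first exact: cvg_cst.
by apply: cvg_expr; rewrite ger0_norm ?divr_ge0//; lra.
Qed.

Lemma rshell_sum_le u E N : (forall a, `|u a| <= E * 2^-1 ^+ mlen a) ->
  `|\sum_(0 <= n < N) rshell u n| <= E * 4 ^+ d * 3.
Proof.
move=> uE; apply: (le_trans (ler_norm_sum _ _ _)).
have E0 : 0 <= E * 4 ^+ d.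
  by have := rshell_le 0 uE; rewrite expr0 mulr1; exact: le_trans.
apply: (@le_trans _ _ (\sum_(0 <= n < N) E * 4 ^+ d * (2 / 3) ^+ n)).
  by apply: ler_sum => n _; exact: rshell_le.
rewrite -mulr_sumr ler_wpM2l// big_mkord.
have g := @geo_ord_le R (2 / 3) N; rewrite (_ : (1 - 2 / 3)^-1 = 3 :> R) in g; last by field.
by apply: g; lra.
Qed.

Lemma rshell_cvg u E : (forall a, `|u a| <= E * 2^-1 ^+ mlen a) ->
  cvgn (fun N => \sum_(0 <= n < N) rshell u n : R^o).
Proof.
move=> uE; apply: (@normed_cvg R R^o).
apply: (@series_le_cvg _ _ (fun n => E * 4 ^+ d * (2 / 3) ^+ n)) => //.
- by move=> n /=.
- by move=> n; apply: le_trans (rshell_le n uE).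
- by move=> n; exact: rshell_le.
- apply: (@is_cvg_geometric_series _ (E * 4 ^+ d) (2 / 3)).
  by rewrite ger0_norm ?divr_ge0//; lra.
Qed.

Lemma cvg_geo_dist (E : R) (s : nat -> R) l : (forall n, `|s n - l| <= E * (2 / 3) ^+ n) ->
  s n @[n --> \oo] --> l.
Proof.
move=> sE; apply/cvgrPdist_le => e e0.
near=> n; rewrite distrC; apply: (le_trans (sE n)).
rewrite (le_trans (ler_norm _))//.
by near: n; move: e e0; apply/cvgr0Pnorm_le; exact: cvg_geo23.
Unshelve. all: by end_near. Qed.

End Shells.

(** A function on [n + 1] points is its value at the first point together with its
    restriction to the others. *)
Lemma boxsum_ffun {R : realType} n K (J : seq nat -> R) :
  boxsum n K J = \sum_(b : {ffun 'I_n -> 'I_K}) J (seq_of_mindex (mindex_of_box b)).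
Proof.
elim: n J => [|n IH] J /=.
  have x0 : 'I_0 -> 'I_K by case.
  have e b : seq_of_mindex (@mindex_of_box 0 K b) = [::] by apply: size0nil; rewrite size_of_mindex.
  rewrite (big_pred1 [ffun i => x0 i]); first by rewrite e.
  by move=> b /=; apply/esym/eqP/ffunP => -[].
under eq_bigr => k _ do rewrite IH.
rewrite pair_big/=.
pose h (p : 'I_K * {ffun 'I_n -> 'I_K}) : {ffun 'I_n.+1 -> 'I_K} :=
  [ffun i => if unlift ord0 i is Some j then p.2 j else p.1].
pose h' (b : {ffun 'I_n.+1 -> 'I_K}) := (b ord0, [ffun j => b (lift ord0 j)] : {ffun 'I_n -> 'I_K}).
rewrite [RHS](reindex h)/=; last first.
  exists h' => [[k b] _|b _].
    rewrite /h/h' ffunE unlift_none; congr pair.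
    by apply/ffunP => j; rewrite !ffunE liftK.
  by apply/ffunP => i; rewrite !ffunE; case: unliftP => [j ->|->]; rewrite ?ffunE.
apply: eq_bigr => -[k b] _ /=; congr J.
rewrite /seq_of_mindex enum_ordSl /= !ffunE unlift_none /=; congr cons.
rewrite -map_comp; apply: eq_map => j /=.
by rewrite !ffunE liftK.
Qed.

Section ShellIdentity.
Context {R : realType} {d : nat}.
Local Notation RR := (measurableTypeR R).
Variables (G : R -> R) (c : nat -> R) (CG : R) (F : seq nat -> d.-tuple RR -> R) (B E : R).
Hypothesis G_cont : continuous G.
Hypothesis G_le : forall x, `|G x| <= CG.
Hypothesis CG_ge0 : 0 <= CG.
Hypothesis aF : admissible c F B.
Hypothesis box : forall K,
  `|boxsum d K (coefint G c F) - F (nseq d 0%N) (nseq_tuple d 0)| <= E * B * 2^-1 ^+ K.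

Let v (t : d.-tuple RR) (a : mindex d) : R := sprod (symb c) (seq_of_mindex a) * F (seq_of_mindex a) t.
Let W := @wgt_mass R.

(** Dominated convergence exchanges the integral with the limit over shells; the
    shells of integrals are compared with box sums, whose limit is known. *)
Lemma shell_identity :
  \int[lebesgueRn R d]_t (tensor_tuple G t * limn (fun N => \sum_(0 <= n < N) rshell (v t) n : R^o)) =
  F (nseq d 0%N) (nseq_tuple d 0).
Proof.
have B0 := admissible_ge0 aF.
have vB t a : `|v t a| <= B * wgtn t * 2^-1 ^+ mlen a.
  rewrite /v normrM norm_sprod_symb -normrM -sumn_of_mindex.
  by apply: (le_trans (adm_bound aF t (size_of_mindex a))); rewrite mulrAC.
have cJ a : coefint G c F (seq_of_mindex a) = \int[@leb R d]_t (tensor_tuple G t * v t a).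
  rewrite /coefint /v -RintegralZl//.
    by apply: eq_Rintegral => t _; rewrite mulrCA.
  have [C FC] := adm_dom aF (seq_of_mindex a).
  apply: (@dominated_integrable_wgtn _ _ _ (CG ^+ d * C)).
    by apply: measurable_funM; [exact: measurable_tensor_tuple|exact: (adm_meas aF)].
  by move=> t; rewrite normrM -mulrA ler_pM// tensor_tuple_le.
have mv a : measurable_fun setT (fun t => v t a).
  by apply: measurable_funM => //; exact: (adm_meas aF).
have JB (a : mindex d) : `|coefint G c F (seq_of_mindex a)| <= (CG ^+ d * B * W ^+ d) * 2^-1 ^+ mlen a.
  rewrite cJ mulrAC; apply: Rintegral_le_wgtn.
    by apply: measurable_funM; [exact: measurable_tensor_tuple|exact: mv].
  move=> t; rewrite normrM -!mulrA; apply: ler_pM => //; first exact: tensor_tuple_le.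
  by apply: (le_trans (vB t a)); rewrite mulrAC mulrA.
pose j (a : mindex d) := coefint G c F (seq_of_mindex a).
pose S t N := \sum_(0 <= n < N) rshell (v t) n.
have H1 : (\int[@leb R d]_t (tensor_tuple G t * S t N)) @[N --> \oo] -->
    \int[@leb R d]_t (tensor_tuple G t * limn (S t : nat -> R^o)).
  apply: (@dominated_Rintegral_cvg _ _ _ _ _ _ (fun t => (CG ^+ d * (B * 4 ^+ d * 3)) * wgtn t)).
  - move=> N; apply: measurable_funM; first exact: measurable_tensor_tuple.
    apply: measurable_sum => n; rewrite /rshell.
    rewrite (_ : (fun _ => _) = (fun t => \sum_(b <- [seq b <- index_enum _ | (\sum_i (b : {ffun 'I_d -> 'I_n.+1}) i == n)%N]) v t (mindex_of_box b))); last first.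
      by apply/funext => t; rewrite big_filter.
    by apply: measurable_sum => b; exact: mv.
  - by apply: integrable_realZ; exact: integrable_wgtn.
  - move=> N t; rewrite normrM -mulrA; apply: ler_pM => //; first exact: tensor_tuple_le.
    apply: (le_trans (rshell_sum_le N (vB t))); apply: eq_ler; ring.
  - move=> t; apply: cvgM; first exact: cvg_cst.
    exact: (rshell_cvg (vB t)).
have H2 N : \int[@leb R d]_t (tensor_tuple G t * S t N) = \sum_(0 <= n < N) rshell j n.
  have Iv a : (@leb R d).-integrable setT (EFin \o (fun t => tensor_tuple G t * v t a)).
    apply: (@dominated_integrable_wgtn _ _ _ (CG ^+ d * (B * 2^-1 ^+ mlen a))).
      by apply: measurable_funM; [exact: measurable_tensor_tuple|exact: mv].
    move=> t; rewrite normrM -mulrA; apply: ler_pM => //; first exact: tensor_tuple_le.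
    by apply: (le_trans (vB t a)); rewrite mulrAC.
  have E1 n := Rintegral_sum_seq [seq b <- index_enum _ | (\sum_i (b : {ffun 'I_d -> 'I_n.+1}) i == n)%N] (fun b => Iv (mindex_of_box b)).
  have E2 t : tensor_tuple G t * S t N = \sum_(n <- index_iota 0 N) \sum_(b <- [seq b <- index_enum _ | (\sum_i (b : {ffun 'I_d -> 'I_n.+1}) i == n)%N]) tensor_tuple G t * v t (mindex_of_box b).
    by rewrite /S mulr_sumr; apply: eq_bigr => n _; rewrite big_filter /rshell mulr_sumr.
  rewrite (funext E2).
  rewrite (Rintegral_sum_seq (index_iota 0 N) (fun n => (E1 n).1)).2.
  apply: eq_bigr => n _; rewrite (E1 n).2 big_filter /rshell; apply: eq_bigr => b _.
  by rewrite /j cJ.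
have H3 : \sum_(0 <= n < N) rshell j n @[N --> \oo] --> F (nseq d 0%N) (nseq_tuple d 0).
  apply: (@cvg_geo_dist R (CG ^+ d * B * W ^+ d * 4 ^+ d + E * B)) => N.
  have EB : 0 <= E * B by have := box 0; rewrite expr0 mulr1; exact: le_trans.
  rewrite -(subrK (boxsum d N (coefint G c F)) (\sum_(0 <= n < N) rshell j n)) -addrA.
  apply: (le_trans (ler_normD _ _)); rewrite mulrDl; apply: lerD.
    by rewrite boxsum_ffun; exact: (rshell_box N JB).
  apply: (le_trans (box N)); rewrite ler_wpM2l//.
  by apply: ler_pow; lra.
transitivity (\int[@leb R d]_t (tensor_tuple G t * limn (S t : nat -> R^o))).
  by rewrite /Rintegral (eq_measure_integral (@leb R d)).
rewrite -(cvg_lim _ H1)//.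
by under eq_fun do rewrite H2; rewrite (cvg_lim _ H3).
Qed.
End ShellIdentity.

(** * Duality with test functions *)

Lemma eq_limn {R : realType} (f g : nat -> R^o) : f = g -> limn f = limn g.
Proof. by move=> ->. Qed.

Section Duality.
Context {R : realType} {d : nat}.
Local Notation Rd := 'rV[R]_d.
Variables (M : nat -> R) (G : nat -> R -> R) (c : nat -> R) (CG D : R).
Hypothesis M_gt0 : forall p, 0 < M p.
Hypothesis jG : jet G.
Hypothesis G_le : forall x, `|G 0%N x| <= CG.
Hypothesis CG_ge0 : 0 <= CG.
Hypothesis D_ge0 : 0 <= D.
Hypothesis c0 : c 0%N = 1.
Hypothesis c_ge0 : forall m, 0 <= c m.
Hypothesis c_odd : forall m, odd m -> c m = 0.
Hypothesis G_fund : delta_rate (G 0%N) c D.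

Definition tensor_coef (a : mindex d) : R[i] := (\prod_i c (a i))%:C%C.

Lemma normc_tensor_coef a : Normc.normc (tensor_coef a) = \prod_i c (a i).
Proof. by rewrite /tensor_coef normc_real ger0_norm// prodr_ge0. Qed.

(** The signs [(-1)^|a|] of the transpose and [(- i)^|a|] of [D^a] combine to
    [i^|a|], which is real on the even multi-indices that carry nonzero
    coefficients. *)
Lemma symb_term (phi : Rd -> R[i]) a x :
  udo_opp tensor_coef a * Dop a phi x = (\prod_i symb c (a i))%:C%C * partials a phi x.
Proof.
rewrite /udo_opp /Dop mulrA; congr (_ * _); rewrite mulrAC -exprMn mulN1r opprK.
rewrite /mlen -prodrXr /tensor_coef !rmorph_prod -big_split/=; apply: eq_bigr => i _.
rewrite /symb; have [/c_odd ->|e] := boolP (odd (a i)); first by rewrite !mulr0.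
rewrite rmorphM rmorphXn rmorphN1; congr (_ * _).
by rewrite -{1}(odd_double_half (a i)) (negbTE e) add0n -muln2 mulnC exprM sqr_i.
Qed.

Variables (phi : Rd -> R[i]) (Ca Cp h : R).
Hypothesis sphi : smooth phi.
Hypothesis h_gt0 : 0 < h.
Hypothesis c_le : forall a : mindex d,
  \prod_i c (a i) <= Ca * (h / 2) ^+ mlen a / M (mlen a).

Section Part.
Variable pr : R[i] -> R.
Hypothesis pr_cont : forall a, continuous (fun x => pr (partials a phi x) : R^o).
Hypothesis pr_partial : forall a i x,
  let g : Rd -> R^o := fun x => pr (partials a phi x) in
  derivable g x (delta_mx 0 i) /\
  pr (partial i (partials a phi) x) = 'D_(delta_mx 0 i) g x.
Hypothesis pr_le : forall a x, `|pr (partials a phi x)| <=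
  Cp * (M (mlen a) / h ^+ mlen a) * \prod_(i < d) wgt (x 0 i).

Let F (a : seq nat) (t : d.-tuple (measurableTypeR R)) : R := jetRd pr phi a t.

Let wgtn_Rd (t : d.-tuple (measurableTypeR R)) :
  \prod_(i < d) wgt ((Rd_of_tuple t : Rd) ord0 i) = wgtn t.
Proof. by apply: eq_bigr => i _; rewrite mxE. Qed.

Let FE a t : F a t = pr (partials (mindex_of_seq a) phi (Rd_of_tuple t)).
Proof. by rewrite /F /jetRd Rd_of_seq_tuple. Qed.

Lemma admissible_jetRd : admissible c F (Ca * Cp).
Proof.
split.
- exact: (chain_jetRd pr_partial (addn0 d)).
- by move=> a; have := measurable_continuous_Rd (@pr_cont (mindex_of_seq a)); apply: eq_measurable_fun => t _; rewrite FE.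
- by move=> a; eexists => t; rewrite FE -wgtn_Rd; exact: pr_le.
- move=> a t sa; rewrite FE normrM (sprod_of_seq c sa) ger0_norm ?prodr_ge0//.
  apply: (le_trans (ler_pM _ _ (c_le (mindex_of_seq a)) (pr_le (mindex_of_seq a) _))) => //.
    exact: prodr_ge0.
  rewrite wgtn_Rd mlen_of_seq// le_eqVlt; apply/orP; left; apply/eqP.
  rewrite expr_div_n exprVn; have := M_gt0 (sumn a) => /lt0r_neq0 ?.
  have : h ^+ sumn a != 0 by rewrite expf_neq0// gt_eqF.
  have : (2 : R) ^+ sumn a != 0 by rewrite expf_neq0// pnatr_eq0.
  by move=> ? ?; field; rewrite ?andbT; repeat (apply/andP; split).
Qed.

Hypothesis prD : forall z w, pr (z + w) = pr z + pr w.
Hypothesis pr0 : pr 0 = 0.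
Hypothesis prZ : forall (u : R) z, pr (u%:C%C * z) = u * pr z.
Hypothesis pr_lim : forall x, pr (udo (udo_opp tensor_coef) phi x) =
  limn (fun N => \sum_(0 <= n < N)
    pr (shell (fun a => udo_opp tensor_coef a * Dop a phi x) n) : R^o).

Lemma dual_part :
  \int[lebesgueRn R d]_t pr (tensor G (fun=> 0%N) (Rd_of_tuple t) *
    udo (udo_opp tensor_coef) phi (Rd_of_tuple t)) = pr (phi 0).
Proof.
have [E E0 box] := box_identity (continuous_jet jG (k := 0)) G_le CG_ge0 D_ge0 c0 G_fund d.
have aF := admissible_jetRd.
have := shell_identity (continuous_jet jG (k := 0)) G_le aF (fun K => box F (Ca * Cp) K aF).
rewrite [RHS]/F /jetRd.
have -> : mindex_of_seq (nseq d 0%N) = [ffun=> 0%N] :> mindex d.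
  by apply/ffunP => i; rewrite !ffunE nth_nseq if_same.
have -> : Rd_of_seq (nseq_tuple d 0) = 0 :> Rd.
  by apply/rowP => i; rewrite !mxE nth_nseq if_same.
have -> : partials [ffun=> 0%N] phi = phi.
  by rewrite /partials; elim: (enum _) => [//|i l IH] /=; rewrite ffunE.
move=> <-; apply: eq_Rintegral => t _; rewrite /tensor prZ pr_lim; congr (_ * _).
  by apply: eq_bigr => i _; rewrite mxE.
apply: eq_limn; apply/funext => N; apply: eq_bigr => n _.
rewrite /shell (big_morph pr prD pr0); apply: eq_bigr => b _.
rewrite symb_term prZ FE mindex_of_seqK (sprod_of_seq (d := d)) ?size_of_mindex//.
by rewrite mindex_of_seqK.
Qed.

End Part.

Hypothesis phi_le : forall a x,
  `|complex.Re (partials a phi x)| <= Cp * (M (mlen a) / h ^+ mlen a) * \prod_(i < d) wgt (x 0 i) /\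
  `|complex.Im (partials a phi x)| <= Cp * (M (mlen a) / h ^+ mlen a) * \prod_(i < d) wgt (x 0 i).

(** Since [G] and the coefficients of the real derivatives are real, the identity
    splits into its real and imaginary parts. *)
Lemma udo_dual_tensor : udo_dual tensor_coef (regular (tensor G (fun=> 0%N))) phi = delta0 phi.
Proof.
rewrite /udo_dual /regular /integralRd /delta0.
have cp a := smooth_partials a sphi.
transitivity (complex.Re (phi 0) +i* complex.Im (phi 0))%C; last by case: (phi 0).
congr (_ +i* _)%C; [apply: (@dual_part (@complex.Re R))|apply: (@dual_part (@complex.Im R))] => //.
- by move=> a; have [] := cp a.
- by move=> a i x; split=> //; have [_ _ /(_ i x)[]] := cp a.
- by move=> a x; exact: (phi_le a x).1.
- by move=> [? ?] [? ?].
- by move=> a [u w]; rewrite /= mul0r subr0.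
- by move=> a; have [] := cp a.
- by move=> a i x; split=> //; have [_ _ /(_ i x)[]] := cp a.
- by move=> a x; exact: (phi_le a x).2.
- by move=> [? ?] [? ?].
- by move=> a [u w]; rewrite /= mul0r addr0.
Qed.

End Duality.

Section CoefBound.
Context {R : realType} {d : nat}.
Variables (M : nat -> R) (c0 H : R).
Hypotheses (M_gt0 : forall p, 0 < M p) (M0 : M 0%N = 1)
  (c0_ge1 : 1 <= c0) (H_ge1 : 1 <= H) (M_M2 : cond_M2 c0 H M).

Lemma M_le_prod (a : mindex d) :
  M (mlen a) <= c0 ^+ d * (H ^+ d) ^+ mlen a * \prod_i M (a i).
Proof.
have := M_sumn_le M_gt0 M0 c0_ge1 H_ge1 M_M2 (seq_of_mindex a).
rewrite sumn_of_mindex size_of_mindex -/(sprod M _) (sprod_of_seq (d := d)) ?size_of_mindex//.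
by rewrite mindex_of_seqK.
Qed.

Lemma prod_coef_le (c : nat -> R) C L : 0 < C -> 0 < L -> (forall m, 0 <= c m) ->
  (forall m, c m <= C * L ^+ m / M m) ->
  forall a : mindex d, \prod_i c (a i) <= (C * c0) ^+ d * (L * H ^+ d) ^+ mlen a / M (mlen a).
Proof.
move=> C0 L0 cp cC a.
have P0 : 0 < \prod_i M (a i) by exact: prodr_gt0.
apply: (@le_trans _ _ (C ^+ d * L ^+ mlen a / \prod_i M (a i))).
  apply: (@le_trans _ _ (\prod_i (C * L ^+ a i / M (a i)))).
    by apply: ler_prod => i _; rewrite cp cC.
  by rewrite !big_split/= prodr_const card_ord prodrXr -prodfV.
rewrite ler_pdivrMr// mulrAC ler_pdivlMr// !exprMn.
have := M_le_prod a; move: (M (mlen a)) (\prod_i M (a i)) => m P mP.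
have -> : C ^+ d * c0 ^+ d * (L ^+ mlen a * H ^+ d ^+ mlen a) * P =
  C ^+ d * L ^+ mlen a * (c0 ^+ d * H ^+ d ^+ mlen a * P) by ring.
by rewrite ler_wpM2l// mulr_ge0// exprn_ge0// ltW.
Qed.

End CoefBound.

(** * Existence of the fundamental solutions *)

Section Membership.
Context {R : realType} {d : nat}.
Variables (M : nat -> R).
Hypotheses (M_gt0 : forall p, 0 < M p) (M0 : M 0%N = 1)
  (M_M1 : cond_M1 M).

Section Weighted.
Variables (tau : nat -> R) (tau_gt0 : forall j, 0 < tau j)
  (tau_nd : forall i j, (i <= j)%N -> tau i <= tau j).

Lemma weighted_superM p q :
  (M p * \prod_(j < p) tau j) * (M q * \prod_(j < q) tau j) <=
  M (p + q)%N * \prod_(j < p + q) tau j.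
Proof.
rewrite mulrACA; apply: ler_pM; try by rewrite mulr_ge0 ?prodr_ge0// => *; exact: ltW.
  exact: M_superM.
rewrite big_split_ord/= ler_wpM2l//; first by apply: prodr_ge0 => j _; exact: ltW.
by apply: ler_prod => j _; rewrite ltW//= tau_nd// leq_addl.
Qed.

Variables (G : nat -> R -> R) (C kappa c1 : R) (W : 'rV[R]_d -> \bar R).
Hypotheses (jG : jet G) (C_ge0 : 0 <= C) (kappa_ge0 : 0 <= kappa) (c1_ge0 : 0 <= c1)
  (G_le : forall k x, `|G k x| <= C * (M k * \prod_(j < k) tau j) * expR (- (kappa * `|x|)))
  (W_le : forall x, (0 <= W x <= (c1 * expR (kappa * enorm x))%:E)%E).

(** [w] is the reciprocal of the growth allowed for the derivatives, so the
    supremum is bounded by a constant. *)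
Lemma tensor_sup_lty (w : nat -> R) :
  (forall p, w p * (M p * \prod_(j < p) tau j) = 1) -> (forall p, 0 <= w p) ->
  (ereal_sup [set ((w (mlen a))%:E * LooRd (fun x => W x *
     (Normc.normc (Dop a (tensor G (fun=> 0%N)) x))%:E))%E | a in [set: mindex d]] < +oo)%E.
Proof.
move=> wN w0; apply: (@le_lt_trans _ _ (c1 * C ^+ d)%:E); last exact: ltry.
apply: ge_ereal_sup => _ [a _ <-].
pose N p := M p * \prod_(j < p) tau j.
have N0 : N 0%N = 1 by rewrite /N M0 big_ord0 mulr1.
have Np p : 0 < N p by rewrite mulr_gt0// prodr_gt0.
have H := LooRd_tensor jG (N := N) N0 Np weighted_superM C_ge0 kappa_ge0 c1_ge0 G_le W_le a.
apply: le_trans (lee_wpmul2l _ H) _; first by rewrite lee_fin.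
by rewrite -EFinM lee_fin mulrCA /N wN mulr1.
Qed.

End Weighted.
End Membership.

Section TensorSolution.
Context {R : realType} {d : nat}.
Local Notation Rd := 'rV[R]_d.
Variables (M A : nat -> R) (c0 H : R) (tau : nat -> R) (kappa : R).
Hypotheses (M_gt0 : forall p, 0 < M p) (A_gt0 : forall p, 0 < A p) (M0 : M 0%N = 1)
  (M_M1 : cond_M1 M) (c0_ge1 : 1 <= c0) (H_ge1 : 1 <= H) (M_M2 : cond_M2 c0 H M)
  (M_M5 : cond_M5 M).
Hypotheses (tau_gt0 : forall j, 0 < tau j)
  (tau_nd : forall i j, (i <= j)%N -> tau i <= tau j) (kappa_ge0 : 0 <= kappa).

(** What the two cases share: they differ in [tau], in the weight [W] and in the
    choice of [X]. *)
Theorem tensor_fundamental_solution : exists (G : Rd -> R[i]) (c : mindex d -> R[i]),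
  [/\ smooth G,
      forall (W : Rd -> \bar R) c1 (w : nat -> R), 0 <= c1 ->
        (forall x, 0 <= W x <= (c1 * expR (kappa * enorm x))%:E)%E ->
        (forall p, w p * (M p * \prod_(j < p) tau j) = 1) -> (forall p, 0 <= w p) ->
        (ereal_sup [set ((w (mlen a))%:E * LooRd (fun x => W x *
          (Normc.normc (Dop a G x))%:E))%E | a in [set: mindex d]] < +oo)%E,
      exists2 L0, 0 < L0 & forall X J0, 0 < X ->
        (forall j, (J0 <= j)%N -> X <= tau j) -> exists2 C, 0 < C &
        forall a, Normc.normc (c a) <= C * (L0 / X) ^+ mlen a / M (mlen a) &
      forall phi h C, 0 < h -> S_h M A h phi ->
        (forall a, Normc.normc (c a) <= C * (h / 2) ^+ mlen a / M (mlen a)) ->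
        udo_dual c (regular G) phi = delta0 phi].
Proof.
have [G [c [jG [C C0 G_le] [c_0 c_ge0 c_odd] [L0 L00 c_le] [D D0 G_fund]]]] :=
  fundamental_solution_1d M_gt0 M0 M_M1 c0_ge1 H_ge1 M_M2 M_M5 tau_gt0 tau_nd kappa_ge0.
have G0_le x : `|G 0%N x| <= C.
  apply: (le_trans (G_le 0%N x)); rewrite M0 big_ord0 !mulr1 ler_piMr//.
  by rewrite -(@expR0 R) ler_expR oppr_le0 mulr_ge0.
exists (tensor G (fun=> 0%N)), (tensor_coef c); split.
- exact: smooth_tensor.
- by move=> W c1 w c10 W_le wN w0; exact: (tensor_sup_lty M_gt0 M0 M_M1 tau_gt0 tau_nd jG C0 kappa_ge0 c10 G_le).
- have Hd : 0 < H ^+ d by rewrite exprn_gt0// (lt_le_trans ltr01).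
  exists (L0 * H ^+ d); first exact: mulr_gt0.
  move=> X J0 X0 XJ; have [Cc Cc0 cC] := c_le X J0 X0 XJ.
  exists ((Cc * c0) ^+ d); first by rewrite exprn_gt0// mulr_gt0// (lt_le_trans ltr01).
  move=> a; rewrite normc_tensor_coef// [L0 * _ / X]mulrAC.
  by apply: (prod_coef_le M_gt0 M0 c0_ge1 H_ge1 M_M2 Cc0 _ c_ge0 cC); exact: divr_gt0.
- move=> phi h Ca h0 Sh c_Ca; have [Cp _ phi_le] := S_h_bound M_gt0 A_gt0 h0 Sh.
  apply: (udo_dual_tensor M_gt0 jG G0_le C0 D0 c_0 c_ge0 c_odd G_fund Sh.1 h0 _ phi_le).
  by move=> a; rewrite -normc_tensor_coef.
Qed.

End TensorSolution.

Theorem proposition2p2 (R : realType) (d : nat) (d_gt0 : (0 < d)%N)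
    (M A : nat -> R)
    (M_gt0 : forall p, 0 < M p) (A_gt0 : forall p, 0 < A p)
    (M0 : M 0%N = 1) (M1 : M 1%N = 1) (A0 : A 0%N = 1) (A1 : A 1%N = 1)
    (M_M1 : cond_M1 M) (A_M1 : cond_M1 A)
    (c0 H : R) (c0_ge1 : 1 <= c0) (H_ge1 : 1 <= H)
    (M_M2 : cond_M2 c0 H M) (A_M2 : cond_M2 c0 H A)
    (M_M5 : cond_M5 M) (A_M6 : cond_M6 A) :
  (forall t : R, 0 < t ->
     exists (G : 'rV[R]_d -> R[i]) (c : mindex d -> R[i]),
       [/\ S_h M A t G,
           udo_beurling M c &
           eq_dual (S_beurling M A) (udo_dual c (regular G)) (@delta0 R d)]) /\
  (forall t : nat -> R, frakR t ->
     exists (G : 'rV[R]_d -> R[i]) (c : mindex d -> R[i]),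
       [/\ S_r M A t G,
           udo_roumieu M c &
           eq_dual (S_roumieu M A) (udo_dual c (regular G)) (@delta0 R d)]).
Proof.
have [cA [LA [cA1 LA1 M6]]] := A_M6.
have cA0 : 0 <= cA by apply: le_trans cA1.
have LA0 : 0 < LA by apply: lt_le_trans LA1.
split.
(* Beurling case: [tau] is constant and the operator fixes the constant
   [L = L0 t]. *)
- move=> t t0; have tV : 0 < t^-1 by rewrite invr_gt0.
  have kappa_ge0 : 0 <= LA * t by rewrite mulr_ge0// ltW.
  have [G [c [sG Gfin [L0 L00 c_le] dual]]] :=
    tensor_fundamental_solution (d := d) (tau := fun=> t^-1) M_gt0 A_gt0 M0 M_M1 c0_ge1 H_ge1
      M_M2 M_M5 (fun=> tV) (fun _ _ _ => lexx _) kappa_ge0.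
  have [C C0 cC] := c_le t^-1 0%N tV (fun _ _ => lexx _).
  rewrite invrK in cC.
  have L_gt0 : 0 < L0 * t by exact: mulr_gt0.
  exists G, c; split; [split=> // | by exists (L0 * t), C; split | ].
  + apply: (Gfin _ cA (fun p => t ^+ p / M p)) => //.
    * move=> x; rewrite -mulrA -[LA]divr1; apply: (expeR_assoc_M6 A_gt0 cA1 LA1 M6) => //.
        by move=> p; rewrite expr1n mulr1.
      by rewrite mulr_ge0 ?sqrtr_ge0// ltW.
    * move=> p; rewrite prodr_const card_ord exprVn; have := M_gt0 p => /lt0r_neq0 ?.
      have ? : t ^+ p != 0 by rewrite expf_neq0// gt_eqF.
      by field; apply/andP; split.
    * by move=> p; rewrite divr_ge0 ?exprn_ge0// ltW.
  (* The test function belongs to the spaces of all parameters; [h = 2 L] is the one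
     that the coefficients can be paired with. *)
  + move=> phi Sphi; have h0 : 0 < 2 * (L0 * t) by rewrite mulr_gt0.
    apply: (dual phi _ C h0 (Sphi _ h0)) => a.
    by rewrite (mulrC 2) mulfK.
(* Roumieu case: [t] is indexed from 1 and tends to infinity, so every constant [L]
   is available; the test function then chooses [L = h / 2]. *)
- move=> t [t_gt0 t_nd t_cvg]; pose tau j := t j.+1.
  have tau_gt0 j : 0 < tau j by exact: t_gt0.
  have tau_nd i j : (i <= j)%N -> tau i <= tau j.
    by move=> /subnKC <-; elim: (j - i)%N => [|k /le_trans]; [rewrite addn0|apply; rewrite addnS; exact: t_nd].
  have kappa_ge0 : 0 <= LA / tau 0%N by rewrite divr_ge0// ltW.
  have [G [c [sG Gfin [L0 L00 c_le] dual]]] :=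
    tensor_fundamental_solution (d := d) M_gt0 A_gt0 M0 M_M1 c0_ge1 H_ge1
      M_M2 M_M5 tau_gt0 tau_nd kappa_ge0.
  have tpow p : \prod_(j < p) tau j = rprod t p by rewrite /rprod big_add1 big_mkord.
  have c_all : udo_roumieu M c.
    move=> L Lp; have X0 : 0 < L0 / L by exact: divr_gt0.
    have [J0 _ HJ] := (cvgryPge _).1 t_cvg (L0 / L).
    have [|C C0 cC] := c_le _ J0 X0; first by move=> j Jj; apply: HJ; exact: leq_trans (leqnSn j).
    by exists C => // a; rewrite invf_div mulrCA divff ?mulr1 ?gt_eqF// in cC.
  exists G, c; split => //.
  + split=> //; apply: (Gfin _ cA (fun p => (M p * rprod t p)^-1)) => //.
    * move=> x; apply: (expeR_assoc_M6 A_gt0 cA1 LA1 M6) => //; last exact: sqrtr_ge0.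
      move=> p; rewrite ler_wpM2l ?(ltW (A_gt0 p))// -tpow.
      rewrite -[X in _ ^+ X]card_ord -prodr_const; apply: ler_prod => j _.
      by rewrite ltW//= tau_nd.
    * by move=> p; rewrite tpow mulVf// -tpow gt_eqF// mulr_gt0// prodr_gt0.
    * by move=> p; rewrite invr_ge0 -tpow ltW// mulr_gt0// prodr_gt0.
  + move=> phi [h h0 Sh]; have [C _ cC] := c_all _ (divr_gt0 h0 (ltr0Sn R 1)).
    exact: dual h0 Sh cC.
Qed.
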